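(* Let $\mathcal{X}=\mathcal{X}^1\times\mathcal{X}^2$, $\mathcal{U}=\mathcal{U}^1\times\mathcal{U}^2$, and let $\mathcal{D}\subset\mathcal{F}\times\mathcal{E}$, $\mathcal{F}=\mathcal{E}'$, be the Stokes-Dirac structure given as the graph of the operator $\mathcal{J}\in\mathcal{L}(\mathcal{E},\mathcal{F})$ constructed in the context. Consider the port-Hamiltonian system without resistive port ($\mathcal{R}=\emptyset$) defined by $\mathcal{D}$ and by the Hamiltonian $\mathcal{H}(\alpha) = \frac12(\alpha,Q\alpha)_{\mathcal{X}}$, where $Q\in\mathcal{L}(\mathcal{X})$ is a self-adjoint positive-definite operator. Then for all $\alpha_0\in\mathcal{X}$ and all $u\in H^2_{\mathrm{loc}}([0,\infty);\mathcal{U})$ such that $\begin{pmatrix} Q\alpha_0 \\ u(0)\end{pmatrix}\in\mathcal{E}$, there exists a unique trajectory (that is, a unique pair of functions $(\alpha,y)$) satisfying $$\left(\begin{pmatrix}\dot\alpha(t) \\ -y(t)\end{pmatrix},\begin{pmatrix} Q\alpha(t) \\ u(t)\end{pmatrix}\right)\in\mathcal{C}([0,\infty);\mathcal{D}),\quad\text{with}\quad\alpha(0)=\alpha_0.$$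
   Context: Standing setting: - $\mathcal{X}^1$ and $\mathcal{X}^2$ are complex Hilbert spaces, identified with their respective duals; $\mathcal{X} := \mathcal{X}^1\times\mathcal{X}^2$. - $L$ is a closed and densely defined operator from $\mathcal{X}^1$ into $\mathcal{X}^2$ with domain $\mathcal{Z}^1$; $K$ is a closed and densely defined operator from $\mathcal{X}^2$ into $\mathcal{X}^1$ with domain $\mathcal{Z}^2$. The domains $\mathcal{Z}^1$, $\mathcal{Z}^2$ are Hilbert spaces for the respective graph norms, so that $L\in\mathcal{L}(\mathcal{Z}^1,\mathcal{X}^2)$ and $K\in\mathcal{L}(\mathcal{Z}^2,\mathcal{X}^1)$. Here $\mathcal{Z} := \mathcal{Z}^1\times\mathcal{Z}^2$. - $J := \begin{bmatrix} 0 & -K \\ L & 0\end{bmatrix}$, defined on $\mathcal{Z}^1\times\mathcal{Z}^2$ with values in $\mathcal{X}$. - $\mathcal{U}^1,\mathcal{U}^2$ are complex Hilbert spaces with topological duals $(\mathcal{U}^1)',(\mathcal{U}^2)'$, $\mathcal{U} := \mathcal{U}^1\times\mathcal{U}^2$; $\gamma^i\in\mathcal{L}(\mathcal{Z}^i,\mathcal{U}^i)$ for $i=1,2$, and $G := \begin{bmatrix}\gamma^1&0 \\ 0&\gamma^2\end{bmatrix}\in\mathcal{L}(\mathcal{Z}^1\times\mathcal{Z}^2,\mathcal{U}^1\times\mathcal{U}^2)$; $\beta^1\in\mathcal{L}(\mathcal{Z}^1,(\mathcal{U}^2)')$ and $\beta^2\in\mathcal{L}(\mathcal{Z}^2,(\mathcal{U}^1)')$.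 - Abstract Green's identity: for all $e^1\in\mathcal{Z}^1$ and $e^2\in\mathcal{Z}^2$, $$(Le^1,e^2)_{\mathcal{X}^2} = (e^1,Ke^2)_{\mathcal{X}^1} + \langle\gamma^1e^1,\beta^2e^2\rangle_{\mathcal{U}^1,(\mathcal{U}^1)'} + \langle\beta^1e^1,\gamma^2e^2\rangle_{(\mathcal{U}^2)',\mathcal{U}^2}.$$ - (1) $\gamma^i$ is onto, $i=1,2$; (2) $\mathcal{X}^i_1 := \ker\gamma^i$ is dense in $\mathcal{X}^i$, $i=1,2$; (3) either $\ker\gamma^1\cap\ker\beta^1$ is dense in $\mathcal{X}^1$ and $\beta^1$ restricted to $\mathcal{X}^1_1$ is onto $(\mathcal{U}^2)'$, or $\ker\gamma^2\cap\ker\beta^2$ is dense in $\mathcal{X}^2$ and $\beta^2$ restricted to $\mathcal{X}^2_1$ is onto $(\mathcal{U}^1)'$. Conventions: inner products and duality brackets are antilinear in the first variable and linear in the second; for a complex Hilbert space $\mathcal{V}$, $\langle f,v\rangle_{\mathcal{V}',\mathcal{V}}:=f(v)$, with the scalar multiplication of $\mathcal{V}'$ given by $(\lambda f)(v)=\overline{\lambda}f(v)$, and $\langle v,f\rangle_{\mathcal{V},\mathcal{V}'} := \overline{\langle f,v\rangle_{\mathcal{V}',\mathcal{V}}}$. Construction of $\mathcal{J}$: let $A := J|_{\mathcal{X}_1}$ with domain $\mathcal{X}_1 := \mathcal{X}^1_1\times\mathcal{X}^2_1$ (a skew-adjoint operator on $\mathcal{X}$), $\mathcal{X}_{-1}$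 the completion of $\mathcal{X}$ for the norm $\|(I-A)^{-1}\cdot\|_{\mathcal{X}}$, and $A|_{\mathcal{X}}\in\mathcal{L}(\mathcal{X},\mathcal{X}_{-1})$ the continuous extension of $A$; $\mathcal{X}^i_{-1}$ is the projection of $\mathcal{X}_{-1}$ on the $i$-th component. Let $B = \begin{bmatrix}0&B^2 \\ B^1&0\end{bmatrix}\in\mathcal{L}(\mathcal{U},\mathcal{X}_{-1})$, with $B^1\in\mathcal{L}(\mathcal{U}^1,\mathcal{X}^2_{-1})$, $B^2\in\mathcal{L}(\mathcal{U}^2,\mathcal{X}^1_{-1})$, be the unique control operator of the boundary control system $(J,G)$, i.e. $Jz = A|_{\mathcal{X}}z+BGz$ for all $z\in\mathcal{Z}$, and let $C := \begin{bmatrix}0&\beta^2 \\ \beta^1&0\end{bmatrix}\in\mathcal{L}(\mathcal{Z},\mathcal{U}')$. Set $$\mathcal{E} := \left\{\begin{pmatrix} e \\ u\end{pmatrix}\in\mathcal{X}\times\mathcal{U}\;\middle|\;A|_{\mathcal{X}}e+Bu\in\mathcal{X}\right\},\qquad \mathcal{J} := \begin{bmatrix}A|_{\mathcal{X}}&B \\ -C&0\end{bmatrix},\qquad \mathcal{F}:=\mathcal{E}',$$ where $\mathcal{E}$ carries the graph norm $\|(e,u)\|_{\mathcal{E}}^2=\|e\|_{\mathcal{X}}^2+\|u\|_{\mathcal{U}}^2+\|A|_{\mathcal{X}}e+Bu\|_{\mathcal{X}}^2$; the map $z\mapsto(z,Gz)$ is a bounded bijection from $\mathcal{Z}$ onto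 $\mathcal{E}$ (so $Ce$ makes sense for $(e,u)\in\mathcal{E}$), and $(x,v)\in\mathcal{X}\times\mathcal{U}'$ is regarded as an element of $\mathcal{F}$ through $\langle(x,v),(e,u)\rangle_{\mathcal{F},\mathcal{E}} := (x,e)_{\mathcal{X}}+\langle v,u\rangle_{\mathcal{U}',\mathcal{U}}$. Finally $\mathcal{D} := \{(\mathcal{J}e,e)\mid e\in\mathcal{E}\}\subset\mathcal{F}\times\mathcal{E}$. It is a Stokes-Dirac structure: $\mathcal{D}$ equals the set of all $(f^1,e^1)\in\mathcal{F}\times\mathcal{E}$ such that $\overline{\langle f^1,e^2\rangle_{\mathcal{F},\mathcal{E}}}+\langle f^2,e^1\rangle_{\mathcal{F},\mathcal{E}}=0$ for all $(f^2,e^2)\in\mathcal{D}$. A trajectory is a pair $(\alpha,y)$ with $\alpha:[0,\infty)\to\mathcal{X}$ differentiable (derivative $\dot\alpha$) and $y:[0,\infty)\to\mathcal{U}'$; $Q\alpha$ is the variational derivative of $\mathcal{H}$ at $\alpha$. $\mathcal{C}([0,\infty);\mathcal{D})$ is the space of continuous functions with values in $\mathcal{D}\subset\mathcal{F}\times\mathcal{E}$.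
   Formalization: ''Positive-definite'' Q is taken to mean coercive, (x,Qx) ≥ c‖x‖² for some c > 0; with only (x,Qx) > 0 for x ≠ 0 the range of Q can meet the domain of J too little and existence fails. *)

(* Defs.v *)
From HB Require Import structures.
From mathcomp Require Import all_boot all_order all_algebra.
From mathcomp Require Import complex ring.
From mathcomp Require Import all_classical all_reals all_analysis.

Set Implicit Arguments.
Unset Strict Implicit.
Unset Printing Implicit Defensive.

Import Order.TTheory GRing.Theory Num.Theory.
Import numFieldNormedType.Exports.

Local Open Scope classical_set_scope.
Local Open Scope complex_scope.
Local Open Scope ring_scope.

(* Complex Hilbert spaces over [R[i]], for an arbitrary model [R] of the reals.
   Inner products are antilinear in the first variable and linear in the
   second. *)
HB.mixin Record isHilbert (R : realType) V & CompleteNormedModule R[i] V := {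
  inner : V -> V -> R[i] ;
  inner_linear : forall x, linear_for *%R (inner x) ;
  innerC : forall x y, inner y x = Num.conj (inner x y) ;
  inner_norm : forall x, inner x x = `|x| ^+ 2
}.

#[short(type="hilbertType")]
HB.structure Definition Hilbert (R : realType) :=
  {V of CompleteNormedModule R[i] V & isHilbert R V}.

Section minkowski.
Variable C : numClosedFieldType.
Implicit Types a b c d : C.

Definition hypot a b : C := sqrtC (a ^+ 2 + b ^+ 2).

Lemma hypot_sqr a b : hypot a b ^+ 2 = a ^+ 2 + b ^+ 2.
Proof. exact: sqrtCK. Qed.

Lemma hypot_ge0 a b : 0 <= a -> 0 <= b -> 0 <= hypot a b.
Proof. by move=> a0 b0; rewrite sqrtC_ge0 addr_ge0 ?exprn_ge0. Qed.

Lemma hypot_eq0 a b : 0 <= a -> 0 <= b -> hypot a b = 0 -> a = 0 /\ b = 0.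
Proof.
move=> a0 b0 /eqP; rewrite sqrtC_eq0 paddr_eq0 ?exprn_ge0// !sqrf_eq0.
by case/andP => /eqP-> /eqP->.
Qed.

Lemma ler_hypotl a b : 0 <= a -> 0 <= b -> a <= hypot a b.
Proof.
move=> a0 b0; rewrite -(@ler_pXn2r _ 2) ?nnegrE ?hypot_ge0// hypot_sqr.
by rewrite lerDl exprn_ge0.
Qed.

Lemma ler_hypotr a b : 0 <= a -> 0 <= b -> b <= hypot a b.
Proof. by move=> a0 b0; rewrite /hypot addrC ler_hypotl. Qed.

Lemma hypotD a b c d : 0 <= a -> 0 <= b -> 0 <= c -> 0 <= d ->
  hypot (a + c) (b + d) <= hypot a b + hypot c d.
Proof.
move=> a0 b0 c0 d0.
have h1 := hypot_ge0 a0 b0; have h2 := hypot_ge0 c0 d0.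
rewrite -(@ler_pXn2r _ 2) ?nnegrE ?addr_ge0 ?hypot_ge0 ?addr_ge0//.
rewrite hypot_sqr [leRHS]sqrrD !hypot_sqr.
have cs : a * c + b * d <= hypot a b * hypot c d.
  rewrite -(@ler_pXn2r _ 2) ?nnegrE ?addr_ge0 ?mulr_ge0//.
  rewrite exprMn !hypot_sqr -subr_ge0.
  have -> : (a ^+ 2 + b ^+ 2) * (c ^+ 2 + d ^+ 2) - (a * c + b * d) ^+ 2 =
    (a * d - b * c) ^+ 2 by ring.
  by rewrite real_exprn_even_ge0// rpredB// ger0_real// mulr_ge0.
rewrite -subr_ge0.
set l := (X in 0 <= X).
have -> : l = (hypot a b * hypot c d - (a * c + b * d)) *+ 2.
  by rewrite /l; ring.
by rewrite mulrn_wge0// subr_ge0.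
Qed.

Lemma hypotM k a b : 0 <= k -> 0 <= a -> 0 <= b ->
  hypot (k * a) (k * b) = k * hypot a b.
Proof.
move=> k0 a0 b0; rewrite /hypot !exprMn -mulrDr sqrtCM ?nnegrE ?exprn_ge0//.
  by rewrite sqrCK.
by rewrite addr_ge0 ?exprn_ge0.
Qed.

Lemma ler_hypot a b c d : 0 <= a -> 0 <= b -> a <= c -> b <= d ->
  hypot a b <= hypot c d.
Proof.
move=> a0 b0 ac bd.
have [c0 d0] := (le_trans a0 ac, le_trans b0 bd).
rewrite -(@ler_pXn2r _ 2) ?nnegrE ?hypot_ge0// !hypot_sqr.
by rewrite lerD// ler_pXn2r ?nnegrE.
Qed.

End minkowski.

(* The type [V * W] already carries the (equivalent) sup norm, so the
   Hilbertian product norm needs an alias. *)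
Definition hprod (V W : Type) := (V * W)%type.

Section hprod_normed.
Variables (R : realType) (V W : normedModType R[i]).

HB.instance Definition _ := GRing.Lmodule.copy (hprod V W) (V * W)%type.

Definition hprod_norm (x : hprod V W) : R[i] := hypot `|x.1| `|x.2|.

Let hprod_normD x y : hprod_norm (x + y) <= hprod_norm x + hprod_norm y.
Proof.
apply: (le_trans (ler_hypot _ _ (ler_normD _ _) (ler_normD _ _))) => //.
exact: hypotD.
Qed.

Let hprod_normZ (k : R[i]) x : hprod_norm (k *: x) = `|k| * hprod_norm x.
Proof. by rewrite /hprod_norm !normrZ hypotM. Qed.

Let hprod_norm0_eq0 x : hprod_norm x = 0 -> x = 0.
Proof.
case: x => x y /hypot_eq0[]//= /normr0_eq0 -> /normr0_eq0 -> //.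
Qed.

HB.instance Definition _ := Lmodule_isNormed.Build R[i] (hprod V W)
  hprod_normD hprod_normZ hprod_norm0_eq0.

Lemma hprod_normE (x : hprod V W) : `|x| = hypot `|x.1| `|x.2|.
Proof. by []. Qed.

End hprod_normed.

Section hprod_hilbert.
Variables (R : realType) (V W : hilbertType R).

Let hprod_complete (F : set_system (hprod V W)) :
  ProperFilter F -> cauchy F -> cvg F.
Proof.
move=> FF /cauchyP Fc.
have c1 : cvg ((fst : hprod V W -> V) @ F).
  apply: cauchy_cvg; apply: cauchy_exP => e /Fc[z Fz]; exists z.1.
  rewrite /nbhs/= -ball_normE; move: Fz; rewrite -ball_normE; apply: filterS => y.
  by apply: le_lt_trans; exact: ler_hypotl.
have c2 : cvg ((snd : hprod V W -> W) @ F).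
  apply: cauchy_cvg; apply: cauchy_exP => e /Fc[z Fz]; exists z.2.
  rewrite /nbhs/= -ball_normE; move: Fz; rewrite -ball_normE; apply: filterS => y.
  by apply: le_lt_trans; exact: ler_hypotr.
move/cvg_ex : c1 => [a /cvgrPdist_lt Fa]; move/cvg_ex : c2 => [b /cvgrPdist_lt Fb].
apply/cvg_ex; exists (a, b); apply/fcvgrPdist_lt => e e0.
have e20 : 0 < e / 2 by rewrite divr_gt0.
near=> y; rewrite hprod_normE/=.
have ya : `|a - y.1| < e / 2 by near: y; exact: Fa.
have yb : `|b - y.2| < e / 2 by near: y; exact: Fb.
rewrite (le_lt_trans (_ : _ <= `|a - y.1| + `|b - y.2|))//.
  rewrite -(@ler_pXn2r _ 2) ?nnegrE ?addr_ge0 ?hypot_ge0//.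
  by rewrite hypot_sqr sqrrD addrAC lerDl mulrn_wge0// mulr_ge0.
by rewrite [e]splitr ltrD.
Unshelve. all: by end_near. Qed.

HB.instance Definition _ :=
  Uniform_isComplete.Build (hprod V W) hprod_complete.

Definition hprod_inner (x y : hprod V W) : R[i] :=
  inner x.1 y.1 + inner x.2 y.2.

Let hprod_inner_linear x : linear_for *%R (hprod_inner x).
Proof.
move=> a y z; rewrite /hprod_inner /= !inner_linear mulrDr.
by rewrite addrACA.
Qed.

Let hprod_innerC x y : hprod_inner y x = Num.conj (hprod_inner x y).
Proof. by rewrite /hprod_inner rmorphD/= -!innerC. Qed.

Let hprod_inner_norm x : hprod_inner x x = `|x| ^+ 2.
Proof. by rewrite hprod_normE hypot_sqr /hprod_inner !inner_norm. Qed.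

HB.instance Definition _ := isHilbert.Build R (hprod V W)
  hprod_inner_linear hprod_innerC hprod_inner_norm.

End hprod_hilbert.

(* Unbounded operators; the value of [op_fun] outside [op_dom] is junk. *)
Record operator (R : realType) (V W : lmodType R[i]) := Operator {
  op_dom : set V ;
  op_fun :> V -> W ;
  op_dom0 : op_dom 0 ;
  op_domP : forall a x y, op_dom x -> op_dom y -> op_dom (a *: x + y) ;
  op_linear : forall a x y, op_dom x -> op_dom y ->
    op_fun (a *: x + y) = a *: op_fun x + op_fun y
}.

(* The domain of an operator, normed by its graph norm. *)
Section graph_space.
Variables (R : realType) (V W : normedModType R[i]) (T : operator V W).

Definition dom_pred : {pred V} := fun x => x \in op_dom T.

Let dom_submod_closed : submod_closed dom_pred.
Proof.
split; first by rewrite unfold_in /dom_pred inE; exact: op_dom0.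
by move=> a x y; rewrite !unfold_in /dom_pred !inE; exact: op_domP.
Qed.

HB.instance Definition _ := GRing.isSubmodClosed.Build R[i] V dom_pred
  dom_submod_closed.

Record graph_space := GraphSpace {
  gval :> V ;
  gvalP : gval \in dom_pred
}.

HB.instance Definition _ := [isSub for gval].
HB.instance Definition _ := [Choice of graph_space by <:].
HB.instance Definition _ := [SubChoice_isSubLmodule of graph_space by <:].

Lemma graph_space_dom (z : graph_space) : op_dom T (val z).
Proof. by have := gvalP z; rewrite unfold_in /dom_pred inE. Qed.

Definition graph_norm (z : graph_space) : R[i] := hypot `|val z| `|T (val z)|.

Lemma op0 : T 0 = 0.
Proof.
have := op_linear 1 (op_dom0 T) (op_dom0 T).
by rewrite scale1r addr0 scale1r => /eqP; rewrite -subr_eq0 opprD addNKr oppr_eq0 => /eqP.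
Qed.

Let graph_normD x y : graph_norm (x + y) <= graph_norm x + graph_norm y.
Proof.
rewrite /graph_norm; have := op_linear 1 (graph_space_dom x) (graph_space_dom y).
rewrite !scale1r raddfD/= => ->.
apply: (le_trans (ler_hypot _ _ (ler_normD _ _) (ler_normD _ _))) => //.
exact: hypotD.
Qed.

Let graph_normZ (k : R[i]) x : graph_norm (k *: x) = `|k| * graph_norm x.
Proof.
rewrite /graph_norm; have := op_linear k (graph_space_dom x) (op_dom0 T).
by rewrite linearZ/= !addr0 op0 addr0 => ->; rewrite !normrZ hypotM.
Qed.

Let graph_norm0_eq0 x : graph_norm x = 0 -> x = 0.
Proof.
by case/hypot_eq0 => // /normr0_eq0 x0 _; apply: val_inj; rewrite x0 raddf0.
Qed.

HB.instance Definition _ := Lmodule_isNormed.Build R[i] graph_space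
  graph_normD graph_normZ graph_norm0_eq0.

Lemma graph_normE (z : graph_space) : `|z| = hypot `|val z| `|T (val z)|.
Proof. by []. Qed.

End graph_space.

(* The topological dual: continuous linear functionals with the operator norm
   and the conjugated scalar multiplication [(a *: f) v = a^* * f v]. *)
Section dual.
Variables (R : realType) (V : normedModType R[i]).

Definition dual_pred : {pred (V -> R[i]^o)} :=
  fun f => `[< linear f /\ continuous f >].

Record dual := Dual {
  dual_fun :> V -> R[i]^o ;
  dual_funP : dual_fun \in dual_pred
}.

HB.instance Definition _ := [isSub for dual_fun].
HB.instance Definition _ := [Choice of dual by <:].

Lemma dual_linear (f : dual) : linear f.
Proof. by have := dual_funP f; rewrite unfold_in => /asboolP[]. Qed.

Lemma dual_continuous (f : dual) : continuous f.
Proof. by have := dual_funP f; rewrite unfold_in => /asboolP[]. Qed.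

Let dual_zmod_closed : zmod_closed dual_pred.
Proof.
split => [|f g]; rewrite !unfold_in.
  apply/asboolP; split; first by move=> a x y; rewrite /= scaler0 addr0.
  by move=> x; exact: cvg_cst.
move=> /asboolP[lf cf] /asboolP[lg cg]; apply/asboolP; split.
  move=> a x y; rewrite !fctE lf lg opprD addrACA.
  by rewrite scalerBr.
by move=> x; apply: cvgB; [exact: cf|exact: cg].
Qed.

HB.instance Definition _ := GRing.isZmodClosed.Build _ dual_pred
  dual_zmod_closed.
HB.instance Definition _ := [SubChoice_isSubZmodule of dual by <:].

Let dual_scale_subproof (a : R[i]) (f : dual) :
  (fun v => Num.conj a * f v : R[i]^o) \in dual_pred.
Proof.
rewrite unfold_in; apply/asboolP; split.
  move=> b x y; rewrite dual_linear mulrDr; congr (_ + _).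
  by rewrite /GRing.scale/= mulrCA.
move=> x; apply: (@cvgZr _ R[i]^o).
exact: dual_continuous.
Qed.

Definition dual_scale (a : R[i]) (f : dual) : dual :=
  Dual (dual_scale_subproof a f).

Let dual_scaleA a b f : dual_scale a (dual_scale b f) = dual_scale (a * b) f.
Proof. by apply: val_inj; apply/funext => v /=; rewrite rmorphM mulrA. Qed.

Let dual_scale1 : left_id 1 dual_scale.
Proof. by move=> f; apply: val_inj; apply/funext => v /=; rewrite rmorph1 mul1r. Qed.

Let dual_scaleDr : right_distributive dual_scale +%R.
Proof. by move=> a f g; apply: val_inj; apply/funext => v /=; rewrite mulrDr. Qed.

Let dual_scaleDl f : {morph dual_scale^~ f : a b / a + b}.
Proof.
by move=> a b; apply: val_inj; apply/funext => v /=; rewrite rmorphD mulrDl.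
Qed.

HB.instance Definition _ := GRing.Zmodule_isLmodule.Build R[i] dual
  dual_scaleA dual_scale1 dual_scaleDr dual_scaleDl.

HB.instance Definition _ (f : dual) :=
  GRing.isLinear.Build R[i] V R[i]^o *:%R (dual_fun f) (dual_linear f).

Definition dual_norm (f : dual) : R[i] :=
  (sup [set complex.Re `|f v| | v in [set v : V | `|v| <= 1]])%:C.

Let Re_normE (W : normedModType R[i]) (w : W) : (complex.Re `|w|)%:C = `|w|.
Proof. by rewrite RRe_real// normr_real. Qed.

Let dual_ball (f : dual) :=
  [set complex.Re `|f v| | v in [set v : V | `|v| <= 1]].

Let dual_has_sup (f : dual) : has_sup (dual_ball f).
Proof.
split; first by exists (complex.Re `|f 0|), 0 => //=; rewrite normr0 ler01.
have /linear_bounded_continuous/linear_boundedP/pinfty_ex_gt0[M M0 fM] :=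
  @dual_continuous f.
exists (complex.Re M) => _ [v v1 <-].
rewrite -lecR Re_normE RRe_real ?gtr0_real//.
by rewrite (le_trans (fM _))// ler_piMr// ltW.
Qed.

Let dual_norm_ball (f : dual) v : `|v| <= 1 -> `|f v| <= dual_norm f.
Proof.
move=> v1; rewrite -Re_normE lecR.
by apply: ub_le_sup; [case: (dual_has_sup f)|exists v].
Qed.

Let dual_norm_le (f : dual) (M : R[i]) :
  (forall v, `|v| <= 1 -> `|f v| <= M) -> dual_norm f <= M.
Proof.
move=> fM.
have M0 : 0 <= M by apply: le_trans (fM 0 _); rewrite ?normr0.
rewrite -[leRHS]RRe_real ?ger0_real// lecR.
apply: ge_sup; first by case: (dual_has_sup f).
by move=> _ [v v1 <-]; rewrite -lecR Re_normE RRe_real ?ger0_real//; exact: fM.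
Qed.

Let dual_normD f g : dual_norm (f + g) <= dual_norm f + dual_norm g.
Proof.
apply: dual_norm_le => v v1; apply: le_trans (ler_normD _ _) _.
by apply: lerD; exact: dual_norm_ball.
Qed.

Let dual_normZ_le (a : R[i]) f : dual_norm (a *: f) <= `|a| * dual_norm f.
Proof.
apply: dual_norm_le => v v1; rewrite /= normrM norm_conjC.
by rewrite ler_wpM2l// dual_norm_ball.
Qed.

Let dual_norm_ge0 f : 0 <= dual_norm f.
Proof. by apply: le_trans (dual_norm_ball f (v := 0) _); rewrite ?normr0. Qed.

Let dual_normZ (a : R[i]) f : dual_norm (a *: f) = `|a| * dual_norm f.
Proof.
apply/eqP; rewrite eq_le dual_normZ_le/=.
have [->|a0] := eqVneq a 0; first by rewrite normr0 mul0r dual_norm_ge0.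
rewrite -ler_pdivlMl ?normr_gt0// -normfV.
by rewrite (le_trans _ (dual_normZ_le _ _))// scalerA mulVf// scale1r.
Qed.

Let dual_norm0_eq0 f : dual_norm f = 0 -> f = 0.
Proof.
move=> f0; apply: val_inj; apply/funext => v /=.
have [->|v0] := eqVneq v 0; first by rewrite (linear0 f).
have := @dual_norm_ball f (`|v|^-1 *: v); rewrite f0 normfZV// lexx => /(_ isT).
rewrite normr_le0 linearZ/= scaler_eq0 invr_eq0 normr_eq0 (negbTE v0)/=.
by move/eqP.
Qed.

HB.instance Definition _ := Lmodule_isNormed.Build R[i] dual
  dual_normD dual_normZ dual_norm0_eq0.

Lemma dual_normE (f : dual) : `|f| = dual_norm f.
Proof. by []. Qed.

End dual.

Section continuity.
Variable R : realType.

Let lipschitz_cvg (V W : normedModType R[i]) (f : V -> W) M : 0 <= M ->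
  (forall x y, `|f x - f y| <= M * `|x - y|) -> continuous f.
Proof.
move=> M0 fM x; apply/cvgrPdist_lt => e e0.
have M1 : 0 < M + 1 by rewrite ltr_wpDl.
near=> y; apply: (le_lt_trans (fM _ _)).
apply: (@le_lt_trans _ _ ((M + 1) * `|x - y|)).
  by rewrite ler_wpM2r// lerDl.
rewrite -ltr_pdivlMl//; near: y; apply: cvgr_dist_lt => //.
by rewrite mulr_gt0// invr_gt0.
Unshelve. all: by end_near. Qed.

Lemma hprod_fst_continuous (V W : normedModType R[i]) :
  continuous (fst : hprod V W -> V).
Proof.
by apply: (@lipschitz_cvg _ _ _ 1) => // x y; rewrite mul1r; exact: ler_hypotl.
Qed.

Lemma hprod_snd_continuous (V W : normedModType R[i]) :
  continuous (snd : hprod V W -> W).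
Proof.
by apply: (@lipschitz_cvg _ _ _ 1) => // x y; rewrite mul1r; exact: ler_hypotr.
Qed.

Lemma gval_continuous (V W : normedModType R[i]) (T : operator V W) :
  continuous (val : graph_space T -> V).
Proof.
apply: (@lipschitz_cvg _ _ _ 1) => // x y.
by rewrite mul1r -raddfB graph_normE ler_hypotl.
Qed.

Lemma innerZr (V : hilbertType R) (x y : V) a : inner x (a *: y) = a * inner x y.
Proof.
have := inner_linear x a y 0; have := inner_linear x 1 0 0.
rewrite scaler0 !addr0 mul1r => /eqP.
by rewrite -subr_eq0 opprD addNKr oppr_eq0 => /eqP ->; rewrite addr0.
Qed.

Lemma innerBr (V : hilbertType R) (x y z : V) :
  inner x (y - z) = inner x y - inner x z.
Proof.
by have := inner_linear x 1 y (- z); rewrite scale1r mul1r -scaleN1r innerZr mulN1r.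
Qed.

Lemma cauchy_schwarz (V : hilbertType R) (x y : V) :
  `|inner x y| <= `|x| * `|y|.
Proof.
have [->|xn0] := eqVneq x 0.
  rewrite innerC; have := innerZr y 0 0.
  by rewrite scaler0 mul0r => ->; rewrite rmorph0 !normr0 mul0r.
have x0 : 0 < `|x| ^+ 2 by rewrite exprn_gt0// normr_gt0.
pose a := inner x y; pose z := `|x| ^+ 2 *: y - a *: x.
have xz : inner x z = 0 by rewrite innerBr !innerZr inner_norm mulrC subrr.
have zx : inner z x = 0 by rewrite innerC xz rmorph0.
have zy : inner z y = `|x| ^+ 2 * `|y| ^+ 2 - `|a| ^+ 2.
  rewrite innerC innerBr !innerZr inner_norm [inner y x]innerC -/a -normCK.
  by rewrite conj_Creal// rpredB ?rpredM ?rpredX ?normr_real.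
have := inner_norm z; rewrite {2}/z innerBr !innerZr zx zy mulr0 subr0 => zz.
have : 0 <= `|z| ^+ 2 by rewrite exprn_ge0.
rewrite -zz pmulr_rge0// subr_ge0 -exprMn => h.
by rewrite -(@ler_pXn2r _ 2) ?nnegrE ?mulr_ge0.
Qed.

Lemma inner_continuous (V : hilbertType R) (x : V) :
  continuous (inner x : V -> R[i]^o).
Proof.
apply: (@lipschitz_cvg _ _ _ `|x|) => // y z.
by rewrite -innerBr cauchy_schwarz.
Qed.

End continuity.

Section operators.
Variable R : realType.

Definition graph (V W : lmodType R[i]) (T : operator V W) : set (V * W) :=
  [set p | op_dom T p.1 /\ p.2 = T p.1].

Definition closed_op (V W : normedModType R[i]) (T : operator V W) :=
  closed (graph T).

Definition adjoint_graph (V W : hilbertType R) (T : operator V W) :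
    set (W * V) :=
  [set p | forall x, op_dom T x -> inner p.1 (T x) = inner p.2 x].

Definition skew_adjoint (V : hilbertType R) (T : operator V V) :=
  dense (op_dom T) /\ adjoint_graph T = [set p | graph T (p.1, - p.2)].

(* [(I - T)^-1 x]; the default [0] is irrelevant when [I - T] is bijective. *)
Definition resolvent1 (V : normedModType R[i]) (T : operator V V) (x : V) : V :=
  xget 0 [set z | op_dom T z /\ z - T z = x].

Definition resolvent_norm (V : normedModType R[i]) (T : operator V V) (x : V) :
  R[i] := `|resolvent1 T x|.

(* A completion of [V] for the norm [N]. *)
Record completion (V : lmodType R[i]) (N : V -> R[i]) := Completion {
  cpl_space :> completeNormedModType R[i] ;
  cpl_emb : {linear V -> cpl_space} ;
  cpl_emb_inj : injective cpl_emb ;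
  cpl_emb_dense : dense (range cpl_emb) ;
  cpl_emb_norm : forall x, `|cpl_emb x| = N x
}.

End operators.

Section duality.
Variable R : realType.

Let continuousD_fun (T : topologicalType) (f g : T -> R[i]^o) :
  continuous f -> continuous g -> continuous (fun x => f x + g x).
Proof. by move=> cf cg x; apply: cvgD; [exact: cf|exact: cg]. Qed.

Let continuous_comp_fun (T T' : topologicalType) (f : T -> T') (g : T' -> R[i]^o) :
  continuous f -> continuous g -> continuous (fun x => g (f x)).
Proof. by move=> cf cg x; apply: continuous_comp; [exact: cf|exact: cg]. Qed.

Let dual_pair_subproof (V W : normedModType R[i]) (f : dual V) (g : dual W) :
  (fun v : hprod V W => f v.1 + g v.2) \in @dual_pred R (hprod V W).
Proof.
rewrite unfold_in; apply/asboolP; split.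
  by move=> a x y /=; rewrite !linearP scalerDr addrACA.
apply: continuousD_fun; apply: continuous_comp_fun.
- exact: hprod_fst_continuous.
- exact: dual_continuous.
- exact: hprod_snd_continuous.
- exact: dual_continuous.
Qed.

Definition dual_pair (V W : normedModType R[i]) (f : dual V) (g : dual W) :
  dual (hprod V W) := Dual (dual_pair_subproof f g).

Let flow_subproof (X : hilbertType R) (U Y : normedModType R[i])
    (T : operator (hprod X U) Y) (x : X) (v : dual U) :
  (fun e : graph_space T => inner x (val e).1 + v (val e).2)
    \in @dual_pred R (graph_space T).
Proof.
rewrite unfold_in; apply/asboolP; split.
  move=> a y z; rewrite linearP/= inner_linear linearP.
  by rewrite scalerDr addrACA.
apply: continuousD_fun.
  exact: (continuous_comp_fun (@gval_continuous _ _ _ T)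
    (continuous_comp_fun (@hprod_fst_continuous _ X U) (@inner_continuous _ X x))).
exact: (continuous_comp_fun (@gval_continuous _ _ _ T)
  (continuous_comp_fun (@hprod_snd_continuous _ X U) (@dual_continuous _ _ v))).
Qed.

(* [(x, v)] in [X * U'] seen as a continuous linear functional on the domain of
   [T]. *)
Definition flow (X : hilbertType R) (U Y : normedModType R[i])
    (T : operator (hprod X U) Y) (x : X) (v : dual U) : dual (graph_space T) :=
  Dual (flow_subproof T x v).

End duality.

Section system.
Variables (R : realType) (X1 X2 U1 U2 : hilbertType R).
Variables (L : operator X1 X2) (K : operator X2 X1).
Variables (gamma1 : {linear graph_space L -> U1}).
Variables (gamma2 : {linear graph_space K -> U2}).
Variables (beta1 : {linear graph_space L -> dual U2}).
Variables (beta2 : {linear graph_space K -> dual U1}).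

Local Notation X := (hprod X1 X2).
Local Notation U := (hprod U1 U2).
Local Notation Z := (hprod (graph_space L) (graph_space K)).

Definition Zval (z : Z) : X := (val z.1, val z.2).

(* The block operators [[0, -K], [L, 0]], [[gamma1, 0], [0, gamma2]] and
   [[0, beta2], [beta1, 0]]; [J] is meaningful on the range of [Zval] only. *)
Definition J (x : X) : X := (- K x.2, L x.1).

Definition G (z : Z) : U := (gamma1 z.1, gamma2 z.2).

Definition C (z : Z) : dual U := dual_pair (beta2 z.2) (beta1 z.1).

Let A_dom : set X := [set Zval z | z in [set z | G z = 0]].

Let A_dom0 : A_dom 0.
Proof. by exists 0 => //=; rewrite /G /= !linear0. Qed.

Let A_domP a x y : A_dom x -> A_dom y -> A_dom (a *: x + y).
Proof.
move=> [z Gz <-] [w Gw <-]; exists (a *: z + w).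
  move: Gz Gw => [z1 z2] [w1 w2].
  by rewrite /= /G /= !linearP z1 z2 w1 w2 !scaler0 !addr0.
congr pair; exact: (linearP (val : graph_space _ -> _)).
Qed.

Let A_linear a x y : A_dom x -> A_dom y -> J (a *: x + y) = a *: J x + J y.
Proof.
move=> [z _ <-] [w _ <-]; rewrite /J /=.
rewrite !op_linear; try exact: graph_space_dom.
by rewrite opprD -scalerN.
Qed.

(* The restriction of [J] to [ker gamma1 * ker gamma2]. *)
Definition A : operator X X := Operator A_dom0 A_domP A_linear.

End system.

Section node.
Variables (R : realType) (X U : normedModType R[i]) (N : X -> R[i]).
Variables (Xm1 : completion N) (Aext : {linear X -> Xm1}) (B : {linear U -> Xm1}).

Let node_dom : set (hprod X U) :=
  [set e | range (cpl_emb Xm1) (Aext e.1 + B e.2)].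

Let node_fun (e : hprod X U) : X :=
  xget 0 [set x | cpl_emb Xm1 x = Aext e.1 + B e.2].

Let node_funE e : node_dom e -> cpl_emb Xm1 (node_fun e) = Aext e.1 + B e.2.
Proof.
by case=> x _ xe; rewrite /node_fun; case: xgetP => // /(_ x).
Qed.

Let node_dom0 : node_dom 0.
Proof. by exists 0 => //; rewrite !linear0 addr0. Qed.

Let node_domP a e f : node_dom e -> node_dom f -> node_dom (a *: e + f).
Proof.
move=> [x _ xe] [y _ yf]; exists (a *: x + y) => //.
by rewrite !linearP/= xe yf scalerDr addrACA.
Qed.

Let node_linear a e f : node_dom e -> node_dom f ->
  node_fun (a *: e + f) = a *: node_fun e + node_fun f.
Proof.
move=> de df; apply: (@cpl_emb_inj _ _ _ Xm1).
rewrite linearP !node_funE//; last exact: node_domP.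
by rewrite !linearP/= scalerDr addrACA.
Qed.

(* The operator [(e, u) |-> Aext e + B u] from [X * U] to [X], whose domain
   consists of the [(e, u)] with [Aext e + B u] in [X]. *)
Definition node : operator (hprod X U) X :=
  Operator node_dom0 node_domP node_linear.

End node.

Section stokes_dirac.
Variables (R : realType) (X1 X2 U1 U2 : hilbertType R).
Variables (L : operator X1 X2) (K : operator X2 X1).
Variables (beta1 : {linear graph_space L -> dual U2}).
Variables (beta2 : {linear graph_space K -> dual U1}).

Local Notation X := (hprod X1 X2).
Local Notation U := (hprod U1 U2).
Local Notation Z := (hprod (graph_space L) (graph_space K)).

Variables (N : X -> R[i]) (Xm1 : completion N).
Variables (Aext : {linear X -> Xm1}) (B : {linear U -> Xm1}).

Local Notation E := (graph_space (node Aext B)).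
Local Notation F := (dual E).

(* Inverse of [Zval] on its range; the default [0] is irrelevant there. *)
Definition toZ (x : X) : Z := (insubd 0 x.1, insubd 0 x.2).

(* The block operator [[Aext, B], [-C, 0]]. *)
Definition calJ (e : E) : F :=
  flow (node Aext B) (node Aext B (val e)) (- C beta1 beta2 (toZ (val e).1)).

Definition stokes_dirac : set (F * E) := [set (calJ e, e) | e in [set: E]].

End stokes_dirac.
Arguments stokes_dirac {R X1 X2 U1 U2 L K} beta1 beta2 {N Xm1} Aext B _.

Section components.
Variables (R : realType) (X1 X2 : hilbertType R).
Variables (N : hprod X1 X2 -> R[i]) (Xm1 : completion N).

(* The completions of [X1] and [X2], as closed subspaces of that of
   [X1 * X2]. *)
Definition cpl_comp1 : set Xm1 :=
  closure [set cpl_emb Xm1 ((x, 0) : hprod X1 X2) | x in [set: X1]].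

Definition cpl_comp2 : set Xm1 :=
  closure [set cpl_emb Xm1 ((0, x) : hprod X1 X2) | x in [set: X2]].

End components.
Arguments cpl_comp1 {R X1 X2 N} Xm1 _.
Arguments cpl_comp2 {R X1 X2 N} Xm1 _.

Section trajectories.
Variables (R : realType) (X U : hilbertType R) (T : operator (hprod X U) X).

(* One-sided at [t = 0]. *)
Definition derivative_ge0 (a da : R -> X) := forall t : R, 0 <= t ->
  (fun s => ((s - t)^-1)%:C *: (a s - a t)) @ within [set s | 0 <= s] t^'
    --> da t.

(* [p] is the continuous curve t |-> ((da t, - y t), (Q (a t), u t)) in [D];
   only the values at times [t >= 0] matter. *)
Definition trajectory (D : set (dual (graph_space T) * graph_space T))
    (Q : X -> X) (u : R -> U) (a : R -> X) (y : R -> dual U) :=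
  exists da : R -> X, derivative_ge0 a da /\
  exists p : R -> dual (graph_space T) * graph_space T,
    [/\ forall t, 0 <= t -> D (p t),
        {within `[0, +oo[, continuous p} &
        forall t, 0 <= t ->
          (p t).1 = flow T (da t) (- y t) /\ val (p t).2 = (Q (a t), u t)].

End trajectories.

Section sobolev.
Variables (R : realType) (V : normedModType R[i]).

Local Notation mu := (@lebesgue_measure R).

(* The norm of a complex normed space takes its values in [R[i]]. *)
Definition rnorm (v : V) : R := complex.Re `|v|.

Definition simple_fun (s : R -> V) :=
  finite_set (range s) /\ forall v, measurable (s @^-1` [set v]).

(* Meaningful on domains of finite measure. *)
Definition simple_integral (D : set R) (s : R -> V) : V :=
  \sum_(v \in range s) (fine (mu (D `&` s @^-1` [set v])))%:C *: v.

Definition bochner_integral (D : set R) (w : R -> V) (I : V) :=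
  exists s : nat -> R -> V,
    [/\ forall n, simple_fun (s n),
        forall n, measurable_fun D (fun t => rnorm (w t - s n t)),
        (\int[mu]_(t in D) (rnorm (w t - s n t))%:E)%E @[n --> \oo] --> 0%E &
        simple_integral D (s n) @[n --> \oo] --> I].

Definition strongly_measurable (w : R -> V) :=
  exists s : nat -> R -> V, (forall n, simple_fun (s n)) /\
    {ae mu, forall t, 0 <= t -> s n t @[n --> \oo] --> w t}.

Definition L2loc (w : R -> V) := strongly_measurable w /\
  forall T : R, 0 < T ->
    measurable_fun `[0, T] (fun t => rnorm (w t)) /\
    (\int[mu]_(t in `[0%R, T]) (rnorm (w t) ^+ 2)%:E < +oo)%E.

(* [v] is locally square integrable on [0, +oo) and [u] is an indefinite
   integral of [v]. *)
Definition H1loc_derivative (u v : R -> V) := L2loc v /\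
  forall t, 0 <= t -> bochner_integral `[0, t] v (u t - u 0).

Definition H2loc (u : R -> V) :=
  exists v w, H1loc_derivative u v /\ H1loc_derivative v w.

End sobolev.

(* Main.v *)
Require Import Defs.
From HB Require Import structures.
From mathcomp Require Import all_boot all_order all_algebra.
From mathcomp Require Import complex ring lra finmap.
From mathcomp Require Import all_classical all_reals all_analysis measurable_realfun.

Set Implicit Arguments.
Unset Strict Implicit.
Unset Printing Implicit Defensive.

Import Order.TTheory GRing.Theory Num.Theory.
Import numFieldNormedType.Exports.

Local Open Scope classical_set_scope.
Local Open Scope complex_scope.
Local Open Scope ring_scope.

(** Write [z] for a point of the domain of the operator [J] and [G z]
for its boundary trace. Membership in the Stokes-Dirac structure says that at
every time there is a [z] with [Zval z = Q alpha], [G z = u], [J z = alpha'] and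
[y = C z] ([trajectory_state]): a flow determines its two components because
[dom A] is dense and [G] is onto. The output [y] depends boundedly on [z], in the
graph norm ([C_bounded]), and everything reduces to the boundary control problem
[alpha' = J (Q alpha)], [G (Q alpha) = u].

Uniqueness ([trajectory_unique]): the difference [d] of two states has zero
trace, so [d' = A (Q d)], and skew-symmetry of [A] makes the energy [(d, Q d)]
constant ([energy_conservation]).

Existence ([state_exists]). The extrapolated operator [I - A|X] is bounded below
from [X] to [X_{-1}] ([extrapolation_lower]). This yields a bounded lifting [l] of
boundary data with [G (l u) = u] and [J (l u) = l u] ([lifting]). With [P] the
inverse of [Q], the substitution [alpha = b + P (l u)] removes the boundary input:
[b' = A (Q b) + f] with [f = l u - P (l u')], and compatibility of the data says
exactly that [Q b(0)] lies in [dom A]. The operator [A Q] is m-dissipative for the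
energy norm [sqrt (x, Q x)] ([precomp_m_dissipative]).

The Cauchy problem [x' = M x + f] for an m-dissipative [M] is solved by backward
Euler with steps [h = 2^-k] ([cauchy_problem_solution]). The velocities
[v_j = (x_j - x_{j-1}) / h] obey [v_{j+1} = R_h (v_j + f_{j+1} - f_j)] with
[R_h = (I - h M)^-1] and [v_0 = M x_0 + f_0]. This scheme sees only the increments
of [f], and [R_h] is a contraction, so that [v] depends on [f] in total variation.
It therefore suffices to treat [f = phi(t) c] with [phi] scalar, and for those the
scheme is a Stieltjes sum of the powers [R_h^n c]. The powers converge for [c] in
[dom M^2], because halving the step costs [h^2 / 4 |M^2 c|] per step
([resolvent_halving]), hence for every [c] by density. The limit of the velocities
is a continuous function, so the limit of the [x_j] is a classical solution.

An [H^2_loc] input enters through [indefinite_approximable] and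
[indefinite_derivative]: an indefinite Bochner integral is approximated in
variation by indefinite integrals of simple functions, which are finite sums
[phi_i(t) c_i], and it is differentiable when its density is continuous. Estimates
on vector-valued integrals are obtained by pairing with vectors of the Hilbert
space, which reduces them to scalar Lebesgue integrals. *)

(** * Real-valued norms and inner products *)

Section real_norm.
Variables (R : realType) (V : normedModType R[i]).
Implicit Types (x y z : V) (r : R).

Lemma rnormE x : (rnorm x)%:C = `|x|.
Proof. by rewrite /rnorm RRe_real// normr_real. Qed.

Lemma rnorm_ge0 x : 0 <= rnorm x.
Proof. by rewrite -lecR rnormE normr_ge0. Qed.

Lemma rnorm0 : rnorm (0 : V) = 0.
Proof. by rewrite /rnorm normr0. Qed.

Lemma rnormD x y : rnorm (x + y) <= rnorm x + rnorm y.
Proof. by rewrite -lecR rmorphD/= !rnormE ler_normD. Qed.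

Lemma rnormN x : rnorm (- x) = rnorm x.
Proof. by rewrite /rnorm normrN. Qed.

Lemma rnormB x y : rnorm (x - y) <= rnorm x + rnorm y.
Proof. by rewrite -(rnormN y) rnormD. Qed.

Lemma rnorm_distC x y : rnorm (x - y) = rnorm (y - x).
Proof. by rewrite /rnorm distrC. Qed.

Lemma rnorm_dist z x y : rnorm (x - y) <= rnorm (x - z) + rnorm (z - y).
Proof. by rewrite -{1}(subrK z x) -addrA rnormD. Qed.

Lemma rnormZ r x : rnorm (r%:C *: x) = `|r| * rnorm x.
Proof.
apply: complexI; rewrite rmorphM/= !rnormE normrZ; congr (_ * _).
by rewrite normc_def/= expr0n/= addr0 sqrtr_sqr.
Qed.

Lemma rnorm_eq0 x : rnorm x = 0 -> x = 0.
Proof. by move=> x0; apply/normr0_eq0; rewrite -rnormE x0. Qed.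

Lemma rnorm_le0 x : rnorm x <= 0 -> x = 0.
Proof. by move=> x0; apply/rnorm_eq0/le_anti; rewrite x0 rnorm_ge0. Qed.

Lemma rnorm_cvgP T (F : set_system T) (FF : Filter F) (f : T -> V) l :
  f @ F --> l <-> forall e : R, 0 < e -> \forall x \near F, rnorm (l - f x) < e.
Proof.
split=> [/cvgrPdist_lt fl e e0|fl].
  have := fl e%:C; rewrite ltcR => /(_ e0); apply: filterS => x.
  by rewrite -rnormE ltcR.
apply/cvgrPdist_lt => e e0.
have eR : e = (complex.Re e)%:C by rewrite RRe_real// gtr0_real.
have := fl (complex.Re e); rewrite -ltcR -eR => /(_ e0).
by apply: filterS => x; rewrite -ltcR rnormE -eR.
Qed.

Lemma near_rnorm x (P : set V) :
  (\forall y \near x, P y) <-> exists2 e : R, 0 < e & forall y, rnorm (x - y) < e -> P y.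
Proof.
split.
  move/nbhs_normP => [e e0 eP].
  have eR : e = (complex.Re e)%:C by rewrite RRe_real// gtr0_real.
  exists (complex.Re e); first by rewrite -ltcR -eR.
  by move=> y xy; apply: eP; rewrite /= -rnormE eR ltcR.
move=> [e e0 eP]; apply/nbhs_normP; exists e%:C; first by rewrite /= ltcR.
by move=> y; rewrite /= -rnormE ltcR => /eP.
Qed.

Lemma rnorm_dense (D : set V) x (e : R) : dense D -> 0 < e ->
  exists2 y, D y & rnorm (x - y) < e.
Proof.
move=> dD e0.
have /dD : [set y | rnorm (x - y) < e]^° !=set0.
  by exists x; apply/near_rnorm; exists e.
move=> /(_ (@open_interior _ _))[y [/interior_subset/= xy Dy]].
by exists y.
Qed.

End real_norm.

Lemma continuous_rbounded (R : realType) (V W : normedModType R[i])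
    (f : {linear V -> W}) :
  continuous f -> exists2 M : R, 0 < M & forall x, rnorm (f x) <= M * rnorm x.
Proof.
move=> cf; have /linear_bounded_continuous/linear_boundedP/pinfty_ex_gt0[M M0 fM] := cf.
have MR : M = (complex.Re M)%:C by rewrite RRe_real// gtr0_real.
exists (complex.Re M); first by rewrite -ltcR -MR.
by move=> x; rewrite -lecR rmorphM/= !rnormE -MR; exact: fM.
Qed.

Lemma rnorm_complete (R : realType) (V : completeNormedModType R[i]) (x : nat -> V) :
  (forall e : R, 0 < e -> exists K, forall k l, (K <= k)%N -> (K <= l)%N ->
     rnorm (x k - x l) < e) ->
  exists l : V, forall e : R, 0 < e -> exists K, forall k, (K <= k)%N ->
     rnorm (x k - l) < e.
Proof.
move=> xc.
have /cauchy_cvg/cvg_ex[l xl] : cauchy (x @ \oo).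
  apply: cauchy_exP => e e0.
  have eR : e = (complex.Re e)%:C by rewrite RRe_real// gtr0_real.
  have /xc[K xK] : 0 < complex.Re e by rewrite -ltcR -eR.
  exists (x K); exists K => // k /= Kk.
  by rewrite -ball_normE /ball_ /= eR -rnormE ltcR xK.
exists l => e e0; move/rnorm_cvgP: xl => /(_ e e0)[K _ xK].
by exists K => k Kk; rewrite rnorm_distC; exact: xK.
Qed.

Section real_inner.
Variables (R : realType) (V : hilbertType R).
Implicit Types (x y z : V) (r : R).

Definition rin x y : R := complex.Re (inner x y).

Lemma rinDr x y z : rin x (y + z) = rin x y + rin x z.
Proof.
by rewrite /rin; have := inner_linear x 1 y z; rewrite scale1r mul1r => ->; rewrite raddfD.
Qed.

Lemma rinZr x r y : rin x (r%:C *: y) = r * rin x y.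
Proof. by rewrite /rin innerZr; case: (inner x y) => a b /=; rewrite mul0r subr0. Qed.

Lemma rin0r x : rin x 0 = 0.
Proof. by rewrite -(scale0r (0 : V)) -(rmorph0 (real_complex R)) rinZr mul0r. Qed.

Lemma rinC x y : rin x y = rin y x.
Proof. by rewrite /rin (innerC y x); case: (inner y x). Qed.

Lemma rinNr x y : rin x (- y) = - rin x y.
Proof. by rewrite -(mulN1r (rin x y)) -rinZr rmorphN rmorph1 scaleN1r. Qed.

Lemma rinBr x y z : rin x (y - z) = rin x y - rin x z.
Proof. by rewrite rinDr rinNr. Qed.

Lemma rinDl x y z : rin (x + y) z = rin x z + rin y z.
Proof. by rewrite rinC rinDr !(rinC z). Qed.

Lemma rinZl x r y : rin (r%:C *: x) y = r * rin x y.
Proof. by rewrite rinC rinZr (rinC y). Qed.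

Lemma rinNl x y : rin (- x) y = - rin x y.
Proof. by rewrite rinC rinNr rinC. Qed.

Lemma rinBl x y z : rin (x - y) z = rin x z - rin y z.
Proof. by rewrite rinDl rinNl. Qed.

Lemma rin_norm x : rin x x = rnorm x ^+ 2.
Proof. by apply: complexI; rewrite rmorphXn/= rnormE -inner_norm /rin RRe_real// inner_norm rpredX// normr_real. Qed.

Lemma rin_cs x y : rin x y <= rnorm x * rnorm y.
Proof.
apply: (@le_trans _ _ `|rin x y|); first exact: ler_norm.
rewrite -lecR rmorphM/= !rnormE; apply: le_trans (cauchy_schwarz x y).
rewrite /rin; case: (inner x y) => a b /=; rewrite normc_def lecR /=.
by rewrite -sqrtr_sqr ler_sqrt ?sqr_ge0 ?addr_ge0 ?sqr_ge0// lerDl sqr_ge0.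
Qed.

Lemma rnorm_le_rin x (b : R) : 0 <= b -> (forall y, rin y x <= rnorm y * b) -> rnorm x <= b.
Proof.
move=> b0 /(_ x); rewrite rin_norm expr2.
have [->//|x0] := eqVneq (rnorm x) 0.
by rewrite ler_pM2l// lt0r x0 rnorm_ge0.
Qed.

End real_inner.

(** * Equivalent norms *)

(** Homogeneity is for real scalars, the only ones that multiply vectors in the
    time stepping. *)
Record equivalent_norm (R : realType) (V : normedModType R[i]) (N : V -> R) : Prop := {
  equivalent_normD : forall x y, N (x + y) <= N x + N y ;
  equivalent_normZ : forall (r : R) x, N (r%:C *: x) = `|r| * N x ;
  equivalent_norm_upper : exists2 a, 0 < a & forall x, rnorm x <= a * N x ;
  equivalent_norm_lower : exists2 b, 0 < b & forall x, N x <= b * rnorm x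
}.

Section equivalent_norm_theory.
Variables (R : realType) (V : normedModType R[i]) (N : V -> R).
Hypothesis N_norm : equivalent_norm N.
Implicit Types (x y z : V) (r : R).

Lemma enorm0 : N 0 = 0.
Proof. by have := equivalent_normZ N_norm 0 0; rewrite scaler0 normr0 mul0r. Qed.

Lemma enormN x : N (- x) = N x.
Proof.
have := equivalent_normZ N_norm (-1) x.
by rewrite rmorphN rmorph1 scaleN1r normrN1 mul1r.
Qed.

Lemma enorm_ge0 x : 0 <= N x.
Proof.
have := equivalent_normD N_norm x (- x); rewrite subrr enorm0 enormN; lra.
Qed.

Lemma enorm_distC x y : N (x - y) = N (y - x).
Proof. by rewrite -enormN opprB. Qed.

Lemma enorm_dist z x y : N (x - y) <= N (x - z) + N (z - y).
Proof. by rewrite -{1}(subrK z x) -addrA; exact: equivalent_normD. Qed.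

Lemma enormZ r x : 0 <= r -> N (r%:C *: x) = r * N x.
Proof. by move=> r0; rewrite equivalent_normZ// ger0_norm. Qed.

Lemma enorm_le0 x : N x <= 0 -> x = 0.
Proof.
move=> x0; have [a a0 ha] := equivalent_norm_upper N_norm.
by apply: rnorm_le0; apply: (le_trans (ha x)); rewrite pmulr_rle0.
Qed.

Lemma enorm_dense (D : set V) x (e : R) : dense D -> 0 < e ->
  exists2 y, D y & N (x - y) <= e.
Proof.
move=> dD e0; have [b b0 hb] := equivalent_norm_lower N_norm.
have [|y Dy xy] := rnorm_dense x dD (e := e / b); first by rewrite divr_gt0.
exists y => //; apply: (le_trans (hb _)).
by rewrite mulrC -ler_pdivlMr// ltW.
Qed.

Lemma enorm_sum (w : nat -> V) (c : nat -> R) m n :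
  (forall a, (m <= a < n)%N -> N (w a) <= c a) ->
  N (\sum_(m <= a < n) w a) <= \sum_(m <= a < n) c a.
Proof.
move=> wc; rewrite big_seq [leRHS]big_seq.
elim/big_ind2 : _ => [|x r y s xr ys|a].
- by rewrite enorm0.
- by apply: (le_trans (equivalent_normD N_norm _ _)); rewrite lerD.
- by rewrite mem_index_iota => /wc.
Qed.

End equivalent_norm_theory.

Lemma equivalent_norm_complete (R : realType) (V : completeNormedModType R[i])
    (N : V -> R) (N_norm : equivalent_norm N) (x : nat -> V) :
  (forall e : R, 0 < e -> exists K, forall k l, (K <= k)%N -> (K <= l)%N ->
     N (x k - x l) <= e) ->
  exists l : V, forall e : R, 0 < e -> exists K, forall k, (K <= k)%N ->
     N (x k - l) <= e.
Proof.
have [a a0 ha] := equivalent_norm_upper N_norm.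
have [b b0 hb] := equivalent_norm_lower N_norm.
move=> xc; have [|l xl] := @rnorm_complete R V x.
  move=> e e0; have [|K xK] := xc (e / a / 2); first by rewrite !divr_gt0.
  exists K => k l Kk Kl; apply: (le_lt_trans (ha _)).
  rewrite mulrC -ltr_pdivlMr//; apply: (le_lt_trans (xK _ _ Kk Kl)).
  by rewrite gtr_pMr ?divr_gt0//; lra.
exists l => e e0; have [|K xK] := xl (e / b); first by rewrite divr_gt0.
exists K => k /xK xk; apply: (le_trans (hb _)).
by rewrite mulrC -ler_pdivlMr// ltW.
Qed.

(** * Dyadic time grids *)

Section dyadic.
Variable R : realType.

Definition dyadic (k : nat) : R := (2 ^+ k)^-1.

Lemma dyadic_gt0 k : 0 < dyadic k.
Proof. by rewrite invr_gt0 exprn_gt0. Qed.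

Lemma dyadicD k m : (2 ^ m)%:R * dyadic (k + m) = dyadic k.
Proof.
rewrite /dyadic natrX exprD invfM mulrCA mulfV ?mulr1//.
Qed.

Lemma dyadicS k : dyadic k.+1 = dyadic k / 2.
Proof. by rewrite /dyadic exprS invfM mulrC. Qed.

Lemma dyadicM i k m : (i * 2 ^ m)%:R * dyadic (k + m) = i%:R * dyadic k.
Proof. by rewrite natrM -mulrA dyadicD. Qed.

Lemma dyadic_le k l : (k <= l)%N -> dyadic l <= dyadic k.
Proof. by move=> kl; rewrite lef_pV2 ?posrE ?exprn_gt0// ler_weXn2l// ler1n. Qed.

Lemma dyadic_small (e : R) : 0 < e -> exists K, forall k, (K <= k)%N -> dyadic k < e.
Proof.
move=> e0; exists (Num.truncn e^-1).+1 => k Kk; rewrite -[ltRHS]invrK ltf_pV2 ?posrE ?invr_gt0 ?exprn_gt0//.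
apply: (lt_le_trans (truncnS_gt _)).
by rewrite -natrX ler_nat (leq_trans Kk)// ltnW// ltn_expl.
Qed.

Definition grid_index k (t : R) : nat := Num.truncn (t * 2 ^+ k).

Lemma grid_index_le k t : 0 <= t -> (grid_index k t)%:R * dyadic k <= t.
Proof.
move=> t0; rewrite /dyadic ler_pdivrMr ?exprn_gt0//.
by rewrite truncn_le mulr_ge0 ?exprn_ge0.
Qed.

Lemma grid_index_gt k t : 0 <= t -> t < (grid_index k t)%:R * dyadic k + dyadic k.
Proof.
move=> t0; rewrite -[X in _ + X]mul1r -mulrDl /dyadic ltr_pdivlMr ?exprn_gt0//.
by rewrite natr1 truncnS_gt.
Qed.

End dyadic.

(** * Joint Cauchy convergence of functions on dyadic grids *)

Section joint_cauchy.
Variables (R : realType) (V : completeNormedModType R[i]) (N : V -> R).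
Hypothesis N_norm : equivalent_norm N.
Implicit Types (x y z : V) (r T : R) (k l i j m n a b : nat).
Local Notation dyadic := (@dyadic R).

(** [v k i] is the value at time [i 2^-k] of an approximation of level [k]. The
    times compared need not be equal, so that the predicate expresses uniform
    convergence on [0, T] together with continuity of the limit. *)
Definition jointly_cauchy T (v : nat -> nat -> V) := forall e : R, 0 < e ->
  exists2 d : R, 0 < d & exists K, forall k l i j, (K <= k)%N -> (K <= l)%N ->
    i%:R * dyadic k <= T -> j%:R * dyadic l <= T -> `|i%:R * dyadic k - j%:R * dyadic l| < d ->
    N (v k i - v l j) <= e.

Lemma jointly_cauchy_ordered T v :
  (forall e : R, 0 < e -> exists2 d : R, 0 < d & exists K, forall k m i j,
    (K <= k)%N -> i%:R * dyadic k <= T -> j%:R * dyadic (k + m) <= T ->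
    `|i%:R * dyadic k - j%:R * dyadic (k + m)| < d -> N (v k i - v (k + m)%N j) <= e) ->
  jointly_cauchy T v.
Proof.
move=> h e /h[d d0 [K hK]]; exists d => //; exists K => k l i j Kk Kl.
have [kl|/ltnW lk] := leqP k l.
  by rewrite -(subnKC kl) => *; exact: hK.
rewrite -(subnKC lk) => iT jT ij.
by rewrite (enorm_distC N_norm); apply: hK => //; rewrite distrC.
Qed.

Lemma jointly_cauchyD T v w : jointly_cauchy T v -> jointly_cauchy T w ->
  jointly_cauchy T (fun k i => v k i + w k i).
Proof.
move=> hv hw e e0; have e20 : 0 < e / 2 by rewrite divr_gt0.
have [d1 d10 [K1 h1]] := hv _ e20; have [d2 d20 [K2 h2]] := hw _ e20.
exists (Num.min d1 d2); first by rewrite lt_min d10 d20.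
exists (maxn K1 K2) => k l i j; rewrite !geq_max => /andP[k1 k2] /andP[l1 l2] iT jT.
rewrite lt_min => /andP[ij1 ij2].
rewrite [e]splitr opprD addrACA.
by apply: (le_trans (equivalent_normD N_norm _ _)); rewrite lerD ?h1 ?h2.
Qed.

(** The three-epsilon argument that lets the data of the scheme be replaced by
    nicer data. *)
Lemma jointly_cauchy_approx T v :
  (forall e : R, 0 < e -> exists2 w, jointly_cauchy T w &
     forall k i, i%:R * dyadic k <= T -> N (v k i - w k i) <= e) ->
  jointly_cauchy T v.
Proof.
move=> h e e0; have e30 : 0 < e / 3 by rewrite divr_gt0.
have [w /(_ _ e30)[d d0 [K hK]] vw] := h _ e30.
exists d => //; exists K => k l i j Kk Kl iT jT ij.
have := hK _ _ _ _ Kk Kl iT jT ij; have := vw _ _ iT; have := vw _ _ jT.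
rewrite [N (v l j - _)](enorm_distC N_norm).
have := enorm_dist N_norm (w k i) (v k i) (v l j).
have := enorm_dist N_norm (w l j) (w k i) (v l j).
lra.
Qed.

(** The indefinite integrals of indicator functions, and the identity, are of
    this kind. *)
Definition slow T (phi : R -> R) := forall s t, 0 <= s -> s <= t -> t <= T ->
  0 <= phi t - phi s <= t - s.

Definition increment (phi : R -> R) k a := phi (a.+1%:R * dyadic k) - phi (a%:R * dyadic k).

Lemma increment_sum phi k m n : (m <= n)%N ->
  \sum_(m <= a < n) increment phi k a = phi (n%:R * dyadic k) - phi (m%:R * dyadic k).
Proof. by move=> mn; rewrite (telescope_sumr (fun a => phi (a%:R * dyadic k))). Qed.

Lemma increment_ge0 T phi k a : slow T phi -> a.+1%:R * dyadic k <= T -> 0 <= increment phi k a.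
Proof.
move=> sphi aT; have dk0 := ltW (dyadic_gt0 R k).
have a0 : 0 <= a%:R * dyadic k by rewrite mulr_ge0.
have a1 : a%:R * dyadic k <= a.+1%:R * dyadic k by rewrite ler_wpM2r// ler_nat.
by case/andP: (sphi _ _ a0 a1 aT).
Qed.

Lemma stieltjes_bound T phi k (w : nat -> V) c m n : slow T phi -> (m <= n)%N ->
  n%:R * dyadic k <= T -> 0 <= c -> (forall a, (m <= a < n)%N -> N (w a) <= c) ->
  N (\sum_(m <= a < n) (increment phi k a)%:C *: w a) <=
    c * (n%:R * dyadic k - m%:R * dyadic k).
Proof.
move=> sphi mn nT c0 wc.
have dk0 := ltW (dyadic_gt0 R k).
apply: (le_trans (enorm_sum N_norm (c := fun a => c * increment phi k a) _)).
  move=> a man; have i0 : 0 <= increment phi k a.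
    apply: increment_ge0 sphi _; apply: le_trans nT.
    by rewrite ler_wpM2r// ler_nat; case/andP: man.
  by rewrite (enormZ N_norm)// mulrC ler_wpM2r// wc.
rewrite -mulr_sumr increment_sum//; apply: ler_wpM2l => //.
have m0 : 0 <= m%:R * dyadic k by rewrite mulr_ge0.
have m1 : m%:R * dyadic k <= n%:R * dyadic k by rewrite ler_wpM2r// ler_nat.
by case/andP: (sphi _ _ m0 m1 nT).
Qed.

Lemma increment_refine phi k m a :
  increment phi k a = \sum_(a * 2 ^ m <= b < a.+1 * 2 ^ m) increment phi (k + m)%N b.
Proof.
rewrite increment_sum ?leq_mul2r ?leqnSn ?orbT//.
by rewrite !dyadicM.
Qed.

(** A sum over the grid of level [k] rewritten over a finer grid, so that two
    levels can be compared term by term. *)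
Lemma refine_sum phi k m i (w : nat -> V) :
  \sum_(0 <= a < i) (increment phi k a)%:C *: w a =
  \sum_(0 <= b < i * 2 ^ m) (increment phi (k + m)%N b)%:C *: w (b %/ 2 ^ m)%N.
Proof.
rewrite big_nat_mul; apply: eq_bigr => a _.
rewrite (increment_refine phi k m a) rmorph_sum/= scaler_suml.
rewrite [LHS]big_seq_cond [RHS]big_seq_cond; apply: eq_bigr => b.
rewrite mem_index_iota andbT => /andP[ab ba]; congr (_ *: w _).
apply/esym/eqP; rewrite eqn_leq; apply/andP; split.
  by rewrite -ltnS ltn_divLR// expn_gt0.
by rewrite leq_divRL ?expn_gt0.
Qed.

(** Both sums are written over the finer grid. On the common range of indices the
    integrands are close, and the variation of [phi] is at most [T]; the remaining
    terms carry a variation of at most the distance of the two times. *)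
Lemma jointly_cauchy_stieltjes T phi c K0 (q : nat -> nat -> nat -> V) :
  0 <= T -> 0 <= c -> slow T phi ->
  (forall k i a, (K0 <= k)%N -> (a < i)%N -> i%:R * dyadic k <= T ->
     N (q k i a) <= c) ->
  (forall e : R, 0 < e -> exists2 d : R, 0 < d & exists K, forall k l i j a b,
     (K <= k)%N -> (K <= l)%N -> i%:R * dyadic k <= T -> j%:R * dyadic l <= T ->
     `|i%:R * dyadic k - j%:R * dyadic l| < d -> (a < i)%N -> (b < j)%N ->
     `|a%:R * dyadic k - b%:R * dyadic l| < d -> N (q k i a - q l j b) <= e) ->
  jointly_cauchy T (fun k i => \sum_(0 <= a < i) (increment phi k a)%:C *: q k i a).
Proof.
move=> T0 c0 sphi qc qcauchy; apply: jointly_cauchy_ordered => e e0.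
have T1 : 0 < T + 1 by lra.
have c1 : 0 < c + 1 by lra.
pose e' := e / 2 / (T + 1); have e'0 : 0 < e' by rewrite !divr_gt0.
have [d d0 [K hK]] := qcauchy _ e'0.
have [K' hK'] := dyadic_small d0.
exists (Num.min d (e / 2 / (c + 1))); first by rewrite lt_min d0 !divr_gt0.
exists (maxn K0 (maxn K K')) => k m i j.
rewrite !geq_max => /and3P[K0k Kk K'k] iT jT.
rewrite lt_min => /andP[ijd ije].
set l := (k + m)%N; set n := (2 ^ m)%N.
have n0 : (0 < n)%N by rewrite expn_gt0.
have dl0 := dyadic_gt0 R l; have dk0 := dyadic_gt0 R k.
rewrite (refine_sum _ _ m) -/n -/l.
have inT : (i * n)%:R * dyadic l = i%:R * dyadic k by rewrite dyadicM.
have main p : (p <= i * n)%N -> (p <= j)%N ->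
  N (\sum_(0 <= b < p) (increment phi l b)%:C *: q k i (b %/ n)%N -
     \sum_(0 <= b < p) (increment phi l b)%:C *: q l j b) <= e / 2.
  move=> pi pj; rewrite -sumrB.
  under eq_bigr do rewrite -scalerBr.
  have pT : p%:R * dyadic l <= T.
    by apply: le_trans jT; rewrite ler_wpM2r ?ler_nat// ltW.
  apply: (@le_trans _ _ (e' * (p%:R * dyadic l - 0%:R * dyadic l))).
    apply: (stieltjes_bound sphi _ _ (ltW e'0)) => // b /andP[_ bp].
    apply: hK => //.
    - by rewrite (leq_trans Kk)// leq_addr.
    - by rewrite ltn_divLR// (leq_trans bp).
    - exact: leq_trans bp pj.
    - rewrite -(dyadicM R _ k m) -/l -/n -mulrBl normrM (gtr0_norm dl0).
      have bn : (b %/ n * n <= b)%N by rewrite leq_trunc_div.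
      rewrite -opprB normrN -natrB// ger0_norm//.
      have -> : (b - b %/ n * n = b %% n)%N by rewrite {1}(divn_eq b n) addKn.
      apply: (@lt_trans _ _ (dyadic k)); last exact: hK'.
      by rewrite -(dyadicD _ k m) -/l -/n ltr_pM2r// ltr_nat ltn_pmod.
  rewrite mul0r subr0; apply: (@le_trans _ _ (e' * (T + 1))).
    by apply: ler_wpM2l; [exact: ltW|lra].
  by rewrite /e' divfK// gt_eqF.
have rest (x : R) : `|x| < e / 2 / (c + 1) -> c * x <= e / 2.
  move=> xe; apply: (@le_trans _ _ ((c + 1) * `|x|)).
    apply: (@le_trans _ _ (c * `|x|)); first by rewrite ler_wpM2l// ler_norm.
    by rewrite ler_wpM2r//; lra.
  by rewrite mulrC -ler_pdivlMr// ltW.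
have [inj|/ltnW jin] := leqP (i * n) j.
  rewrite [X in _ - X](big_cat_nat (n := (i * n)%N))//= opprD addrA.
  apply: (le_trans (equivalent_normD N_norm _ _)); rewrite (enormN N_norm).
  rewrite [leRHS]splitr; apply: lerD; first exact: main.
  apply: (le_trans (stieltjes_bound sphi inj jT c0 _)).
    by move=> b /andP[_ bj]; apply: qc => //; rewrite (leq_trans K0k)// leq_addr.
  by apply: rest; rewrite inT distrC.
rewrite [X in X - _](big_cat_nat (n := j))//= addrAC.
apply: (le_trans (equivalent_normD N_norm _ _)).
rewrite [leRHS]splitr; apply: lerD; first exact: main.
apply: (le_trans (stieltjes_bound sphi jin _ c0 _)); first by rewrite inT.
  by move=> b /andP[_ bi]; apply: qc => //; rewrite ltn_divLR.
by apply: rest; rewrite inT.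
Qed.

Lemma jointly_cauchy_bounded T v : 0 <= T -> jointly_cauchy T v ->
  exists2 c : R, 0 <= c & exists K, forall k i, (K <= k)%N ->
    i%:R * dyadic k <= T -> N (v k i) <= c.
Proof.
move=> T0 /(_ 1 ltr01)[d d0 [K hK]].
have [K1 hK1] := dyadic_small d0; pose K2 := maxn K K1.
have sum_ge0 n : 0 <= \sum_(0 <= j < n) N (v K2 j).
  by apply: sumr_ge0 => j _; exact: (enorm_ge0 N_norm).
(* Every time up to T is close to a point of the grid of level K2, which has
   finitely many points. *)
exists (1 + \sum_(0 <= j < (grid_index K2 T).+1) N (v K2 j)).
  by have := sum_ge0 (grid_index K2 T).+1; lra.
exists K => k i Kk iT; pose j := grid_index K2 (i%:R * dyadic k).
have it0 : 0 <= i%:R * dyadic k by rewrite mulr_ge0// ltW// dyadic_gt0.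
have jle := grid_index_le K2 it0; have jgt := grid_index_gt K2 it0; rewrite -/j in jle jgt.
have dd : dyadic K2 < d by apply: hK1; rewrite leq_maxr.
have := hK k K2 i j Kk (leq_maxl _ _) iT (le_trans jle iT).
rewrite ltr_norml => h; have {}h : N (v k i - v K2 j) <= 1 by apply: h; lra.
have jT : (j <= grid_index K2 T)%N.
  by apply: le_truncn; rewrite ler_wpM2r// exprn_ge0.
have : N (v K2 j) <= \sum_(0 <= j < (grid_index K2 T).+1) N (v K2 j).
  rewrite (big_cat_nat (n := j.+1))//= big_nat_recr//= -addrA addrCA lerDl.
  by rewrite addr_ge0// sumr_ge0// => b _; exact: (enorm_ge0 N_norm).
have := equivalent_normD N_norm (v k i - v K2 j) (v K2 j); rewrite subrK.
lra.
Qed.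

Lemma jointly_cauchy_limit (v : nat -> nat -> V) :
  (forall T, 0 < T -> jointly_cauchy T v) ->
  exists w : R -> V, forall T e : R, 0 < e -> exists2 d : R, 0 < d & exists K,
    forall k i t, (K <= k)%N -> 0 <= t -> t <= T -> i%:R * dyadic k <= T ->
      `|i%:R * dyadic k - t| < d -> N (v k i - w t) <= e.
Proof.
move=> hv.
have near_grid_index (t d : R) K : 0 <= t -> 0 < d -> exists K', (K <= K')%N /\
    forall k, (K' <= k)%N -> `|(grid_index k t)%:R * dyadic k - t| < d.
  move=> t0 d0; have [K' hK'] := dyadic_small d0; exists (maxn K K').
  rewrite leq_maxl; split=> // k; rewrite geq_max => /andP[_ /hK' kd].
  have := grid_index_le k t0; have := grid_index_gt k t0; rewrite distrC ltr_norml; lra.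
have lim (t : R) : exists l : V, 0 <= t -> forall e : R, 0 < e ->
    exists K, forall k, (K <= k)%N -> N (v k (grid_index k t) - l) <= e.
  have [t0|t0] := leP 0 t; last by exists 0; lra.
  have [e e0|l hl] := equivalent_norm_complete N_norm (x := fun k => v k (grid_index k t)).
    have T0 : 0 < t + 1 by lra.
    have [d d0 [K hK]] := hv _ T0 _ e0.
    have d20 : 0 < d / 2 by rewrite divr_gt0.
    have [K' [KK' hK']] := near_grid_index t _ K t0 d20.
    exists K' => k l kK lK; apply: hK; rewrite ?(leq_trans KK')//.
    - by have := grid_index_le k t0; lra.
    - by have := grid_index_le l t0; lra.
    - have := hK' _ kK; have := hK' _ lK; rewrite !ltr_norml; lra.
  by exists l.
have [w hw] := choice lim.
exists w => T e e0; have [T0|T0] := leP 0 T; last first.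
  by exists 1 => //; exists 0 => k i t _ t0 tT; lra.
have e20 : 0 < e / 2 by rewrite divr_gt0.
have T1 : 0 < T + 1 by lra.
have [d d0 [K hK]] := hv _ T1 _ e20.
have d20 : 0 < d / 2 by rewrite divr_gt0.
exists (d / 2) => //; exists K => k i t Kk t0 tT iT it.
have [K1 hK1] := hw _ t0 _ e20.
have [K2 [KK2 hK2]] := near_grid_index t _ (maxn K K1) t0 d20.
move: KK2; rewrite geq_max => /andP[KK2 K1K2].
have h1 := hK1 _ K1K2; have h2 := hK2 _ (leqnn K2).
have := enorm_dist N_norm (v K2 (grid_index K2 t)) (v k i) (w t).
have := hK k K2 i (grid_index K2 t) Kk KK2; have := grid_index_le K2 t0.
move=> h3 h4; have {}h4 : N (v k i - v K2 (grid_index K2 t)) <= e / 2.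
  apply: h4; [lra|lra|].
  by move: it h2; rewrite !ltr_norml; lra.
lra.
Qed.

End joint_cauchy.

(** * Resolvents of m-dissipative operators *)

Record m_dissipative (R : realType) (V : normedModType R[i]) (N : V -> R)
    (M : operator V V) : Prop := {
  m_dissipative_dense : dense (op_dom M) ;
  m_dissipative_le : forall (h : R) x, 0 < h -> op_dom M x ->
    N x <= N (x - h%:C *: M x) ;
  m_dissipative_range : forall (h : R) g, 0 < h ->
    exists2 x, op_dom M x & x - h%:C *: M x = g
}.

Section operator_theory.
Variables (R : realType) (V W : normedModType R[i]) (T : operator V W).

Lemma op_domD x y : op_dom T x -> op_dom T y -> op_dom T (x + y).
Proof. by move=> dx dy; have := op_domP 1 dx dy; rewrite scale1r. Qed.

Lemma op_domZ a x : op_dom T x -> op_dom T (a *: x).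
Proof. by move=> dx; have := op_domP a dx (op_dom0 T); rewrite addr0. Qed.

Lemma op_domB x y : op_dom T x -> op_dom T y -> op_dom T (x - y).
Proof. by move=> dx dy; rewrite -scaleN1r; apply/op_domD/op_domZ. Qed.

Lemma opD x y : op_dom T x -> op_dom T y -> T (x + y) = T x + T y.
Proof. by move=> dx dy; have := op_linear 1 dx dy; rewrite !scale1r. Qed.

Lemma opZ a x : op_dom T x -> T (a *: x) = a *: T x.
Proof. by move=> dx; have := op_linear a dx (op_dom0 T); rewrite op0 !addr0. Qed.

Lemma opB x y : op_dom T x -> op_dom T y -> T (x - y) = T x - T y.
Proof.
move=> dx dy; rewrite -scaleN1r opD//; last exact: op_domZ.
by rewrite opZ// scaleN1r.
Qed.

End operator_theory.

Lemma subrACA (V : zmodType) (x y a b : V) : x - y - (a - b) = x - a - (y - b).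
Proof. by rewrite opprD addrACA -opprD. Qed.

Section resolvent.
Variables (R : realType) (V : completeNormedModType R[i]) (N : V -> R).
Hypothesis N_norm : equivalent_norm N.
Variable M : operator V V.
Hypothesis M_diss : m_dissipative N M.
Implicit Types (x y z c : V) (h r T : R) (k l i j m n : nat).
Local Notation dyadic := (@dyadic R).

Definition resolvent h g : V := xget 0 [set x | op_dom M x /\ x - h%:C *: M x = g].

Lemma resolvent_spec h g : 0 < h ->
  op_dom M (resolvent h g) /\ resolvent h g - h%:C *: M (resolvent h g) = g.
Proof.
move=> h0; rewrite /resolvent; case: xgetP => [x _ []//|].
by have [x dx xg] := m_dissipative_range M_diss g h0 => /(_ x)[].
Qed.

Lemma resolvent_dom h g : 0 < h -> op_dom M (resolvent h g).
Proof. by move=> h0; have [] := resolvent_spec g h0. Qed.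

Lemma resolventE h g : 0 < h -> h%:C *: M (resolvent h g) = resolvent h g - g.
Proof.
by move=> h0; have [_ E] := resolvent_spec g h0; rewrite -{3}E opprB addrC subrK.
Qed.

Lemma resolvent_uniq h x : 0 < h -> op_dom M x -> resolvent h (x - h%:C *: M x) = x.
Proof.
move=> h0 dx; have [dy yx] := resolvent_spec (x - h%:C *: M x) h0.
apply/eqP; rewrite -subr_eq0; apply/eqP; apply: (enorm_le0 N_norm).
apply: (le_trans (m_dissipative_le M_diss h0 (op_domB dy dx))).
by rewrite opB// scalerBr opprD addrACA -opprD yx subrr (enorm0 N_norm).
Qed.

Lemma resolventP a h x y : 0 < h -> resolvent h (a *: x + y) = a *: resolvent h x + resolvent h y.
Proof.
move=> h0; have [dx xE] := resolvent_spec x h0; have [dy yE] := resolvent_spec y h0.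
rewrite -{1}xE -{1}yE -[RHS](resolvent_uniq h0); last exact: op_domP.
rewrite op_linear//; congr (resolvent h _).
by rewrite scalerBr scalerDr opprD addrACA !scalerA [a * _]mulrC.
Qed.

Lemma resolventD h x y : 0 < h -> resolvent h (x + y) = resolvent h x + resolvent h y.
Proof. by move=> h0; have := resolventP 1 x y h0; rewrite !scale1r. Qed.

Lemma resolvent0 h : 0 < h -> resolvent h 0 = 0.
Proof.
move=> h0; have := resolventD 0 0 h0; rewrite addr0 => /eqP.
by rewrite -subr_eq0 opprD addNKr oppr_eq0 => /eqP.
Qed.

Lemma resolventZ a h x : 0 < h -> resolvent h (a *: x) = a *: resolvent h x.
Proof. by move=> h0; have := resolventP a x 0 h0; rewrite resolvent0// !addr0. Qed.

Lemma resolventB h x y : 0 < h -> resolvent h (x - y) = resolvent h x - resolvent h y.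
Proof. by move=> h0; rewrite -scaleN1r resolventD// resolventZ// scaleN1r. Qed.

Lemma resolvent_le h g : 0 < h -> N (resolvent h g) <= N g.
Proof.
move=> h0; have [dx xg] := resolvent_spec g h0.
by apply: (le_trans (m_dissipative_le M_diss h0 dx)); rewrite xg.
Qed.

(** [M (R_h c)] is a combination of [R_h c] and [c], so it stays in the domain. *)
Lemma resolvent_comm h c : 0 < h -> op_dom M c ->
  op_dom M (M (resolvent h c)) /\ M (resolvent h c) = resolvent h (M c).
Proof.
move=> h0 dc; have [dx xc] := resolvent_spec c h0.
have hC : h%:C != 0 :> R[i] by rewrite (inj_eq (@complexI R)) gt_eqF.
have d2 : op_dom M (M (resolvent h c)).
  have -> : M (resolvent h c) = h%:C^-1 *: (resolvent h c - c).
    by rewrite -resolventE// scalerA mulVf// scale1r.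
  by apply/op_domZ/op_domB.
split=> //; rewrite -{2}xc opB//; last exact: op_domZ.
by rewrite opZ// resolvent_uniq.
Qed.

Lemma resolvent_dist h c : 0 < h -> op_dom M c -> N (resolvent h c - c) <= h * N (M c).
Proof.
move=> h0 dc; rewrite -resolventE// (enormZ N_norm) ?(ltW h0)// ler_wpM2l ?(ltW h0)//.
by have [_ ->] := resolvent_comm h0 dc; exact: resolvent_le.
Qed.

Lemma iter_resolvent_le h c i : 0 < h -> N (iter i (resolvent h) c) <= N c.
Proof.
by move=> h0; elim: i => //= i; apply: le_trans; exact: resolvent_le.
Qed.

Lemma iter_resolventB h x y i : 0 < h ->
  iter i (resolvent h) (x - y) = iter i (resolvent h) x - iter i (resolvent h) y.
Proof. by move=> h0; elim: i => //= i ->; rewrite resolventB. Qed.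

Lemma iter_resolvent_comm h c i : 0 < h -> op_dom M c ->
  op_dom M (iter i (resolvent h) c) /\ M (iter i (resolvent h) c) = iter i (resolvent h) (M c).
Proof.
move=> h0 dc; elim: i => //= i [di Mi]; split; first exact: resolvent_dom.
by have [_ ->] := resolvent_comm h0 di; rewrite Mi.
Qed.

Lemma iter_resolvent_lip h c i j : 0 < h -> op_dom M c ->
  N (iter i (resolvent h) c - iter j (resolvent h) c) <= `|i%:R * h - j%:R * h| * N (M c).
Proof.
move=> h0 dc.
have step a b : N (iter (b + a) (resolvent h) c - iter a (resolvent h) c) <= b%:R * h * N (M c).
  elim: b => [|b IH]; first by rewrite add0n subrr (enorm0 N_norm) !mul0r.
  have [d Md] := iter_resolvent_comm (b + a) h0 dc.
  apply: (le_trans (enorm_dist N_norm (iter (b + a) (resolvent h) c) _ _)).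
  rewrite -natr1 mulrDl mul1r mulrDl [leRHS]addrC; apply: lerD => //.
  apply: (le_trans (resolvent_dist h0 d)); rewrite ler_wpM2l ?(ltW h0)// Md.
  exact: iter_resolvent_le.
rewrite -mulrBl normrM (gtr0_norm h0).
have [ij|/ltnW ji] := leqP i j.
  rewrite (enorm_distC N_norm) -{1}(subnK ij) distrC -natrB// ger0_norm//.
by rewrite -{1}(subnK ji) -natrB// ger0_norm.
Qed.

Definition dom2 c := op_dom M c /\ op_dom M (M c).

Lemma iter_resolvent_dom2 h c i : 0 < h -> dom2 c ->
  dom2 (iter i (resolvent h) c) /\ N (M (M (iter i (resolvent h) c))) <= N (M (M c)).
Proof.
move=> h0 [d1 d2]; have [e1 E1] := iter_resolvent_comm i h0 d1.
have [e2 E2] := iter_resolvent_comm i h0 d2.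
by rewrite /dom2 E1 E2; split => //; exact: iter_resolvent_le.
Qed.

(** With [y] the result of two half steps from [c], expanding [(I - (h/2) M)^2]
    gives [(I - h M) y = c - (h^2/4) M^2 y]: apart from the error of order [h^2],
    [y] is the result of one full step. *)
Lemma resolvent_halving h c : 0 < h -> dom2 c ->
  N (resolvent h c - resolvent (h / 2) (resolvent (h / 2) c)) <= h ^+ 2 / 4 * N (M (M c)).
Proof.
move=> h0 c2; have h20 : 0 < h / 2 by rewrite divr_gt0.
have [[dy dMy] Ny] := iter_resolvent_dom2 2 h20 c2; move: dy dMy Ny => /=.
set z := resolvent (h / 2) c; set y := resolvent (h / 2) z => dy dMy Ny.
have zE : z = y - (h / 2)%:C *: M y by have [_ ->] := resolvent_spec z h20.
have cE : c = z - (h / 2)%:C *: M z by have [_ ->] := resolvent_spec c h20.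
have cy : c = y - h%:C *: M y + (h ^+ 2 / 4)%:C *: M (M y).
  rewrite cE zE opB//; last exact: op_domZ.
  rewrite opZ// scalerBr scalerA -rmorphM/= opprB.
  have -> : h / 2 * (h / 2) = h ^+ 2 / 4 by field.
  rewrite [X in _ + X]addrC addrA; congr (_ + _).
  by rewrite -addrA -opprD -scalerDl -rmorphD/= -splitr.
have -> : resolvent h c - y = (h ^+ 2 / 4)%:C *: resolvent h (M (M y)).
  by rewrite {1}cy resolventD// resolvent_uniq// resolventZ// addrAC subrr add0r.
rewrite (enormZ N_norm); last by rewrite divr_ge0// exprn_ge0// ltW.
rewrite ler_wpM2l//; first by rewrite divr_ge0// exprn_ge0// ltW.
by apply: (le_trans (resolvent_le _ h0)).
Qed.

(** The one-step errors add up, because [R_h] is a contraction and the half steps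
    do not increase [N (M^2 _)]. *)
Lemma power_halving k i c : dom2 c ->
  N (iter i (resolvent (dyadic k)) c - iter (i * 2) (resolvent (dyadic k.+1)) c) <=
    i%:R * (dyadic k ^+ 2 / 4 * N (M (M c))).
Proof.
move=> c2; have k0 := dyadic_gt0 R k; have k1 := dyadic_gt0 R k.+1.
elim: i => [|i IH]; first by rewrite mul0n subrr (enorm0 N_norm) mul0r.
rewrite -natr1 mulrDl mul1r mulSn.
set y := iter (i * 2) (resolvent (dyadic k.+1)) c in IH *.
have [dy2 Ny] := iter_resolvent_dom2 (i * 2) k1 c2; rewrite -/y in dy2 Ny.
apply: (le_trans (enorm_dist N_norm (resolvent (dyadic k) y) _ _)); apply: lerD => /=.
  by rewrite -resolventB//; apply: (le_trans (resolvent_le _ k0)).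
rewrite -/y dyadicS; apply: (le_trans (resolvent_halving k0 dy2)).
by rewrite ler_wpM2l// divr_ge0// exprn_ge0// ltW.
Qed.

(** The factor [dyadic k - dyadic (k + m)] is the telescoping form of the geometric
    series of the halving errors. *)
Lemma power_refine k i c m : dom2 c ->
  N (iter i (resolvent (dyadic k)) c - iter (i * 2 ^ m) (resolvent (dyadic (k + m))) c) <=
    i%:R * dyadic k * ((dyadic k - dyadic (k + m)) / 2 * N (M (M c))).
Proof.
move=> c2; elim: m => [|m IH].
  by rewrite expn0 muln1 addn0 !subrr (enorm0 N_norm) !mul0r mulr0.
apply: (le_trans (enorm_dist N_norm (iter (i * 2 ^ m) (resolvent (dyadic (k + m))) c) _ _)).
apply: (le_trans (lerD IH _)).
  rewrite expnSr mulnA addnS.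
  by apply: power_halving.
rewrite -(dyadicM R i k m) addnS dyadicS le_eqVlt; apply/orP; left; apply/eqP.
by field.
Qed.

(** For [c] in [dom M^2] the powers converge with a rate and are Lipschitz in time;
    [dom M^2] is dense since it is the image of [dom M] by [R_1], and [R_1] is a
    contraction whose range is [dom M]. *)
Lemma jointly_cauchy_power T c : 0 <= T ->
  jointly_cauchy N T (fun k i => iter i (resolvent (dyadic k)) c).
Proof.
move=> T0; apply: (jointly_cauchy_approx N_norm) => e e0.
have [d [d1 d2] cd] : exists2 d, dom2 d & N (c - d) <= e.
  have e20 : 0 < e / 2 by rewrite divr_gt0.
  (* d0 in dom M is close to c, and g in dom M is close to (I - M) d0; hence
     R_1 g, which lies in dom M^2, is close to R_1 ((I - M) d0) = d0. *)
  have [d0 dd0 cd0] := enorm_dense N_norm c (m_dissipative_dense M_diss) e20.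
  have [g dg gd] := enorm_dense N_norm (d0 - 1%:C *: M d0)
    (m_dissipative_dense M_diss) e20.
  exists (resolvent 1 g).
    by split; [exact: resolvent_dom | have [] := resolvent_comm (@ltr01 R) dg].
  have := enorm_dist N_norm d0 c (resolvent 1 g).
  have := resolvent_le (d0 - 1%:C *: M d0 - g) (@ltr01 R).
  rewrite resolventB// resolvent_uniq//; lra.
exists (fun k i => iter i (resolvent (dyadic k)) d); last first.
  move=> k i _; rewrite -iter_resolventB ?dyadic_gt0//; apply: le_trans cd.
  by apply: iter_resolvent_le; exact: dyadic_gt0.
apply: (jointly_cauchy_ordered N_norm) => f f0.
set C1 := N (M d) + 1; set C2 := (T + 1) * (N (M (M d)) + 1).
have C10 : 0 < C1 by have := enorm_ge0 N_norm (M d); rewrite /C1; lra.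
have C20 : 0 < C2.
  by rewrite mulr_gt0//; [lra | have := enorm_ge0 N_norm (M (M d)); lra].
have [K hK] := dyadic_small (divr_gt0 f0 C20).
exists (f / 2 / C1); first by rewrite !divr_gt0.
exists K => k m i j /hK kf iT jT ij.
apply: (le_trans (enorm_dist N_norm (iter (i * 2 ^ m) (resolvent (dyadic (k + m))) d) _ _)).
rewrite [leRHS]splitr; apply: lerD.
  apply: (le_trans (power_refine _ _ _ (conj d1 d2))).
  have k0 := dyadic_gt0 R k; have km0 := dyadic_gt0 R (k + m).
  have nM := enorm_ge0 N_norm (M (M d)).
  apply: (@le_trans _ _ ((T + 1) * (dyadic k / 2 * (N (M (M d)) + 1)))).
    apply: ler_pM; [by rewrite mulr_ge0// ltW| | lra |].
      by rewrite mulr_ge0// divr_ge0// subr_ge0 dyadic_le// leq_addr.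
    by apply: ler_pM; [by rewrite divr_ge0// subr_ge0 dyadic_le// leq_addr|by []|lra|lra].
  move: kf; rewrite ltr_pdivlMr// /C2; lra.
apply: (le_trans (iter_resolvent_lip _ _ (dyadic_gt0 R _) d1)); rewrite dyadicM.
apply: (@le_trans _ _ (f / 2 / C1 * C1)); last by rewrite divfK// gt_eqF.
by apply: ler_pM => //; [exact: (enorm_ge0 N_norm) | exact: ltW | rewrite /C1; lra].
Qed.

(** The velocities of the backward Euler scheme for [x' = M x + f], when started
    from [v0 = M x0 + f 0]. *)
Fixpoint euler (v0 : V) (f : R -> V) k i : V :=
  if i is j.+1 then
    resolvent (dyadic k) (euler v0 f k j + (f (j.+1%:R * dyadic k) - f (j%:R * dyadic k)))
  else v0.

Lemma eulerD v0 w0 f g k i :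
  euler (v0 + w0) (fun t => f t + g t) k i = euler v0 f k i + euler w0 g k i.
Proof.
elim: i => //= i ->; rewrite -resolventD ?dyadic_gt0//; congr (resolvent _ _).
by rewrite [RHS]addrACA opprD; congr (_ + _); rewrite addrACA.
Qed.

Lemma euler_cst v0 k i : euler v0 (fun=> 0) k i = iter i (resolvent (dyadic k)) v0.
Proof. by elim: i => //= i ->; rewrite subrr addr0. Qed.

Lemma euler_ramp (phi : R -> R) c k i :
  euler 0 (fun t => (phi t)%:C *: c) k i =
  \sum_(0 <= a < i) (increment phi k a)%:C *: iter (i - a) (resolvent (dyadic k)) c.
Proof.
have k0 := dyadic_gt0 R k.
elim: i => [|i IH]; first by rewrite big_geq.
rewrite /= IH big_nat_recr//= -scalerBl -rmorphB/= resolventD// resolventZ// subSnn/=.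
congr (_ + _); rewrite (big_morph (resolvent (dyadic k)) (fun x y => resolventD x y k0) (resolvent0 k0)).
rewrite [LHS]big_seq [RHS]big_seq; apply: eq_bigr => a.
by rewrite mem_index_iota => /andP[_ ai]; rewrite resolventZ// subSn// ltnW.
Qed.

(** The scheme sees only the increments of its data and [R_h] is a contraction, so
    the errors add up to at most the variation of [f - g], which [b] dominates. *)
Lemma euler_stable v0 f w0 g (b : R -> R) T k i :
  (forall s t, 0 <= s -> s <= t -> t <= T ->
     N ((f t - g t) - (f s - g s)) <= b t - b s) -> i%:R * dyadic k <= T ->
  N (euler v0 f k i - euler w0 g k i) <= N (v0 - w0) + (b (i%:R * dyadic k) - b 0).
Proof.
move=> fgb; have k0 := dyadic_gt0 R k.
elim: i => [|i IH] iT; first by rewrite mul0r subrr addr0.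
have i1 : i%:R * dyadic k <= i.+1%:R * dyadic k by rewrite ler_wpM2r ?ler_nat// ltW.
have i0 : 0 <= i%:R * dyadic k by rewrite mulr_ge0// ltW.
have {}IH := IH (le_trans i1 iT).
rewrite /= -resolventB//; apply: (le_trans (resolvent_le _ k0)).
rewrite opprD addrACA; apply: (le_trans (equivalent_normD N_norm _ _)).
have := fgb _ _ i0 i1 iT; rewrite subrACA; lra.
Qed.

End resolvent.

Lemma subrDD (V : zmodType) (x y a b : V) : x + y - (a + b) = x - a + (y - b).
Proof. by rewrite opprD addrACA. Qed.

(** * Functions on the half-line approximable in variation *)

Section half_line.
Variables (R : realType) (V : normedModType R[i]).
Implicit Types (f df : R -> V).

Definition continuous_on f := forall t : R, 0 <= t -> forall e : R, 0 < e ->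
  exists2 d : R, 0 < d & forall s, 0 <= s -> `|s - t| < d -> rnorm (f s - f t) <= e.

Definition derivative_on f df := forall t : R, 0 <= t -> forall e : R, 0 < e ->
  exists2 d : R, 0 < d & forall s, 0 <= s -> `|s - t| < d ->
    rnorm (f s - f t - (s - t)%:C *: df t) <= e * `|s - t|.

Definition ramps n (c : nat -> V) (phi : nat -> R -> R) (t : R) : V :=
  \sum_(j < n) (phi j t)%:C *: c j.

(** For every [T], [f] is the sum of a finite combination [sum_j phi_j(t) c_j] and
    of a remainder of arbitrarily small variation on [0, T], that variation being
    controlled by the increments of a scalar function [b]. The property depends on
    the norm only up to equivalence and is stable under bounded linear maps. *)
Definition approximable f := forall T e : R, 0 < T -> 0 < e ->
  exists n c phi (b : R -> R), [/\ forall j, slow T (phi j),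
    forall s t, 0 <= s -> s <= t -> t <= T ->
      rnorm ((f t - ramps n c phi t) - (f s - ramps n c phi s)) <= b t - b s &
    b T - b 0 <= e].

Lemma ramps_lip T n c phi s t : (forall j, slow T (phi j)) ->
  0 <= s -> s <= t -> t <= T ->
  rnorm (ramps n c phi t - ramps n c phi s) <= (t - s) * \sum_(j < n) rnorm (c j).
Proof.
move=> sphi s0 st tT; rewrite /ramps -sumrB mulr_sumr.
elim/big_ind2 : _ => [|x r y q xr yq|j _]; first by rewrite rnorm0.
  by apply: (le_trans (rnormD _ _)); exact: lerD.
rewrite -scalerBl -rmorphB/= rnormZ; case/andP: (sphi j _ _ s0 st tT) => p0 pl.
by rewrite ger0_norm// ler_wpM2r// rnorm_ge0.
Qed.

Lemma approximable_continuous f : approximable f -> continuous_on f.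
Proof.
move=> fa t t0 e e0.
have T0 : 0 < t + 1 by lra.
have e20 : 0 < e / 2 by rewrite divr_gt0.
have [n [c [phi [b [sphi fb be]]]]] := fa _ _ T0 e20.
set C := \sum_(j < n) rnorm (c j) + 1.
have C0 : 0 < C.
  by rewrite ltr_wpDl// sumr_ge0// => j _; exact: rnorm_ge0.
have bmono (s r : R) : 0 <= s -> s <= r -> r <= t + 1 -> b s <= b r.
  move=> s0 sr rT; have h := fb _ _ s0 sr rT.
  by rewrite -subr_ge0; apply: le_trans h; exact: rnorm_ge0.
have key (s r : R) : 0 <= s -> s <= r -> r <= t + 1 -> (r - s) * C <= e / 2 ->
    rnorm (f r - f s) <= e.
  move=> s0 sr rT rse.
  have -> : f r - f s = (f r - ramps n c phi r) - (f s - ramps n c phi s) +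
      (ramps n c phi r - ramps n c phi s).
    by rewrite -(subrACA (f r)) subrK.
  apply: (le_trans (rnormD _ _)).
  have := fb _ _ s0 sr rT; have := ramps_lip n c sphi s0 sr rT.
  have := bmono 0 s (lexx _) s0 (le_trans sr rT).
  have := bmono r _ (le_trans s0 sr) rT (lexx _).
  move: rse; rewrite {1}/C mulrDr mulr1; lra.
exists (Num.min 1 (e / 2 / C)); first by rewrite lt_min ltr01 !divr_gt0.
move=> s s0; rewrite lt_min ltr_pdivlMr// => /andP[s1 s2].
have [st|/ltW ts] := leP s t.
  rewrite rnorm_distC; apply: key => //; first lra.
  by apply: le_trans (ltW s2); rewrite ler_wpM2r ?(ltW C0)// distrC ler_norm.
apply: key => //; first by move: s1; rewrite ltr_norml; lra.
by apply: le_trans (ltW s2); rewrite ler_wpM2r ?(ltW C0)// ler_norm.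
Qed.

Lemma approximableD f g : approximable f -> approximable g ->
  approximable (fun t => f t + g t).
Proof.
move=> fa ga T e T0 e0; have e20 : 0 < e / 2 by rewrite divr_gt0.
have [n [c [phi [b [sphi fb be]]]]] := fa _ _ T0 e20.
have [m [d [psi [a [spsi gb ae]]]]] := ga _ _ T0 e20.
exists (n + m)%N, (fun j => if (j < n)%N then c j else d (j - n)%N).
exists (fun j => if (j < n)%N then phi j else psi (j - n)%N), (fun t => b t + a t).
split; [by move=> j; case: ifP| |lra].
have rE t : ramps (n + m) (fun j => if (j < n)%N then c j else d (j - n)%N)
    (fun j => if (j < n)%N then phi j else psi (j - n)%N) t =
    ramps n c phi t + ramps m d psi t.
  rewrite /ramps big_split_ord/=; congr (_ + _); apply: eq_bigr => j _.
    by rewrite ltn_ord.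
  by rewrite ltnNge leq_addr/= addKn.
move=> s t s0 st tT; rewrite !rE.
have -> : f t + g t - (ramps n c phi t + ramps m d psi t) -
    (f s + g s - (ramps n c phi s + ramps m d psi s)) =
    (f t - ramps n c phi t - (f s - ramps n c phi s)) +
    (g t - ramps m d psi t - (g s - ramps m d psi s)).
  by rewrite (subrDD (f t)) (subrDD (f s)) (subrDD (f t - _)).
apply: (le_trans (rnormD _ _)); have := fb _ _ s0 st tT; have := gb _ _ s0 st tT.
lra.
Qed.

End half_line.

Lemma approximable_linear (R : realType) (V W : normedModType R[i])
    (L : {linear V -> W}) (C : R) f : 0 < C ->
  (forall x, rnorm (L x) <= C * rnorm x) -> approximable f ->
  approximable (fun t => L (f t)).
Proof.
move=> C0 LC fa T e T0 e0; have eC0 : 0 < e / C by rewrite divr_gt0.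
have [n [c [phi [b [sphi fb be]]]]] := fa _ _ T0 eC0.
exists n, (L \o c), phi, (fun t => C * b t); split => //; last first.
  by rewrite -mulrBr mulrC -ler_pdivlMr.
have rE t : ramps n (L \o c) phi t = L (ramps n c phi t).
  by rewrite /ramps linear_sum; apply: eq_bigr => j _; rewrite linearZ.
move=> s t s0 st tT; rewrite !rE -!linearB -mulrBr.
by apply: (le_trans (LC _)); rewrite ler_pM2l// fb.
Qed.

Lemma subr_insert (V : zmodType) (A B p q z h : V) :
  p - q - h = A - B - z - (A - p) + (B - q) + (z - h).
Proof.
rewrite opprB [A - B - z + _]addrC -!addrA addKr.
by rewrite (addrCA (- z) B) addKr (addrCA (- z) (- q)) addKr.
Qed.

(** * The inhomogeneous Cauchy problem for an m-dissipative operator *)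

Section cauchy_problem.
Variables (R : realType) (V : completeNormedModType R[i]) (N : V -> R).
Hypothesis N_norm : equivalent_norm N.
Variable M : operator V V.
Hypothesis M_diss : m_dissipative N M.
Implicit Types (f : R -> V).
Local Notation dyadic := (@dyadic R).
Local Notation euler := (euler M).

Lemma jointly_cauchy_ramps T n c phi v0 : 0 <= T -> (forall j, slow T (phi j)) ->
  jointly_cauchy N T (euler v0 (ramps n c phi)).
Proof.
move=> T0 sphi; elim: n => [|n IH].
  have -> : euler v0 (ramps 0 c phi) = fun k i => iter i (resolvent M (dyadic k)) v0.
    apply/funext => k; apply/funext => i; rewrite -euler_cst; congr (euler _ _ _ _).
    by apply/funext => t; rewrite /ramps big_ord0.
  exact: (jointly_cauchy_power N_norm M_diss).
have -> : euler v0 (ramps n.+1 c phi) = fun k i => euler v0 (ramps n c phi) k i +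
    \sum_(0 <= a < i) (increment (phi n) k a)%:C *: iter (i - a) (resolvent M (dyadic k)) (c n).
  apply/funext => k; apply/funext => i.
  rewrite -(euler_ramp N_norm M_diss) -(eulerD N_norm M_diss) addr0.
  congr (euler _ _ _ _).
  by apply/funext => t; rewrite /ramps big_ord_recr.
apply: (jointly_cauchyD N_norm) => //.
apply: (jointly_cauchy_stieltjes N_norm (c := N (c n)) (K0 := 0)
  (q := fun k i a => iter (i - a) (resolvent M (dyadic k)) (c n)) T0 _ (sphi n)).
- exact: (enorm_ge0 N_norm).
- by move=> k i a _ _ _; exact/(iter_resolvent_le M_diss)/dyadic_gt0.
move=> e e0; have [d d0 [K hK]] := jointly_cauchy_power N_norm M_diss (c n) T0 e0.
exists (d / 2); first by rewrite divr_gt0.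
exists K => k l i j a b Kk Kl iT jT ij ai bj ab; apply: hK => //.
- by apply: le_trans iT; rewrite ler_wpM2r ?ler_nat ?leq_subr// ltW// dyadic_gt0.
- by apply: le_trans jT; rewrite ler_wpM2r ?ler_nat ?leq_subr// ltW// dyadic_gt0.
- rewrite !natrB ?(ltnW ai) ?(ltnW bj)//; move: ij ab; rewrite !ltr_norml; lra.
Qed.

Lemma jointly_cauchy_euler T v0 f : 0 < T -> approximable f ->
  jointly_cauchy N T (euler v0 f).
Proof.
move=> T0 fa; apply: (jointly_cauchy_approx N_norm) => e e0.
have [B B0 hB] := equivalent_norm_lower N_norm.
have [n [c [phi [b [sphi fb be]]]]] := fa _ _ T0 (divr_gt0 e0 B0).
exists (euler v0 (ramps n c phi)); first exact: jointly_cauchy_ramps (ltW T0) sphi.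
move=> k i iT.
apply: (le_trans (euler_stable N_norm M_diss v0 v0 (b := fun t => B * b t) (T := T) _ iT)).
  move=> s t s0 st tT; apply: (le_trans (hB _)).
  by rewrite -mulrBr ler_pM2l// fb.
rewrite subrr (enorm0 N_norm) add0r -mulrBr mulrC -ler_pdivlMr//.
have i0 : 0 <= i%:R * dyadic k by rewrite mulr_ge0// ltW// dyadic_gt0.
have := fb _ _ i0 iT (lexx _).
have := rnorm_ge0 (f T - ramps n c phi T -
        (f (i%:R * dyadic k) - ramps n c phi (i%:R * dyadic k))).
lra.
Qed.

(** The Euler points recovered from the velocities; the weights are the increments
    of [id], that is the time step, so that the results on Stieltjes sums apply. *)
Definition position (x0 : V) (v : nat -> nat -> V) k i : V :=
  x0 + \sum_(0 <= a < i) (increment id k a)%:C *: v k a.+1.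

Lemma increment_id k a : increment id k a = dyadic k.
Proof. by rewrite /increment -mulrBl -natrB// subSnn mul1r. Qed.

Lemma slow_id T : slow T (@id R).
Proof. by move=> s t _ st _; rewrite lexx andbT subr_ge0. Qed.

Lemma jointly_cauchy_position T x0 v : 0 <= T -> jointly_cauchy N T v ->
  jointly_cauchy N T (position x0 v).
Proof.
move=> T0 hv; apply: (jointly_cauchyD N_norm).
  by move=> e e0; exists 1 => //; exists 0 => *; rewrite subrr (enorm0 N_norm) ltW.
have [c c0 [K0 hc]] := jointly_cauchy_bounded N_norm T0 hv.
have aT k a i : (a < i)%N -> i%:R * dyadic k <= T -> a.+1%:R * dyadic k <= T.
  by move=> ai; apply: le_trans; rewrite ler_wpM2r ?ler_nat// ltW// dyadic_gt0.
apply: (jointly_cauchy_stieltjes N_norm (K0 := K0) (q := fun k i a => v k a.+1)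
  T0 c0 (@slow_id T)).
  by move=> k i a Kk ai iT; exact: hc Kk (aT _ _ _ ai iT).
move=> e e0; have [d d0 [K hK]] := hv _ e0.
have d20 : 0 < d / 2 by rewrite divr_gt0.
have [K' hK'] := dyadic_small d20.
exists (d / 2) => //; exists (maxn K K') => k l i j a b.
rewrite !geq_max => /andP[Kk /hK' kd] /andP[Kl /hK' ld] iT jT ij ai bj ab.
apply: hK => //; [exact: aT ai iT | exact: aT bj jT|].
have := dyadic_gt0 R k; have := dyadic_gt0 R l.
by move: ab; rewrite -[a.+1%:R]natr1 -[b.+1%:R]natr1 !mulrDl !ltr_norml; lra.
Qed.

(** The velocity recursion is the Euler scheme: [v = M x + f] at every grid point,
    which holds at the start by the choice of [v_0] and is preserved because
    [v_{j+1} - v_j = h M v_{j+1} + f_{j+1} - f_j]. *)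
Lemma position_dom x0 f k i : op_dom M x0 ->
  op_dom M (position x0 (euler (M x0 + f 0) f) k i) /\
  M (position x0 (euler (M x0 + f 0) f) k i) + f (i%:R * dyadic k) =
    euler (M x0 + f 0) f k i.
Proof.
move=> dx0; have k0 := dyadic_gt0 R k; rewrite /position.
elim: i => [|i [di Mi]]; first by rewrite big_geq// addr0 mul0r.
rewrite big_nat_recr//= addrA increment_id.
set x := x0 + _ in di Mi *; set f1 := f (i.+1%:R * _); set f0 := f (i%:R * _) in Mi *.
set v0 := euler _ _ _ _ in Mi *.
have dv : op_dom M (resolvent M (dyadic k) (v0 + (f1 - f0))) by exact: (resolvent_dom M_diss).
split; first exact/op_domD/op_domZ.
have dhv := op_domZ (dyadic k)%:C dv.
rewrite (opD di dhv) (opZ _ dv) (resolventE M_diss)//.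
set r := resolvent _ _ _; rewrite -Mi -(addrA (M x) f0) [f0 + _]addrC subrK.
by rewrite addrAC addrC subrK.
Qed.

Definition grid_limit (v : nat -> nat -> V) (w : R -> V) := forall T e : R, 0 < e ->
  exists2 d : R, 0 < d & exists K, forall k i t, (K <= k)%N -> 0 <= t -> t <= T ->
    i%:R * dyadic k <= T -> `|i%:R * dyadic k - t| < d -> N (v k i - w t) <= e.

Lemma grid_limit_index v w (t e : R) : grid_limit v w -> 0 <= t -> 0 < e ->
  exists K, forall k, (K <= k)%N -> N (v k (grid_index k t) - w t) <= e.
Proof.
move=> vw t0 e0; have [d d0 [K hK]] := vw t _ e0.
have [K' hK'] := dyadic_small d0; exists (maxn K K') => k.
rewrite geq_max => /andP[Kk /hK' kd]; apply: hK => //; first exact: grid_index_le.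
by have := grid_index_le k t0; have := grid_index_gt k t0; rewrite ltr_norml; lra.
Qed.

Lemma grid_limit_continuous v w : grid_limit v w -> continuous_on w.
Proof.
have [a a0 ha] := equivalent_norm_upper N_norm.
move=> vw t t0 e e0.
have e' : 0 < e / a / 2 by rewrite !divr_gt0.
have [d d0 [K hK]] := vw (t + 1) _ e'.
exists (Num.min 1 (d / 2)); first by rewrite lt_min ltr01 divr_gt0.
move=> s s0; rewrite lt_min => /andP[st1 std].
have [K' hK'] := dyadic_small (divr_gt0 d0 (ltr0Sn R 1)).
pose k := maxn K K'; have kd := hK' k (leq_maxr _ _).
have le := grid_index_le k s0; have gt := grid_index_gt k s0; set i := grid_index k s in le gt.
have h1 := hK k i s (leq_maxl _ _) s0; have h2 := hK k i t (leq_maxl _ _) t0.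
apply: (le_trans (ha _)); rewrite mulrC -ler_pdivlMr//.
apply: (le_trans (enorm_dist N_norm (v k i) _ _)).
rewrite (enorm_distC N_norm (w s)) [leRHS]splitr; apply: lerD.
  by apply: h1; rewrite ?ltr_norml; move: st1; rewrite ltr_norml; lra.
by apply: h2; move: st1 std; rewrite ?ltr_norml; lra.
Qed.

(** A difference quotient of [x] is an average of velocities over the interval, and
    these are close to [w t] when the interval is close to [t]. *)
Lemma position_derivative x0 v w x : grid_limit v w ->
  grid_limit (position x0 v) x -> derivative_on x w.
Proof.
have [a a0 ha] := equivalent_norm_upper N_norm.
move=> vw xx t t0 e e0.
have ea0 : 0 < e / a by rewrite divr_gt0.
have [d d0 [K hK]] := vw (t + 1) _ ea0.
have d20 : 0 < d / 2 by rewrite divr_gt0.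
have key (lo hi : R) : 0 <= lo -> lo <= hi -> hi <= t + 1 -> t - d / 2 < lo ->
    hi < t + d / 2 -> N (x hi - x lo - (hi - lo)%:C *: w t) <= e / a * (hi - lo).
  move=> lo0 lohi hiT lot hit; apply/ler_addgt0Pr => f f0.
  have hi0 := le_trans lo0 lohi.
  have f40 : 0 < f / 4 by rewrite divr_gt0.
  have [K1 hK1] := grid_limit_index xx lo0 f40.
  have [K2 hK2] := grid_limit_index xx hi0 f40.
  have C0 : 0 < N (w t) + e / a + 1 by have := enorm_ge0 N_norm (w t); lra.
  have [K3 hK3] := dyadic_small (divr_gt0 f40 C0).
  have [K4 hK4] := dyadic_small d20.
  pose k := maxn (maxn K K1) (maxn K2 (maxn K3 K4)).
  have [Kk K1k K2k K3k K4k] : [/\ K <= k, K1 <= k, K2 <= k, K3 <= k & K4 <= k]%N.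
    by split; rewrite /k !leq_max leqnn ?orbT.
  have {}hK1 := hK1 _ K1k; have {}hK2 := hK2 _ K2k.
  have {}hK3 := hK3 _ K3k; have {}hK4 := hK4 _ K4k.
  have ile := grid_index_le k lo0; have igt := grid_index_gt k lo0.
  have jle := grid_index_le k hi0; have jgt := grid_index_gt k hi0.
  have ij : (grid_index k lo <= grid_index k hi)%N.
    by apply: le_truncn; rewrite ler_wpM2r// exprn_ge0.
  set i := grid_index k lo in hK1 ile igt ij; set j := grid_index k hi in hK2 jle jgt ij.
  have k0 := dyadic_gt0 R k.
  set z := j%:R * dyadic k - i%:R * dyadic k.
  have z0 : 0 <= z by rewrite subr_ge0 ler_wpM2r ?ler_nat// ltW.
  have sumE : position x0 v k j - position x0 v k i - z%:C *: w t =
      \sum_(i <= b < j) (increment id k b)%:C *: (v k b.+1 - w t).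
    rewrite /position (big_cat_nat (n := i) (p := j))//= addrA [X in X - _ - _]addrC addrK.
    have -> : z = \sum_(i <= b < j) increment id k b by rewrite increment_sum.
    rewrite rmorph_sum/= scaler_suml -sumrB.
    by apply: eq_bigr => b _; rewrite scalerBr.
  have : N (position x0 v k j - position x0 v k i - z%:C *: w t) <= e / a * z.
    rewrite sumE.
    have jT : j%:R * dyadic k <= t + 1 by lra.
    apply: (stieltjes_bound N_norm (@slow_id (t + 1)) ij jT (ltW ea0)).
    move=> b /andP[ib bj].
    have bj' : b.+1%:R * dyadic k <= j%:R * dyadic k by rewrite ler_wpM2r ?ler_nat// ltW.
    have ib' : i%:R * dyadic k <= b%:R * dyadic k by rewrite ler_wpM2r ?ler_nat// ltW.
    apply: hK => //; [lra|lra|].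
    by move: bj'; rewrite -[b.+1%:R]natr1 mulrDl mul1r ltr_norml; lra.
  have zE : `|z - (hi - lo)| <= dyadic k by rewrite /z ler_norml; lra.
  have {}zE : N ((z - (hi - lo))%:C *: w t) <= dyadic k * N (w t).
    by rewrite (equivalent_normZ N_norm) ler_wpM2r// (enorm_ge0 N_norm).
  have -> : x hi - x lo - (hi - lo)%:C *: w t =
     (position x0 v k j - position x0 v k i - z%:C *: w t)
     - (position x0 v k j - x hi) + (position x0 v k i - x lo)
     + (z - (hi - lo))%:C *: w t.
    by rewrite [(z - _)%:C]rmorphB/= scalerBl; exact: subr_insert.
  have := equivalent_normD N_norm (position x0 v k j - position x0 v k i - z%:C *: w t
     - (position x0 v k j - x hi) + (position x0 v k i - x lo))
     ((z - (hi - lo))%:C *: w t).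
  have := equivalent_normD N_norm (position x0 v k j - position x0 v k i - z%:C *: w t
     - (position x0 v k j - x hi)) (position x0 v k i - x lo).
  have := equivalent_normD N_norm (position x0 v k j - position x0 v k i - z%:C *: w t)
     (- (position x0 v k j - x hi)).
  rewrite (enormN N_norm).
  have : e / a * z <= e / a * (hi - lo + dyadic k).
    by rewrite ler_pM2l// /z; lra.
  move: hK3; rewrite ltr_pdivlMr// !mulrDr !mulr1.
  have := mulr_gt0 k0 ea0.
  have := mulr_ge0 (ltW k0) (enorm_ge0 N_norm (w t)).
  lra.
exists (Num.min 1 (d / 2)); first by rewrite lt_min ltr01.
move=> s s0; rewrite lt_min !ltr_norml => /andP[st1 std].
apply: (le_trans (ha _)); rewrite mulrC -ler_pdivlMr// mulrAC.
have [st|/ltW ts] := leP t s.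
  by rewrite ger0_norm ?subr_ge0//; apply: key => //; lra.
rewrite -(enormN N_norm) opprB.
rewrite distrC ger0_norm ?subr_ge0//.
have -> : (s - t)%:C *: w t - (x s - x t) = x t - x s - (t - s)%:C *: w t.
  by rewrite opprB addrC -(opprB t s) rmorphN scaleNr.
by apply: key => //; lra.
Qed.

(** The identity [v = M x + f] passes to the limit in the form
    [x = R_1 (x - v + f)], where only the bounded operator [R_1] occurs. *)
Theorem cauchy_problem_solution x0 f : op_dom M x0 -> approximable f ->
  exists x v : R -> V, [/\ x 0 = x0,
    forall t, 0 <= t -> op_dom M (x t) /\ v t = M (x t) + f t,
    continuous_on v & derivative_on x v].
Proof.
move=> dx0 fa; pose vs := euler (M x0 + f 0) f; pose xs := position x0 vs.
have hv T : 0 < T -> jointly_cauchy N T vs by move=> T0; exact: jointly_cauchy_euler.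
have hx T : 0 < T -> jointly_cauchy N T xs.
  by move=> T0; apply: jointly_cauchy_position (ltW T0) (hv _ T0).
have [w vw] := jointly_cauchy_limit N_norm hv.
have [x xx] := jointly_cauchy_limit N_norm hx.
exists x, w; split; last 2 first.
- exact: grid_limit_continuous vw.
- exact: position_derivative vw xx.
- apply/eqP; rewrite -subr_eq0; apply/eqP/(enorm_le0 N_norm)/ler_addgt0Pr => e e0.
  have [K hK] := grid_limit_index xx (lexx 0) e0.
  have := hK K (leqnn K); rewrite (enorm_distC N_norm) add0r.
  by rewrite /grid_index mul0r truncn0 /xs /position big_geq// addr0.
move=> t t0; pose y := resolvent M 1 (x t - w t + f t).
have [dy' yE] := resolvent_spec M_diss (x t - w t + f t) (@ltr01 R).
suff xy : x t = y.
  rewrite xy {1}/y; split=> //.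
  move: yE; rewrite -/y xy rmorph1 scale1r -[RHS]addrA => /addrI yE.
  by rewrite -[M y]opprK yE opprD opprK subrK.
apply/eqP; rewrite -subr_eq0; apply/eqP/(enorm_le0 N_norm)/ler_addgt0Pr => e e0.
have [B B0 hB] := equivalent_norm_lower N_norm.
have e40 : 0 < e / 4 by rewrite divr_gt0.
have [K1 hK1] := grid_limit_index xx t0 e40.
have [K2 hK2] := grid_limit_index vw t0 e40.
have [d d0 hd] := approximable_continuous fa t0 (divr_gt0 e40 B0).
have [K3 hK3] := dyadic_small d0.
pose k := maxn K1 (maxn K2 K3).
have [K1k K2k K3k] : [/\ K1 <= k, K2 <= k & K3 <= k]%N.
  by split; rewrite /k !leq_max leqnn ?orbT.
have {}hK1 := hK1 _ K1k; have {}hK2 := hK2 _ K2k; have {}hK3 := hK3 _ K3k.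
have ile := grid_index_le k t0; have igt := grid_index_gt k t0.
set i := grid_index k t in hK1 hK2 ile igt.
have fd : N (f (i%:R * dyadic k) - f t) <= e / 4.
  apply: (le_trans (hB _)); rewrite mulrC -ler_pdivlMr//; apply: hd.
    by rewrite mulr_ge0// ltW// dyadic_gt0.
  by rewrite ltr_norml; lra.
have [dxi xiE] := position_dom f k i dx0; rewrite -/vs -/xs in dxi xiE.
have xsE : xs k i = resolvent M 1 (xs k i - vs k i + f (i%:R * dyadic k)).
  rewrite -xiE opprD addrA subrK -{1}(resolvent_uniq N_norm M_diss (@ltr01 R) dxi).
  by rewrite rmorph1 scale1r.
apply: (le_trans (enorm_dist N_norm (xs k i) _ _)).
have : N (xs k i - y) <= N (xs k i - x t) + N (vs k i - w t) +
    N (f (i%:R * dyadic k) - f t).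
  rewrite {1}xsE /y -(resolventB N_norm M_diss)//.
  apply: (le_trans (resolvent_le M_diss _ (@ltr01 R))).
  rewrite subrDD subrACA -addrA.
  apply: (le_trans (equivalent_normD N_norm _ _)); rewrite -[leRHS]addrA lerD2l.
  by rewrite -(enormN N_norm (vs k i - w t)); exact: (equivalent_normD N_norm).
move: hK1; rewrite (enorm_distC N_norm (x t)); lra.
Qed.

End cauchy_problem.

(** * Coercive operators and the energy norm *)

Lemma exists_linear (R : realType) (V W : lmodType R[i]) (f : V -> W) :
  linear f -> exists g : {linear V -> W}, g =1 f.
Proof.
move=> lf.
by exists (HB.pack_for {linear V -> W} f (GRing.isLinear.Build R[i] V W *:%R f lf)).
Qed.

Lemma dense_rnorm (R : realType) (V : normedModType R[i]) (D : set V) :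
  (forall x (e : R), 0 < e -> exists2 y, D y & rnorm (x - y) < e) -> dense D.
Proof.
move=> h O [x Ox] oO.
have /near_rnorm[e e0 eO] : \forall y \near x, O y by exact: open_nbhs_nbhs.
by have [y Dy /eO Oy] := h x e e0; exists y.
Qed.

Lemma contraction_fixpoint (R : realType) (V : completeNormedModType R[i])
    (N : V -> R) (N_norm : equivalent_norm N) (F : V -> V) (q : R) :
  0 <= q -> q < 1 -> (forall x y, N (F x - F y) <= q * N (x - y)) ->
  exists x, F x = x.
Proof.
move=> q0 q1 hF; pose x n := iter n F 0.
have step n : N (x n.+1 - x n) <= q ^+ n * N (F 0).
  elim: n => [|n IH]; first by rewrite expr0 mul1r /x /= subr0.
  by apply: (le_trans (hF _ _)); rewrite exprS -mulrA ler_wpM2l.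
have tail n m : (1 - q) * N (x (m + n)%N - x n) <= (q ^+ n - q ^+ (m + n)) * N (F 0).
  elim: m => [|m IH]; first by rewrite add0n !subrr (enorm0 N_norm) mulr0 mul0r.
  have h1 := enorm_dist N_norm (x (m + n)%N) (x (m + n).+1) (x n).
  have h2 := step (m + n)%N; have q1' : 0 <= 1 - q by lra.
  have := ler_wpM2l q1' h1; have := ler_wpM2l q1' h2.
  rewrite addSn exprS; lra.
have [e e0|l hl] := equivalent_norm_complete N_norm (x := x).
  have C0 : 0 < N (F 0) + 1 by have := enorm_ge0 N_norm (F 0); lra.
  have : (fun n => q ^+ n) @ \oo --> 0 by apply: cvg_expr; rewrite ger0_norm.
  move/cvgrPdist_lt => /(_ (e * (1 - q) / (N (F 0) + 1))) [].
    by rewrite !divr_gt0// mulr_gt0//; lra.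
  move=> K _ hK; have sym k l : (K <= k)%N -> (k <= l)%N -> N (x l - x k) <= e.
    move=> Kk /subnK <-; have := tail k (l - k)%N.
    have := hK k Kk; rewrite /= sub0r normrN ger0_norm ?exprn_ge0// ltr_pdivlMr//.
    move=> h1 h2; have q1' : 0 < 1 - q by lra.
    rewrite -(ler_pM2l q1'); apply: (le_trans h2).
    have : 0 <= q ^+ (l - k + k) * N (F 0).
      by rewrite mulr_ge0 ?exprn_ge0// (enorm_ge0 N_norm).
    have : 0 <= q ^+ k by rewrite exprn_ge0.
    lra.
  exists K => k m Kk Km; have [km|/ltnW mk] := leqP k m; last exact: sym.
  by rewrite (enorm_distC N_norm); exact: sym.
exists l; apply/eqP; rewrite -subr_eq0; apply/eqP/(enorm_le0 N_norm).
apply/ler_addgt0Pr => e e0; rewrite add0r.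
have [K hK] := hl _ (divr_gt0 e0 (ltr0Sn R 1)).
have := hK K (leqnn K); have := hK K.+1 (leqnSn K).
have := enorm_dist N_norm (x K.+1) (F l) l; have := hF l (x K).
have := ler_piMl (enorm_ge0 N_norm (l - x K)) (ltW q1).
rewrite [N (l - x K)](enorm_distC N_norm) /=; rewrite -/(x K.+1).
rewrite [X in F l - X](_ : _ = x K.+1)//; lra.
Qed.

Lemma rnorm_equivalent (R : realType) (V : normedModType R[i]) :
  equivalent_norm (@rnorm R V).
Proof.
split; [exact: rnormD|exact: rnormZ| |]; by exists 1 => // x; rewrite mul1r.
Qed.

Section coercive.
Variables (R : realType) (V : hilbertType R).

(** [|x - tau T x|^2 = |x|^2 - 2 tau (x, T x) + tau^2 |T x|^2], and the quadratic
    term is dominated by the middle one for small [tau]. *)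
Lemma coercive_contraction (T : {linear V -> V}) (m C : R) : 0 < m -> 0 < C ->
  (forall x, rnorm (T x) <= C * rnorm x) ->
  (forall x, m * rnorm x ^+ 2 <= rin x (T x)) ->
  exists tau q : R, [/\ 0 < tau, 0 <= q, q < 1 &
    forall x, rnorm (x - tau%:C *: T x) <= q * rnorm x].
Proof.
move=> m0 C0 TC Tm; pose C' := C + m; have C'0 : 0 < C' by rewrite /C'; lra.
(* This step minimises 1 - 2 tau m + tau^2 C'^2, and C' >= m makes the minimum
   nonnegative. *)
exists (m / C' ^+ 2), (Num.sqrt (1 - m ^+ 2 / C' ^+ 2)).
have t0 : 0 < m / C' ^+ 2 by rewrite divr_gt0// exprn_gt0.
have q0 : 0 <= 1 - m ^+ 2 / C' ^+ 2.
  by rewrite subr_ge0 ler_pdivrMr ?exprn_gt0// mul1r ler_sqr ?nnegrE /C'; lra.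
split; [by []|exact: sqrtr_ge0| |move=> x].
  rewrite -[ltRHS]sqrtr1 ltr_sqrt// ltrBlDr ltrDl.
  by rewrite divr_gt0// exprn_gt0.
rewrite -(@ler_pXn2r _ 2) ?nnegrE ?mulr_ge0 ?sqrtr_ge0 ?rnorm_ge0//.
rewrite exprMn sqr_sqrtr// -rin_norm rinBr !rinBl !rinZr !rinZl.
rewrite !rin_norm (rinC (T x)).
set t := m / C' ^+ 2 in t0 *.
have h1 : rnorm (T x) ^+ 2 <= C' ^+ 2 * rnorm x ^+ 2.
  rewrite -exprMn ler_sqr ?nnegrE ?mulr_ge0 ?rnorm_ge0//; last by rewrite ltW.
  by apply: (le_trans (TC x)); rewrite ler_wpM2r ?rnorm_ge0// /C'; lra.
have h2 : t * (t * rnorm (T x) ^+ 2) <= t * m * rnorm x ^+ 2.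
  rewrite -mulrA ler_pM2l//; apply: (le_trans (ler_wpM2l (ltW t0) h1)).
  by rewrite mulrA /t divfK// gt_eqF// exprn_gt0.
have h3 := ler_wpM2l (ltW t0) (Tm x).
have -> : m ^+ 2 / C' ^+ 2 = t * m by rewrite /t expr2 mulrAC.
lra.
Qed.

(** With [S] the identity this solves [T x = g]; with [S] the resolvent
    [(I - A)^-1] it solves [T x - tau^-1 A x = g]. *)
Lemma coercive_solve (T : {linear V -> V}) (m C : R) : 0 < m -> 0 < C ->
  (forall x, rnorm (T x) <= C * rnorm x) ->
  (forall x, m * rnorm x ^+ 2 <= rin x (T x)) ->
  exists2 tau : R, 0 < tau & forall S : V -> V,
    (forall x y, rnorm (S x - S y) <= rnorm (x - y)) ->
    forall g, exists x, S (x - tau%:C *: (T x - g)) = x.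
Proof.
move=> m0 C0 TC Tm; have [tau [q [t0 q0 q1 hq]]] := coercive_contraction m0 C0 TC Tm.
exists tau => // S hS g.
apply: (contraction_fixpoint (rnorm_equivalent V) q0 q1) => x y.
apply: (le_trans (hS _ _)); apply: le_trans (hq _).
have -> : T (x - y) = T x - g - (T y - g) by rewrite linearB opprB addrA subrK.
by rewrite subrACA -scalerBr.
Qed.

Variables (Q : {linear V -> V}).
Hypothesis Q_cont : continuous Q.
Hypothesis Q_selfadjoint : forall x y, inner x (Q y) = inner (Q x) y.
Hypothesis Q_posdef : exists2 c : R, 0 < c &
  forall x, c%:C * `|x| ^+ 2 <= inner x (Q x).

Lemma rin_selfadjoint x y : rin x (Q y) = rin (Q x) y.
Proof. by rewrite /rin Q_selfadjoint. Qed.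

Let QB x y : Q (x - y) = Q x - Q y.
Proof. exact: linearB. Qed.

Let QZ a x : Q (a *: x) = a *: Q x.
Proof. by rewrite linearZ. Qed.

Lemma coercive_rin : exists2 c : R, 0 < c &
  forall x, c * rnorm x ^+ 2 <= rin x (Q x).
Proof.
have [c c0 hc] := Q_posdef; exists c => // x; have := hc x.
rewrite -rnormE -rmorphXn/= -rmorphM/= /rin; case: (inner x (Q x)) => a b.
by rewrite lecE => /andP[_].
Qed.

Definition energy_norm x : R := Num.sqrt (rin x (Q x)).

Lemma energy_norm_sqr x : energy_norm x ^+ 2 = rin x (Q x).
Proof.
have [c c0 hc] := coercive_rin; rewrite sqr_sqrtr//.
by apply: le_trans (hc x); rewrite mulr_ge0 ?(ltW c0)// exprn_ge0// rnorm_ge0.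
Qed.

Lemma energy_norm_ge0 x : 0 <= energy_norm x.
Proof. exact: sqrtr_ge0. Qed.

(** Cauchy-Schwarz for the form [(x, Q y)]: expand the nonnegative energy of
    [(y, Q y) x - (x, Q y) y]. *)
Lemma energy_norm_cs x y : rin x (Q y) <= energy_norm x * energy_norm y.
Proof.
have [y0|yn0] := eqVneq (energy_norm y) 0.
  have [c c0 hc] := coercive_rin.
  have : rnorm y = 0.
    apply/eqP; rewrite -sqrf_eq0; apply/eqP/le_anti; rewrite exprn_ge0 ?rnorm_ge0// andbT.
    by have := hc y; rewrite -energy_norm_sqr y0 expr0n/= pmulr_rle0.
  by move/rnorm_eq0 => ->; rewrite linear0 rin0r mulr_ge0 ?energy_norm_ge0.
have y0 : 0 < energy_norm y by rewrite lt0r yn0 energy_norm_ge0.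
set b := rin x (Q y).
have : 0 <= energy_norm ((energy_norm y ^+ 2)%:C *: x - b%:C *: y) ^+ 2.
  by rewrite exprn_ge0// energy_norm_ge0.
rewrite energy_norm_sqr QB !QZ rinBr !rinBl !rinZr !rinZl.
rewrite (rin_selfadjoint y x) (rinC (Q y)) -/b -!energy_norm_sqr.
set p := energy_norm y in y0 *; set r := energy_norm x.
have r0 : 0 <= r by exact: energy_norm_ge0.
have -> : p ^+ 2 * (p ^+ 2 * r ^+ 2) - p ^+ 2 * (b * b) -
  (b * (p ^+ 2 * b) - b * (b * p ^+ 2)) = p ^+ 2 * ((r * p) ^+ 2 - b ^+ 2) by ring.
rewrite pmulr_rge0 ?exprn_gt0// subr_ge0 => h.
have rp0 : 0 <= r * p by rewrite mulr_ge0// ltW.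
apply: (le_trans (ler_norm b)).
by rewrite -(@ler_pXn2r _ 2) ?nnegrE// real_normK// num_real.
Qed.

Lemma energy_norm_equivalent : equivalent_norm energy_norm.
Proof.
have [c c0 hc] := coercive_rin; have [C C0 hC] := continuous_rbounded Q_cont.
split.
- move=> x y.
  rewrite -(@ler_pXn2r _ 2) ?nnegrE ?addr_ge0 ?energy_norm_ge0// sqrrD.
  rewrite energy_norm_sqr linearD rinDr !rinDl (rin_selfadjoint y x) (rinC (Q y)).
  rewrite -!energy_norm_sqr.
  have := energy_norm_cs x y; lra.
- move=> r x; rewrite /energy_norm QZ rinZr rinZl mulrA -expr2.
  by rewrite sqrtrM ?sqr_ge0// sqrtr_sqr.
- exists (Num.sqrt c)^-1; first by rewrite invr_gt0 sqrtr_gt0.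
  move=> x; rewrite mulrC ler_pdivlMr ?sqrtr_gt0//.
  rewrite -(@ler_pXn2r _ 2) ?nnegrE ?mulr_ge0 ?energy_norm_ge0 ?rnorm_ge0 ?sqrtr_ge0//.
  by rewrite exprMn (sqr_sqrtr (ltW c0)) mulrC energy_norm_sqr hc.
- exists (Num.sqrt C); first by rewrite sqrtr_gt0.
  move=> x.
  rewrite -(@ler_pXn2r _ 2) ?nnegrE ?mulr_ge0 ?energy_norm_ge0 ?rnorm_ge0 ?sqrtr_ge0//.
  rewrite exprMn (sqr_sqrtr (ltW C0)) energy_norm_sqr.
  apply: (le_trans (rin_cs _ _)); rewrite mulrC expr2 mulrA.
  by rewrite ler_wpM2r ?rnorm_ge0.
Qed.

(** [Q] is onto by the fixed point argument of [coercive_solve]; its inverse is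
    again bounded and coercive, since [(x, P x) = (P x, Q (P x))]. *)
Lemma coercive_inverse : exists (P : {linear V -> V}) (m C : R),
  [/\ 0 < m, 0 < C, cancel P Q & cancel Q P] /\
  (forall x, rnorm (P x) <= C * rnorm x) /\
  (forall x, m * rnorm x ^+ 2 <= rin x (P x)).
Proof.
have [c c0 hc] := coercive_rin; have [C C0 hC] := continuous_rbounded Q_cont.
have cb x : c * rnorm x <= rnorm (Q x).
  have [->|x0] := eqVneq (rnorm x) 0; first by rewrite mulr0 rnorm_ge0.
  have {}x0 : 0 < rnorm x by rewrite lt0r x0 rnorm_ge0.
  rewrite -(ler_pM2r x0) -mulrA -expr2; apply: (le_trans (hc x)).
  by rewrite mulrC rin_cs.
have Qinj : injective Q.
  move=> x y xy; apply/eqP; rewrite -subr_eq0; apply/eqP/rnorm_le0.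
  by rewrite -(pmulr_rle0 _ c0); apply: le_trans (cb _) _; rewrite linearB xy subrr rnorm0.
have [tau t0 solve] := coercive_solve c0 C0 hC hc.
have Qonto g : exists x, Q x = g.
  have [x /= xE] := solve id (fun x y => lexx _) g; exists x.
  move/eqP: xE; rewrite -subr_eq0 addrAC subrr add0r oppr_eq0 scaler_eq0.
  by rewrite subr_eq0 (inj_eq (@complexI R)) gt_eqF//= => /eqP.
have [P' P'K] := choice Qonto.
have lP : linear P' by move=> a x y; apply: Qinj; rewrite linearP !P'K.
have [P PE] := exists_linear lP.
have PK : cancel P Q by move=> x; rewrite PE.
have Pb x : rnorm (P x) <= c^-1 * rnorm x.
  by rewrite mulrC ler_pdivlMr// mulrC; apply: le_trans (cb _) _; rewrite PK.
exists P, (c / C ^+ 2), c^-1; split.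
  split => //; [by rewrite divr_gt0// exprn_gt0|by rewrite invr_gt0|].
  by move=> x; apply: Qinj; rewrite PK.
split=> // x; rewrite rinC.
apply: (@le_trans _ _ (c * rnorm (P x) ^+ 2)).
  rewrite -mulrA ler_pM2l// mulrC ler_pdivrMr ?exprn_gt0// mulrC -exprMn.
  rewrite ler_sqr ?nnegrE ?mulr_ge0 ?rnorm_ge0 ?(ltW C0)//.
  by have := hC (P x); rewrite PK.
by have := hc (P x); rewrite PK.
Qed.

Variable T : operator V V.
Hypothesis T_dense : dense (op_dom T).
Hypothesis T_skew : forall x, op_dom T x -> rin x (T x) = 0.
Hypothesis T_range : forall g, exists2 x, op_dom T x & x - T x = g.

Lemma skew_rnorm_le z : op_dom T z -> rnorm z <= rnorm (z - T z).
Proof.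
move=> dz; rewrite -(@ler_pXn2r _ 2) ?nnegrE ?rnorm_ge0// -!rin_norm rinBr !rinBl.
by rewrite (rinC (T z)) T_skew// !subr0 sub0r opprK lerDl rin_norm sqr_ge0.
Qed.

Let TQ_dom : set V := [set x | op_dom T (Q x)].

Let TQ_dom0 : TQ_dom 0.
Proof. by rewrite /TQ_dom /= linear0; exact: op_dom0. Qed.

Let TQ_domP a x y : TQ_dom x -> TQ_dom y -> TQ_dom (a *: x + y).
Proof. by rewrite /TQ_dom /= linearP; exact: op_domP. Qed.

Let TQ_linear a x y : TQ_dom x -> TQ_dom y ->
  T (Q (a *: x + y)) = a *: T (Q x) + T (Q y).
Proof. by rewrite linearP; exact: op_linear. Qed.

Definition precomp : operator V V := Operator TQ_dom0 TQ_domP TQ_linear.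

(** The cross term is [h (Q x, T (Q x)) = 0]: precomposition with [Q] preserves
    skewness when the inner product is weighted by [Q]. *)
Lemma precomp_le (h : R) x : 0 < h -> op_dom precomp x ->
  energy_norm x <= energy_norm (x - h%:C *: precomp x).
Proof.
move=> h0 dx; rewrite -(@ler_pXn2r _ 2) ?nnegrE ?energy_norm_ge0//.
rewrite !energy_norm_sqr QB QZ rinBr !rinBl !rinZr !rinZl /=.
have -> : rin x (Q (T (Q x))) = 0 by rewrite rin_selfadjoint T_skew.
have -> : rin (T (Q x)) (Q x) = 0 by rewrite rinC T_skew.
rewrite -!energy_norm_sqr; have := sqr_ge0 (energy_norm (T (Q x))).
move/(ler_wpM2l (ltW h0))/(ler_wpM2l (ltW h0)).
lra.
Qed.

(** For one particular step the equation [x - h T (Q x) = g], written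
    [P z - h T z = g] with [z = Q x], is solved by [coercive_solve]. The step is
    then decreased: if [I - h1 T Q] is onto and [h1 < 2 h2], then
    [x - h2 T (Q x) = g] is a fixed point equation for the resolvent of step [h1]
    with contraction factor [|1 - h1 / h2| < 1]. *)
Lemma precomp_range (h : R) g : 0 < h ->
  exists2 x, op_dom precomp x & x - h%:C *: precomp x = g.
Proof.
have [P [m [C [[m0 C0 PK QK] [hC hm]]]]] := coercive_inverse.
have /choice[S /all_and2[dS SE]] : forall y, exists x, op_dom T x /\ x - T x = y.
  by move=> y; have [x] := T_range y; exists x.
have Scontr x y : rnorm (S x - S y) <= rnorm (x - y).
  have dz := op_domB (dS x) (dS y); set z := S x - S y in dz *.
  have -> : x - y = z - T z by rewrite /z opB// subrACA !SE.
  exact: skew_rnorm_le.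
have [tau t0 solve] := coercive_solve m0 C0 hC hm.
have range0 f : exists2 x, op_dom precomp x & x - (tau^-1)%:C *: precomp x = f.
  have [x xE] := solve S Scontr f; have := SE (x - tau%:C *: (P x - f)).
  rewrite xE => /addrI/oppr_inj TE; exists (P x); rewrite /= /TQ_dom/= PK.
    by rewrite -xE.
  by rewrite TE scalerA -rmorphM/= mulVf ?gt_eqF// rmorph1 scale1r opprB addrC subrK.
have bootstrap (h1 h2 : R) : 0 < h1 -> h1 < 2 * h2 ->
    (forall f, exists2 x, op_dom precomp x & x - h1%:C *: precomp x = f) ->
    forall f, exists2 x, op_dom precomp x & x - h2%:C *: precomp x = f.
  move=> h10 h12 onto f; have h20 : 0 < h2 by lra.
  have /choice[S' /all_and2[dS' SE']] : forall y, exists x,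
      op_dom precomp x /\ x - h1%:C *: precomp x = y.
    by move=> y; have [x] := onto y; exists x.
  have S'contr x y : energy_norm (S' x - S' y) <= energy_norm (x - y).
    have dz := op_domB (dS' x) (dS' y); set z := S' x - S' y in dz *.
    have -> : x - y = z - h1%:C *: precomp z.
      by rewrite /z opB// scalerBr subrACA !SE'.
    exact: precomp_le.
  pose F x := S' ((1 - h1 / h2)%:C *: x + (h1 / h2)%:C *: f).
  have q1 : `|1 - h1 / h2| < 1.
    have p0 : 0 < h1 / h2 by rewrite divr_gt0.
    have p2 : h1 / h2 < 2 by rewrite ltr_pdivrMr.
    by rewrite ltr_norml; lra.
  have [|x xE] := contraction_fixpoint energy_norm_equivalent (F := F)
      (normr_ge0 (1 - h1 / h2)) q1.
    move=> x y; apply: (le_trans (S'contr _ _)).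
    rewrite opprD addrACA subrr addr0 -scalerBr.
    by rewrite (equivalent_normZ energy_norm_equivalent).
  have := SE' ((1 - h1 / h2)%:C *: x + (h1 / h2)%:C *: f); rewrite -/(F x) xE => eq1.
  exists x; first by rewrite -xE; exact: dS'.
  have h1E : h1%:C *: precomp x = (h1 / h2)%:C *: (x - f).
    move: eq1; rewrite rmorphB rmorph1 scalerBl scale1r -addrA => /addrI.
    by move/eqP; rewrite eqr_oppLR opprD !opprK -scalerBr => /eqP.
  have -> : h2 = (h2 / h1) * h1 by rewrite divfK// gt_eqF.
  rewrite rmorphM/= -scalerA h1E scalerA -rmorphM/=.
  have -> : h2 / h1 * (h1 / h2) = 1 by rewrite mulrA divfK ?mulfV// gt_eqF.
  by rewrite rmorph1 scale1r opprB addrC subrK.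
have all n : forall h : R, tau^-1 / 2 ^+ n < h ->
    forall f, exists2 x, op_dom precomp x & x - h%:C *: precomp x = f.
  elim: n => [|n IH] h'.
    rewrite expr0 divr1 => th; apply: (bootstrap tau^-1) => //; rewrite ?invr_gt0//.
    have : 0 < tau^-1 by rewrite invr_gt0.
    lra.
  rewrite exprS invfM mulrA => th.
  set r := tau^-1 / 2 ^+ n in IH.
  have r0 : 0 < r by rewrite divr_gt0 ?invr_gt0// exprn_gt0.
  have rh : r < 2 * h' by move: th; rewrite -/r mulrAC -/r; lra.
  (* Any step strictly between r and 2 h' can serve as the intermediate one. *)
  apply: (bootstrap ((r + 2 * h') / 2)); [lra|lra|].
  by apply: IH; lra.
move=> h0; have [K hK] := dyadic_small (mulr_gt0 t0 h0).
apply: (all K); have := hK K (leqnn K); rewrite /dyadic => kt.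
by rewrite mulrC ltr_pdivrMr// mulrC.
Qed.

Lemma precomp_dense : dense (op_dom precomp).
Proof.
have [P [m [C [[m0 C0 PK QK] [hC hm]]]]] := coercive_inverse.
apply: dense_rnorm => x e e0.
have [d dd Qxd] := rnorm_dense (Q x) T_dense (divr_gt0 e0 C0).
exists (P d); first by rewrite /= /TQ_dom/= PK.
rewrite -{1}(QK x) -linearB; apply: (le_lt_trans (hC _)).
by rewrite mulrC -ltr_pdivlMr.
Qed.

Lemma precomp_m_dissipative : m_dissipative energy_norm precomp.
Proof.
by split; [exact: precomp_dense|exact: precomp_le|exact: precomp_range].
Qed.

End coercive.

(** * Indefinite Bochner integrals *)

Section bochner.
Variables (R : realType) (V : hilbertType R).
Local Notation mu := (@lebesgue_measure R).
Implicit Types (s w u v : R -> V) (y : V).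

Lemma simple_cst y : simple_fun (fun=> y : V).
Proof.
split; first by apply: sub_finite_set (finite_set1 y) => _ [t _ <-].
by move=> v; rewrite preimage_cst; case: ifP => _; [exact: measurableT|exact: measurable0].
Qed.

Lemma simple_measurable2 s s' (f : V -> V -> R) (D : set R) :
  simple_fun s -> simple_fun s' -> measurable D ->
  measurable_fun D (fun t => f (s t) (s' t)).
Proof.
move=> [fs ms] [fs' ms'] mD.
apply: (measurable_funS measurableT (@subsetT _ D)) => _ B mB; rewrite setTI.
have -> : (fun t => f (s t) (s' t)) @^-1` B =
    \bigcup_(a in range s) \bigcup_(b in range s' `&` [set b | B (f a b)])
      (s @^-1` [set a] `&` s' @^-1` [set b]).
  apply/seteqP; split=> [t /= Bt|t [a _ [b [_ Bb] [sa sb]]]]; last first.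
    by move: sa sb Bb => /= -> ->.
  by exists (s t); [exists t|exists (s' t)].
apply: fin_bigcup_measurable => // a _; apply: fin_bigcup_measurable.
  exact: finite_setIl.
by move=> b _; apply: measurableI.
Qed.

Lemma simple_integrable2 s s' (f : V -> V -> R) (D : set R) :
  simple_fun s -> simple_fun s' -> measurable D -> (mu D < +oo)%E ->
  mu.-integrable D (EFin \o (fun t => f (s t) (s' t))).
Proof.
move=> hs hs' mD Dfin; apply: measurable_bounded_integrable => //.
  exact: simple_measurable2.
have [fs _] := hs; have [fs' _] := hs'.
pose S := fset_set (range s); pose S' := fset_set (range s').
exists (\sum_(a <- S) \sum_(b <- S') `|f a b|); split; first exact: num_real.
move=> C hC t _ /=; apply: ltW; apply: le_lt_trans hC.
have sS : s t \in enum_fset S by rewrite -[_ \in _]/(s t \in S) in_fset_set// inE; exists t.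
have sS' : s' t \in enum_fset S' by rewrite -[_ \in _]/(s' t \in S') in_fset_set// inE; exists t.
rewrite (bigD1_seq (s t))//= ?fset_uniq// (bigD1_seq (s' t))//= ?fset_uniq// -addrA.
by rewrite lerDl addr_ge0// ?sumr_ge0// => a _; rewrite sumr_ge0.
Qed.

Lemma simple_integrable s (f : V -> R) (D : set R) :
  simple_fun s -> measurable D -> (mu D < +oo)%E ->
  mu.-integrable D (EFin \o (fun t => f (s t))).
Proof. by move=> hs; exact: (simple_integrable2 (fun x _ => f x) hs hs). Qed.

(** Pairing with a vector turns the integral of a simple function into a scalar
    Lebesgue integral, from which all its properties are deduced. *)
Lemma rin_simple_integral (D : set R) s y : simple_fun s -> measurable D ->
  (mu D < +oo)%E ->
  rin y (simple_integral D s) = \int[mu]_(t in D) rin y (s t).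
Proof.
move=> hs mD Dfin; have [fs ms] := hs; rewrite /simple_integral fsbig_finite//.
set S := fset_set (range s).
have expand x : x \in S -> rin y x = \sum_(v <- S) (x == v)%:R * rin y v.
  move=> xS; rewrite (bigD1_seq x)//= ?fset_uniq// eqxx mul1r big1 ?addr0// => v.
  by rewrite eq_sym => /negbTE ->; rewrite mul0r.
have -> : \int[mu]_(t in D) rin y (s t) =
    \int[mu]_(t in D) (fun x => \sum_(v <- S) (x == v)%:R * rin y v) (s t).
  apply: eq_Rintegral => t _; apply: expand.
  by rewrite in_fset_set// inE; exists t.
move: (enum_fset S) => l.
elim: l => [|v l IH].
  rewrite big_nil; under eq_Rintegral do rewrite big_nil.
  by rewrite Rintegral_cst// mul0r rin0r.
rewrite big_cons rinDr rinZr IH.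
under [RHS]eq_Rintegral do rewrite big_cons.
have i1 := simple_integrable (fun x => (x == v)%:R * rin y v) hs mD Dfin.
have i2 := simple_integrable (fun x => \sum_(v <- l) (x == v)%:R * rin y v) hs mD Dfin.
apply: etrans (esym (RintegralD (mu := mu) mD i1 i2)).
rewrite RintegralZr//; last exact: (simple_integrable (fun x => (x == v)%:R)).
congr (_ * _ + _); rewrite /Rintegral setIC -integral_indic//; last exact: ms.
congr fine.
apply: eq_integral => t _; rewrite indicE; congr (_%:R)%:E; congr nat_of_bool.
by apply/idP/eqP; rewrite inE.
Qed.

Lemma rin_ext (x x' : V) : (forall y, rin y x = rin y x') -> x = x'.
Proof.
move=> h; apply/eqP; rewrite -subr_eq0; apply/eqP/rnorm_le0.
by apply: rnorm_le_rin => // y; rewrite rinBr h subrr mulr0.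
Qed.

Lemma itv_measure_lty (b c : bool) (x z : R) :
  (mu [set` Interval (BSide b x) (BSide c z)] < +oo)%E.
Proof. by rewrite lebesgue_measure_itv; case: ifP => _; rewrite ltry. Qed.

Lemma itv_measure (r t : R) : r <= t -> fine (mu `]r, t]) = t - r.
Proof.
move=> rt; rewrite lebesgue_measure_itv/= lte_fin.
by case: ltgtP rt => //= -> _; rewrite subrr.
Qed.

Lemma Rintegral_itv_cst (r t c : R) : r <= t ->
  \int[mu]_(q in `]r, t]) c = c * (t - r).
Proof.
move=> rt; have mD : measurable (`]r, t]%classic : set R) by exact: measurable_itv.
by rewrite -(itv_measure rt); exact: (Rintegral_cst mu mD c).
Qed.

Lemma simple_integral_itv s (r t : R) : simple_fun s -> 0 <= r -> r <= t ->
  simple_integral `[0, t] s - simple_integral `[0, r] s = simple_integral `]r, t] s.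
Proof.
move=> hs r0 rt; apply: rin_ext => y; rewrite rinBr !rin_simple_integral//;
  try exact: itv_measure_lty.
apply: (@Rintegral_itvB R (fun t => rin y (s t)) (BLeft 0) (BRight t) r);
  rewrite ?bnd_simp//.
by apply: simple_integrable => //; exact: itv_measure_lty.
Qed.

Lemma simple_integral_dist (D : set R) s s' : simple_fun s -> simple_fun s' ->
  measurable D -> (mu D < +oo)%E ->
  rnorm (simple_integral D s - simple_integral D s') <=
    \int[mu]_(t in D) rnorm (s t - s' t).
Proof.
move=> hs hs' mD Dfin; apply: rnorm_le_rin.
  by apply: Rintegral_ge0 => t _; exact: rnorm_ge0.
move=> y; rewrite rinBr !rin_simple_integral//.
have i1 := simple_integrable2 (fun x x' => rnorm (x - x')) hs hs' mD Dfin.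
have i2 f s1 (hs1 : simple_fun s1) := simple_integrable f hs1 mD Dfin.
rewrite -RintegralB ?i2// -RintegralZl//.
apply: le_Rintegral => //.
- exact: (simple_integrable2 (fun x x' => rin y x - rin y x')).
- exact: (simple_integrable2 (fun x x' => rnorm y * rnorm (x - x'))).
- by move=> t _; rewrite -rinBr; exact: rin_cs.
Qed.

Lemma simple_integral_cst (D : set R) y : measurable D -> (mu D < +oo)%E ->
  simple_integral D (fun=> y) = (fine (mu D))%:C *: y.
Proof.
move=> mD Dfin; apply: rin_ext => z; rewrite rin_simple_integral//; last exact: simple_cst.
by rewrite Rintegral_cst// rinZr mulrC.
Qed.

Record L1_approx (D : set R) w s (e : R) : Prop := {
  L1_approx_simple : simple_fun s ;
  L1_approx_integrable : mu.-integrable D (EFin \o (fun t => rnorm (w t - s t))) ;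
  L1_approx_le : \int[mu]_(t in D) rnorm (w t - s t) <= e
}.

Lemma bochner_approx (t : R) w x e : 0 < e -> bochner_integral `[0, t] w x ->
  exists2 s, L1_approx `[0, t] w s e & rnorm (x - simple_integral `[0, t] s) <= e.
Proof.
move=> e0 [s [hs ms /fine_cvgP[fin0 lim0] limI]].
have /rnorm_cvgP/(_ _ e0) hI := limI.
have /cvgrPdist_lt/(_ _ e0) h0 := lim0.
have : \forall n \near \oo, exists2 s, L1_approx `[0, t] w s e &
    rnorm (x - simple_integral `[0, t] s) <= e.
  near=> n; exists (s n); last by apply: ltW; near: n; exact: hI.
  split=> //.
    apply/integrableP; split; first by apply/measurable_EFinP; exact: ms.
    under eq_integral do rewrite /= ger0_norm ?rnorm_ge0//.
    by rewrite ltey_eq; apply/orP; left; near: n.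
  apply: (le_trans (ler_norm _)); apply: ltW.
  rewrite -normrN -[X in `|X|]add0r; near: n; exact: h0.
by case=> n _ /(_ n (leqnn n)).
Unshelve. all: by end_near. Qed.

Lemma L1_approx_dist (D : set R) w s s' a b : measurable D -> (mu D < +oo)%E ->
  L1_approx D w s a -> L1_approx D w s' b ->
  \int[mu]_(t in D) rnorm (s t - s' t) <= a + b.
Proof.
move=> mD Dfin [hs is1 sa] [hs' is2 sb].
apply: (@le_trans _ _ (\int[mu]_(t in D) (rnorm (w t - s t) + rnorm (w t - s' t)))).
  apply: (le_Rintegral (mu := mu)) => //.
  - exact: (simple_integrable2 (fun x x' => rnorm (x - x'))).
  - exact: (integrableD (mu := mu) mD is1 is2).
  - by move=> t _; rewrite (rnorm_distC (w t) (s t)); exact: rnorm_dist.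
by rewrite (RintegralD (mu := mu))//; exact: lerD.
Qed.

Lemma L1_approx_sub (D E : set R) w s e : measurable D -> measurable E ->
  E `<=` D -> L1_approx D w s e -> L1_approx E w s e.
Proof.
move=> mD mE ED [hs is1 se]; have is2 := integrableS (mu := mu) mD mE ED is1.
split=> //; apply: le_trans se; rewrite fine_le//.
- exact: (integrable_fin_num (mu := mu) mE is2).
- exact: (integrable_fin_num (mu := mu) mD is1).
apply: ge0_subset_integral => //; first by case/integrableP: is1.
by move=> t _; rewrite lee_fin rnorm_ge0.
Qed.

Lemma bochner_dist (t : R) w x s e : bochner_integral `[0, t] w x ->
  L1_approx `[0, t] w s e -> rnorm (x - simple_integral `[0, t] s) <= e.
Proof.
move=> bx se; apply/ler_addgt0Pr => f f0.
have f20 : 0 < f / 2 by rewrite divr_gt0.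
have [s' s'f xs'] := bochner_approx f20 bx.
have Dfin := itv_measure_lty true false 0 t.
have h1 := simple_integral_dist (L1_approx_simple s'f) (L1_approx_simple se)
  (measurable_itv _) Dfin.
have h2 := L1_approx_dist (measurable_itv _) Dfin s'f se.
have := rnorm_dist (simple_integral `[0, t] s') x (simple_integral `[0, t] s).
lra.
Qed.

Lemma subset_itv0 (r t : R) : r <= t -> `[0, r]%classic `<=` `[0, t]%classic.
Proof. by move=> rt; apply: subset_itvl; rewrite bnd_simp. Qed.

Section indefinite.
Variables (u v : R -> V).
Hypothesis u_v : forall t, 0 <= t -> bochner_integral `[0, t] v (u t - u 0).

Lemma indefinite_approx (T e : R) : 0 <= T -> 0 < e -> exists s, L1_approx `[0, T] v s e.
Proof. by move=> T0 e0; have [s hs _] := bochner_approx e0 (u_v T0); exists s. Qed.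

(** The increments over [0, t] and [0, r] are realised by different sequences of
    simple functions in the definition of the Bochner integral; a third simple
    function [s'], close to [v] on the whole of [0, T], serves to compare them. *)
Lemma indefinite_dist (T e r t : R) s : L1_approx `[0, T] v s e ->
  0 <= r -> r <= t -> t <= T ->
  rnorm ((u t - u r) - simple_integral `]r, t] s) <=
    \int[mu]_(q in `]r, t]) rnorm (v q - s q).
Proof.
move=> se r0 rt tT; have t0 := le_trans r0 rt.
apply/ler_addgt0Pr => f f0; have f40 : 0 < f / 4 by rewrite divr_gt0.
have [s' s'f] := indefinite_approx (le_trans t0 tT) f40.
have hs := L1_approx_simple se; have hs' := L1_approx_simple s'f.
have h q : 0 <= q -> q <= T -> rnorm (u q - u 0 - simple_integral `[0, q] s') <= f / 4.
  move=> q0 qT; apply: (bochner_dist (u_v q0)).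
  by apply: L1_approx_sub s'f => //; exact: subset_itv0.
have ht := h t t0 tT; have hr := h r r0 (le_trans rt tT).
have h1 : rnorm (u t - u r - simple_integral `]r, t] s') <= f / 2.
  rewrite -simple_integral_itv//.
  have -> : u t - u r - (simple_integral `[0, t] s' - simple_integral `[0, r] s') =
      (u t - u 0 - simple_integral `[0, t] s') - (u r - u 0 - simple_integral `[0, r] s').
    by rewrite [RHS]subrACA; congr (_ - _); rewrite opprB addrA subrK.
  have := rnormB (u t - u 0 - simple_integral `[0, t] s') (u r - u 0 - simple_integral `[0, r] s').
  lra.
have mD : measurable (`]r, t]%classic : set R) by exact: measurable_itv.
have Dfin := itv_measure_lty false false r t.
have sub : (`]r, t]%classic : set R) `<=` `[0, T]%classic.
  by apply: subset_itv; rewrite bnd_simp.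
have se' := L1_approx_sub (measurable_itv _) mD sub se.
have s'f' := L1_approx_sub (measurable_itv _) mD sub s'f.
have {}se' : L1_approx `]r, t] v s (\int[mu]_(q in `]r, t]) rnorm (v q - s q)).
  by case: se' => *; split.
have h2 := simple_integral_dist hs' hs mD Dfin.
have h3 := L1_approx_dist mD Dfin s'f' se'.
have := rnorm_dist (simple_integral `]r, t] s') (u t - u r) (simple_integral `]r, t] s).
lra.
Qed.

(** Integrals of a simple function over [0, t] are finite sums [phi_j(t) c_j], where
    [phi_j(t)] is the measure of the times in [0, t] at which the value is [c_j]. *)
Lemma indefinite_approximable : approximable u.
Proof.
move=> T e T0 e0; have [s se] := indefinite_approx (ltW T0) e0.
have hs := L1_approx_simple se; have [fs ms] := hs.
pose l : seq V := enum_fset (fset_set (range s)).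
pose c j := nth 0 l j.
pose phi j (t : R) : R := \int[mu]_(q in `[0, t]) (s q == c j)%:R.
have ind (D : set R) j : measurable D -> (mu D < +oo)%E ->
    mu.-integrable D (EFin \o (fun q => (s q == c j)%:R : R)).
  exact: (simple_integrable (fun x => (x == c j)%:R)).
have phiE j (t : R) : phi j t = fine (mu (`[0, t] `&` s @^-1` [set c j])).
  rewrite /phi /Rintegral setIC -integral_indic//; last exact: ms.
  congr fine; apply: eq_integral => q _; rewrite indicE; congr (_%:R)%:E.
  by congr nat_of_bool; apply/eqP/idP; rewrite inE.
have rE t : ramps (size l) c phi t = simple_integral `[0, t] s.
  rewrite /simple_integral fsbig_finite// -/l (big_nth 0) big_mkord.
  by apply: eq_bigr => j _; rewrite phiE.
have fb (r t : R) : 0 <= r -> r <= t -> t <= T ->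
    \int[mu]_(q in `[0, t]) rnorm (v q - s q) - \int[mu]_(q in `[0, r]) rnorm (v q - s q) =
    \int[mu]_(q in `]r, t]) rnorm (v q - s q).
  move=> r0 rt tT.
  apply: (@Rintegral_itvB R (fun q => rnorm (v q - s q)) (BLeft 0) (BRight t) r);
    rewrite ?bnd_simp//.
  by apply: (integrableS (mu := mu) _ _ _ (L1_approx_integrable se)) => //; exact: subset_itv0.
exists (size l), c, phi, (fun t => \int[mu]_(q in `[0, t]) rnorm (v q - s q)); split.
- move=> j r t r0 rt tT.
  have -> : phi j t - phi j r = \int[mu]_(q in `]r, t]) (s q == c j)%:R.
    apply: (@Rintegral_itvB R (fun q => (s q == c j)%:R) (BLeft 0) (BRight t) r);
      rewrite ?bnd_simp//.
    by apply: ind => //; exact: itv_measure_lty.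
  apply/andP; split; first by apply: Rintegral_ge0 => q _; rewrite ler0n.
  apply: (@le_trans _ _ (\int[mu]_(q in `]r, t]) 1)).
    apply: (le_Rintegral (mu := mu)) => //.
    - by apply: ind => //; exact: itv_measure_lty.
    - apply: (simple_integrable (fun=> 1) hs) => //; exact: itv_measure_lty.
    - by move=> q _; rewrite lern1 leq_b1.
  by rewrite Rintegral_itv_cst// mul1r.
- move=> r t r0 rt tT; rewrite subrACA !rE simple_integral_itv// fb//.
  exact: indefinite_dist se r0 rt tT.
- rewrite set_itv1 Rintegral_set1 subr0.
  exact: L1_approx_le se.
Qed.

(** The increment of [u] is compared with the integral of the constant [v t]
    through a simple function close to [v] in [L^1]. *)
Lemma indefinite_derivative : continuous_on v -> derivative_on u v.
Proof.
move=> cv t t0 e e0; have [d d0 hd] := cv t t0 e e0.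
have key (lo hi : R) : 0 <= lo -> lo <= hi -> t - d < lo -> hi < t + d ->
    rnorm (u hi - u lo - (hi - lo)%:C *: v t) <= e * (hi - lo).
  move=> lo0 lohi tlo hit; apply/ler_addgt0Pr => f f0.
  have hi0 := le_trans lo0 lohi; have f20 : 0 < f / 2 by rewrite divr_gt0.
  have [s sf] := indefinite_approx hi0 f20.
  have hs := L1_approx_simple sf.
  have h1 := indefinite_dist sf lo0 lohi (lexx _).
  have mD : measurable (`]lo, hi]%classic : set R) by exact: measurable_itv.
  have Dfin := itv_measure_lty false false lo hi.
  have sub : (`]lo, hi]%classic : set R) `<=` `[0, hi]%classic.
    by apply: subset_itv; rewrite bnd_simp.
  have sf' := L1_approx_sub (measurable_itv _) mD sub sf.
  have h2 := simple_integral_dist hs (simple_cst (v t)) mD Dfin.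
  rewrite simple_integral_cst// itv_measure// in h2.
  have h3 : \int[mu]_(q in `]lo, hi]) rnorm (s q - v t) <= f / 2 + e * (hi - lo).
    have ie : mu.-integrable `]lo, hi] (EFin \o (fun q : R => e)).
      exact: (simple_integrable (fun=> e) hs mD Dfin).
    apply: (@le_trans _ _ (\int[mu]_(q in `]lo, hi]) (rnorm (v q - s q) + e))).
      apply: (le_Rintegral (mu := mu)) => //.
      - exact: (simple_integrable (fun x => rnorm (x - v t)) hs mD Dfin).
      - exact: (integrableD (mu := mu) mD (L1_approx_integrable sf') ie).
      move=> q /=; rewrite in_itv/= => /andP[loq qhi].
      apply: (le_trans (rnorm_dist (v q) _ _)); rewrite rnorm_distC lerD2l.
      by apply: hd; [lra | rewrite ltr_norml; lra].
    rewrite (RintegralD (mu := mu))//; last exact: L1_approx_integrable sf'.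
    by rewrite lerD ?(L1_approx_le sf')// Rintegral_itv_cst.
  have h4 := L1_approx_le sf'.
  have := rnorm_dist (simple_integral `]lo, hi] s) (u hi - u lo) ((hi - lo)%:C *: v t).
  lra.
exists d => // s s0; rewrite ltr_norml => std.
have [st|/ltW ts] := leP t s.
  by rewrite ger0_norm ?subr_ge0//; apply: key => //; lra.
rewrite -rnormN opprB distrC ger0_norm ?subr_ge0//.
have -> : (s - t)%:C *: v t - (u s - u t) = u t - u s - (t - s)%:C *: v t.
  by rewrite opprB addrC -(opprB t s) rmorphN scaleNr.
by apply: key => //; lra.
Qed.

End indefinite.

End bochner.

(** * Calculus on the half-line *)

Section half_line_calculus.
Variables (R : realType).

Lemma derivative_onP (X : hilbertType R) (a da : R -> X) :
  derivative_ge0 a da <-> derivative_on a da.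
Proof.
have E s t : s != t -> rnorm (da t - ((s - t)^-1)%:C *: (a s - a t)) * `|s - t| =
    rnorm (a s - a t - (s - t)%:C *: da t).
  move=> st; rewrite mulrC -rnormZ scalerBr scalerA -rmorphM/= mulfV ?subr_eq0//.
  by rewrite rmorph1 scale1r rnorm_distC.
split=> h t t0.
  move=> e e0; have /rnorm_cvgP/(_ e e0) := h t t0.
  rewrite near_withinE near_withinE => /nbhs_ballP[d /= d0 hd].
  exists d => // s s0 std; have [->|st] := eqVneq s t.
    by rewrite !subrr normr0 mulr0 scale0r subr0 rnorm0.
  rewrite -E// ler_wpM2r//; apply: ltW; apply: hd => //.
  by rewrite -ball_normE /= distrC.
apply/rnorm_cvgP => e e0; have e20 : 0 < e / 2 by rewrite divr_gt0.
have [d d0 hd] := h t t0 _ e20.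
rewrite near_withinE near_withinE; apply/nbhs_ballP; exists d => //= s.
rewrite -ball_normE /= distrC => std st s0; have := hd s s0 std.
rewrite -E// ler_pM2r ?normr_gt0 ?subr_eq0//; lra.
Qed.

Lemma continuous_onD (V : normedModType R[i]) (f g : R -> V) :
  continuous_on f -> continuous_on g -> continuous_on (fun t => f t + g t).
Proof.
move=> hf hg t t0 e e0; have e20 : 0 < e / 2 by rewrite divr_gt0.
have [d d0 h1] := hf t t0 _ e20; have [d' d'0 h2] := hg t t0 _ e20.
exists (Num.min d d'); first by rewrite lt_min d0 d'0.
move=> s s0; rewrite lt_min => /andP[sd sd']; rewrite subrDD.
by apply: (le_trans (rnormD _ _)); have := h1 s s0 sd; have := h2 s s0 sd'; lra.
Qed.

Lemma continuous_on_linear (V W : normedModType R[i]) (L : {linear V -> W}) C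
    (f : R -> V) : 0 < C -> (forall x, rnorm (L x) <= C * rnorm x) ->
  continuous_on f -> continuous_on (fun t => L (f t)).
Proof.
move=> C0 LC hf t t0 e e0; have [d d0 h] := hf t t0 _ (divr_gt0 e0 C0).
exists d => // s s0 sd; rewrite -linearB; apply: (le_trans (LC _)).
by rewrite mulrC -ler_pdivlMr// h.
Qed.

Lemma derivative_onD (V : normedModType R[i]) (f g df dg : R -> V) :
  derivative_on f df -> derivative_on g dg ->
  derivative_on (fun t => f t + g t) (fun t => df t + dg t).
Proof.
move=> hf hg t t0 e e0; have e20 : 0 < e / 2 by rewrite divr_gt0.
have [d d0 h1] := hf t t0 _ e20; have [d' d'0 h2] := hg t t0 _ e20.
exists (Num.min d d'); first by rewrite lt_min d0 d'0.
move=> s s0; rewrite lt_min => /andP[sd sd']; rewrite scalerDr (subrDD (f s)) (subrDD (f s - f t)).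
by apply: (le_trans (rnormD _ _)); have := h1 s s0 sd; have := h2 s s0 sd'; lra.
Qed.

Lemma derivative_on_linear (V W : normedModType R[i]) (L : {linear V -> W}) C
    (f df : R -> V) : 0 < C -> (forall x, rnorm (L x) <= C * rnorm x) ->
  derivative_on f df -> derivative_on (fun t => L (f t)) (fun t => L (df t)).
Proof.
move=> C0 LC hf t t0 e e0; have [d d0 h] := hf t t0 _ (divr_gt0 e0 C0).
exists d => // s s0 sd.
have -> : L (f s) - L (f t) - (s - t)%:C *: L (df t) =
    L (f s - f t - (s - t)%:C *: df t) by rewrite -(linearZ_LR L) !(raddfB L).
apply: (le_trans (LC _)); have := h s s0 sd.
by rewrite -(ler_pM2l C0) mulrA mulrCA divff ?mulr1 ?gt_eqF// mulrC.
Qed.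

Lemma derivative_onB (V : normedModType R[i]) (f g df dg : R -> V) :
  derivative_on f df -> derivative_on g dg ->
  derivative_on (fun t => f t - g t) (fun t => df t - dg t).
Proof.
move=> hf hg; apply: derivative_onD => //.
move=> t t0 e e0; have [d d0 h] := hg t t0 e e0; exists d => // s s0 sd.
by rewrite scalerN -!opprD rnormN; exact: h.
Qed.

Lemma derivative_on_continuous (V : normedModType R[i]) (f df : R -> V) :
  derivative_on f df -> continuous_on f.
Proof.
move=> hf t t0 e e0; have [d d0 h] := hf t t0 1 ltr01.
set C := rnorm (df t) + 1.
have C0 : 0 < C by rewrite /C; have := rnorm_ge0 (df t); lra.
exists (Num.min d (e / C)); first by rewrite lt_min d0 divr_gt0.
move=> s s0; rewrite lt_min ltr_pdivlMr// => /andP[sd se].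
have := h s s0 sd; have := rnormD (f s - f t - (s - t)%:C *: df t) ((s - t)%:C *: df t).
rewrite subrK rnormZ; move: se; rewrite /C; lra.
Qed.

Lemma constant_of_derivative0 (phi : R -> R) (T : R) : 0 <= T ->
  (forall t, 0 <= t -> forall e, 0 < e -> exists2 d, 0 < d &
     forall s, 0 <= s -> `|s - t| < d -> `|phi s - phi t| <= e * `|s - t|) ->
  phi T = phi 0.
Proof.
move=> T0 h.
have der (x : R) : x \in `]0, T[%R -> is_derive x 1 phi 0.
  rewrite in_itv/= => /andP[x0 xT].
  have lim : (fun r => r^-1 *: (phi (r *: 1 + x) - phi x)) @ 0^' --> (0 : R).
    apply/cvgrPdist_le => e e0; have [d d0 hd] := h x (ltW x0) e e0.
    rewrite near_withinE; apply/nbhs_ballP; exists (Num.min d x) => /=.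
      by rewrite lt_min d0 x0.
    move=> r; rewrite -ball_normE /= sub0r normrN lt_min => /andP[rd rx] r0.
    rewrite sub0r normrN normrM normfV mulrC ler_pdivrMr ?normr_gt0//.
    have -> : r *: (1 : R) + x = x + r by rewrite addrC /GRing.scale/= mulr1.
    have := hd (x + r); rewrite addrAC subrr add0r; apply => //.
    by move: rx; rewrite ltr_norml; lra.
  by apply: DeriveDef; [exact: cvgP lim | exact: cvg_lim lim].
have cont : {within `[0, T], continuous phi}.
  apply/subspace_continuousP => x /=; rewrite in_itv/= => /andP[x0 xT].
  apply/cvgrPdist_le => e e0; have [d d0 hd] := h x x0 1 ltr01.
  rewrite near_withinE; apply/nbhs_ballP; exists (Num.min d e) => /=.
    by rewrite lt_min d0 e0.
  move=> r; rewrite -ball_normE /= distrC lt_min => /andP[rd re].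
  rewrite in_itv/= => /andP[r0 _].
  rewrite distrC; apply: (le_trans (hd r r0 rd)).
  by rewrite mul1r ltW.
have [c _] := MVT_segment T0 der cont.
by rewrite mul0r => /eqP; rewrite subr_eq0 => /eqP.
Qed.

(** The derivative of [(a, Q a)] is [2 (Q a, a')], which vanishes; [Q] is
    coercive, so the energy controls the norm. *)
Lemma energy_conservation (V : hilbertType R) (Q : {linear V -> V})
    (Q_cont : continuous Q)
    (Q_selfadjoint : forall x y, inner x (Q y) = inner (Q x) y)
    (Q_posdef : exists2 c : R, 0 < c & forall x, c%:C * `|x| ^+ 2 <= inner x (Q x))
    (a da : R -> V) : derivative_on a da ->
  (forall t, 0 <= t -> rin (Q (a t)) (da t) = 0) -> a 0 = 0 ->
  forall t, 0 <= t -> a t = 0.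
Proof.
move=> hd h0 a0 T T0.
have [c c0 hc] := coercive_rin Q_posdef.
have [C C0 hC] := continuous_rbounded Q_cont.
have expand x y : rin (y + x) (Q (y + x)) - rin x (Q x) =
    2 * rin (Q x) y + rin y (Q y).
  rewrite linearD !rinDr !rinDl (rin_selfadjoint Q_selfadjoint x y).
  by rewrite (rinC y (Q x)); ring.
have : rin (a T) (Q (a T)) = rin (a 0) (Q (a 0)).
  apply: (constant_of_derivative0 (phi := fun t => rin (a t) (Q (a t)))) => // t t0 e e0.
  set A := rnorm (Q (a t)); set B := rnorm (da t) + 1.
  have A0 : 0 <= A by exact: rnorm_ge0.
  have B0 : 0 < B by rewrite /B; have := rnorm_ge0 (da t); lra.
  pose e1 := Num.min 1 (e / 4 / (A + 1)).
  have e10 : 0 < e1 by rewrite lt_min ltr01 !divr_gt0//; lra.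
  have [d d0 hs] := hd t t0 _ e10.
  have CB0 : 0 < C * B ^+ 2 by rewrite mulr_gt0// exprn_gt0.
  exists (Num.min d (e / 2 / (C * B ^+ 2))); first by rewrite lt_min d0 !divr_gt0.
  move=> s s0; rewrite lt_min => /andP[/(hs _ s0) rs se].
  set x := a t; set D := a s - x; set q := `|s - t| in rs se *.
  have q0 : 0 <= q by exact: normr_ge0.
  have -> : rin (a s) (Q (a s)) - rin x (Q x) = 2 * rin (Q x) D + rin D (Q D).
    by rewrite -expand subrK.
  have DE : rin (Q x) D = rin (Q x) (D - (s - t)%:C *: da t).
    by rewrite rinBr rinZr h0// mulr0 subr0.
  have e1l : e1 <= 1 by rewrite ge_min lexx.
  have h1 : `|rin (Q x) D| <= e / 4 * q.
    have e1A : A * e1 <= e / 4.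
      apply: (@le_trans _ _ ((A + 1) * (e / 4 / (A + 1)))); last first.
        by rewrite mulrC divfK// gt_eqF//; lra.
      by apply: ler_pM => //; [exact: ltW|lra|rewrite ge_min lexx orbT].
    have cs y : rin (Q x) y <= A * rnorm y by exact: rin_cs.
    have l1 := cs (D - (s - t)%:C *: da t); have := cs (- (D - (s - t)%:C *: da t)).
    rewrite rinNr rnormN -DE; rewrite -DE in l1 => l2.
    have := ler_wpM2l A0 rs; have := ler_wpM2r q0 e1A.
    rewrite ler_norml; lra.
  have h2 : `|rin D (Q D)| <= e / 2 * q.
    have Dq : rnorm D <= B * q.
      have := rnormD (D - (s - t)%:C *: da t) ((s - t)%:C *: da t).
      have := ler_wpM2r q0 e1l.
      rewrite subrK rnormZ -/q /B; lra.
    have l0 : 0 <= rin D (Q D).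
      by apply: le_trans (hc D); rewrite mulr_ge0 ?(ltW c0)// exprn_ge0// rnorm_ge0.
    rewrite ger0_norm//; apply: (le_trans (rin_cs _ _)).
    apply: (@le_trans _ _ (C * (rnorm D * rnorm D))).
      by rewrite mulrCA ler_wpM2l ?rnorm_ge0.
    apply: (@le_trans _ _ (C * ((B * q) * (B * q)))).
      by rewrite ler_pM2l// ler_pM ?rnorm_ge0.
    have -> : C * (B * q * (B * q)) = C * B ^+ 2 * q * q by ring.
    apply: ler_wpM2r => //; rewrite mulrC -ler_pdivlMr//; exact: ltW.
  have := ler_normD (2 * rin (Q x) D) (rin D (Q D)).
  by rewrite normrM (ger0_norm (ler0n _ 2)); lra.
rewrite a0 linear0 => h; have := hc (a T); rewrite h.
rewrite rin0r pmulr_rle0// => aT.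
apply: rnorm_eq0; apply/eqP; rewrite -sqrf_eq0; apply/eqP/le_anti.
by rewrite aT exprn_ge0// rnorm_ge0.
Qed.

End half_line_calculus.

(** * Norms of products, graphs and duals *)

Section norms.
Variable R : realType.

Lemma hprod_rnorm (V W : normedModType R[i]) (x : hprod V W) :
  rnorm x ^+ 2 = rnorm x.1 ^+ 2 + rnorm x.2 ^+ 2.
Proof.
by apply: complexI; rewrite rmorphD !rmorphXn/= !rnormE hprod_normE hypot_sqr.
Qed.

Lemma graph_rnorm (V W : normedModType R[i]) (T : operator V W) (z : graph_space T) :
  rnorm z ^+ 2 = rnorm (val z) ^+ 2 + rnorm (T (val z)) ^+ 2.
Proof.
by apply: complexI; rewrite rmorphD !rmorphXn/= !rnormE graph_normE hypot_sqr.
Qed.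

Lemma sqr_sum_le (a b c : R) : 0 <= a -> 0 <= b -> 0 <= c ->
  c ^+ 2 = a ^+ 2 + b ^+ 2 -> c <= a + b.
Proof.
move=> a0 b0 c0 h; rewrite -(@ler_pXn2r _ 2) ?nnegrE ?addr_ge0// h sqrrD.
by have := mulr_ge0 a0 b0; lra.
Qed.

Lemma hprod_rnorm_le (V W : normedModType R[i]) (x : hprod V W) :
  rnorm x <= rnorm x.1 + rnorm x.2.
Proof. by apply: sqr_sum_le (hprod_rnorm x); exact: rnorm_ge0. Qed.

Lemma graph_rnorm_le (V W : normedModType R[i]) (T : operator V W) (z : graph_space T) :
  rnorm z <= rnorm (val z) + rnorm (T (val z)).
Proof. by apply: sqr_sum_le (graph_rnorm z); exact: rnorm_ge0. Qed.

Lemma hprod_rnorm1 (V W : normedModType R[i]) (x : hprod V W) : rnorm x.1 <= rnorm x.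
Proof.
rewrite -(@ler_pXn2r _ 2) ?nnegrE ?rnorm_ge0// hprod_rnorm.
by rewrite lerDl exprn_ge0// rnorm_ge0.
Qed.

Lemma hprod_rnorm2 (V W : normedModType R[i]) (x : hprod V W) : rnorm x.2 <= rnorm x.
Proof.
rewrite -(@ler_pXn2r _ 2) ?nnegrE ?rnorm_ge0// hprod_rnorm.
by rewrite lerDr exprn_ge0// rnorm_ge0.
Qed.

Lemma graph_rnorm1 (V W : normedModType R[i]) (T : operator V W) (z : graph_space T) :
  rnorm (val z) <= rnorm z.
Proof.
rewrite -(@ler_pXn2r _ 2) ?nnegrE ?rnorm_ge0// graph_rnorm.
by rewrite lerDl exprn_ge0// rnorm_ge0.
Qed.

Lemma dual_rnorm_le (V : normedModType R[i]) (f : dual V) (M : R) : 0 <= M ->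
  (forall x, rnorm (f x) <= M * rnorm x) -> rnorm f <= M.
Proof.
move=> M0 fM; rewrite /rnorm dual_normE /dual_norm/=.
apply: ge_sup.
  by exists (complex.Re `|f 0|), 0 => //=; rewrite normr0 ler01.
move=> _ [x /= x1 <-]; apply: (le_trans (fM x)).
rewrite -[leRHS]mulr1 ler_wpM2l//.
by rewrite -lecR rnormE rmorph1.
Qed.

Lemma dual_rnorm_apply (V : normedModType R[i]) (f : dual V) x :
  rnorm (f x) <= rnorm f * rnorm x.
Proof.
have [M M0 fM] := continuous_rbounded (f := f) (@dual_continuous _ _ f).
have [x0|x0] := eqVneq (rnorm x) 0.
  by rewrite (rnorm_eq0 x0) linear0 !rnorm0 mulr0.
have {}x0 : 0 < rnorm x by rewrite lt0r x0 rnorm_ge0.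
rewrite -ler_pdivrMr// [leRHS]/rnorm dual_normE /dual_norm/=.
apply: ub_le_sup.
  exists M => _ [y /= y1 <-]; apply: (le_trans (fM y)).
  rewrite -[leRHS]mulr1 ler_wpM2l ?(ltW M0)//.
  by rewrite -lecR rnormE rmorph1.
exists ((rnorm x)^-1%:C *: x) => /=.
  rewrite -rnormE -(rmorph1 (real_complex R)) lecR rnormZ ger0_norm ?invr_ge0 ?rnorm_ge0//.
  by rewrite mulVf// gt_eqF.
transitivity (rnorm ((rnorm x)^-1%:C *: (f x : R[i]^o))); first by rewrite linearZ.
by rewrite rnormZ ger0_norm ?invr_ge0 ?rnorm_ge0// mulrC.
Qed.

Lemma flow_dist (X : hilbertType R) (U Y : normedModType R[i])
    (T : operator (hprod X U) Y) (x x' : X) (v v' : dual U) :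
  rnorm (flow T x v - flow T x' v') <= rnorm (x - x') + rnorm (v - v').
Proof.
apply: dual_rnorm_le => [|e]; first by rewrite addr_ge0// rnorm_ge0.
have -> : (flow T x v - flow T x' v') e =
    (inner (x - x') (val e).1 : R[i]^o) + (v - v') (val e).2.
  rewrite /= subrDD; congr (_ + _).
  by rewrite innerC innerBr rmorphB/= -!innerC.
apply: (le_trans (rnormD _ _)); rewrite mulrDl; apply: lerD.
  apply: (@le_trans _ _ (rnorm (x - x') * rnorm (val e).1)).
    by rewrite -lecR rmorphM/= !rnormE; exact: cauchy_schwarz.
  rewrite ler_wpM2l ?rnorm_ge0//.
  by apply: (le_trans (hprod_rnorm1 _)); exact: graph_rnorm1.
apply: (le_trans (dual_rnorm_apply _ _)).
rewrite ler_wpM2l ?rnorm_ge0//.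
by apply: (le_trans (hprod_rnorm2 _)); exact: graph_rnorm1.
Qed.

End norms.

(** * The extrapolation space *)

Section extrapolation.
Variables (R : realType) (V : hilbertType R) (T : operator V V).
Hypothesis T_skew : skew_adjoint T.
Variable Xm1 : completion (resolvent_norm T).
Variable Text : {linear V -> Xm1}.
Hypothesis Text_cont : continuous Text.
Hypothesis TextE : forall x, op_dom T x -> Text x = cpl_emb Xm1 (T x).
Local Notation emb := (cpl_emb Xm1).

(** [(x, T x) = - (T x, x)], so its real part is zero. *)
Lemma skew_adjoint_rin x : op_dom T x -> rin x (T x) = 0.
Proof.
move=> dx; case: T_skew => _ adj.
have : [set p | graph T (p.1, - p.2)] (x, - T x) by split; rewrite //= opprK.
rewrite -adj => /(_ x dx)/= h; have : rin x (T x) = rin (- T x) x by rewrite /rin h.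
rewrite rinNl (rinC (T x)); lra.
Qed.

(** If [g] were outside the range of [I - T], its resolvent would take the default
    value [0] and [g] would have norm [0] in the completion; [g] would then be [0],
    which lies in the range. *)
Lemma extrapolation_range g : exists2 x, op_dom T x & x - T x = g.
Proof.
have [//|none] := pselect (exists2 x, op_dom T x & x - T x = g).
have g0 : g = 0.
  apply: (@cpl_emb_inj _ _ _ Xm1); rewrite linear0; apply/normr0_eq0.
  rewrite cpl_emb_norm /resolvent_norm /resolvent1; case: xgetP.
    by move=> x _ [dx xg]; exfalso; apply: none; exists x.
  by rewrite normr0.
by exists 0; [exact: op_dom0 | rewrite op0 subr0 g0].
Qed.

Lemma rnorm_emb x : op_dom T x -> rnorm (emb (x - T x)) = rnorm x.
Proof.
move=> dx; rewrite /rnorm cpl_emb_norm /resolvent_norm /resolvent1.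
case: xgetP => [z _ [dz zE]|/(_ x)[]//]; congr (complex.Re `|_|).
apply/eqP; rewrite -subr_eq0; apply/eqP/rnorm_le0.
apply: (le_trans (skew_rnorm_le skew_adjoint_rin (op_domB dz dx))).
by rewrite opB// subrACA zE subrr rnorm0.
Qed.

Lemma rnorm_emb_le x : rnorm (emb x) <= rnorm x.
Proof.
have [z dz <-] := extrapolation_range x; rewrite rnorm_emb//.
exact: (skew_rnorm_le skew_adjoint_rin dz).
Qed.

(** [I - T] is isometric from [dom T] into the completion by definition of the
    norm there; the inequality extends to the whole space by density. *)
Lemma extrapolation_lower x : rnorm x <= rnorm (emb x - Text x).
Proof.
have [C C0 hC] := continuous_rbounded Text_cont.
apply/ler_addgt0Pr => e e0; have e1 : 0 < e / (C + 2) by rewrite divr_gt0//; lra.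
have [d dd xd] := rnorm_dense x T_skew.1 e1.
have h1 := rnormD (x - d) d; rewrite subrK in h1.
have h2 : rnorm d = rnorm (emb d - Text d) by rewrite TextE// -linearB rnorm_emb.
have h3 := rnormB (emb x - Text x) (emb (x - d) - Text (x - d)).
have E : emb x - Text x - (emb (x - d) - Text (x - d)) = emb d - Text d.
  by rewrite subrACA -!linearB subKr.
have h4 := rnormB (emb (x - d)) (Text (x - d)).
have h5 := rnorm_emb_le (x - d); have h6 := hC (x - d).
rewrite E in h3.
have h7 : (C + 2) * rnorm (x - d) <= e.
  by rewrite mulrC -ler_pdivlMr ?ltW//; lra.
lra.
Qed.

Lemma extrapolation_inj x y : emb x - Text x = emb y - Text y -> x = y.
Proof.
move=> xy; apply/eqP; rewrite -subr_eq0; apply/eqP/rnorm_le0.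
apply: (le_trans (extrapolation_lower _)).
by rewrite (raddfB Text) (raddfB emb) subrACA xy subrr rnorm0.
Qed.

Lemma extrapolation_dom x g : Text x = emb g -> op_dom T x.
Proof.
move=> xg; have [y dy yE] := extrapolation_range (x - g).
by rewrite (@extrapolation_inj x y)// (TextE dy) xg -!linearB yE.
Qed.

End extrapolation.

(** * The boundary control system *)

Section boundary_control.
Variables (R : realType) (X1 X2 U1 U2 : hilbertType R).
Variables (L : operator X1 X2) (K : operator X2 X1).
Variables (gamma1 : {linear graph_space L -> U1}).
Variables (gamma2 : {linear graph_space K -> U2}).
Variables (beta1 : {linear graph_space L -> dual U2}).
Variables (beta2 : {linear graph_space K -> dual U1}).
Local Notation X := (hprod X1 X2).
Local Notation U := (hprod U1 U2).
Local Notation Z := (hprod (graph_space L) (graph_space K)).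
Local Notation MA := (A gamma1 gamma2).
Local Notation G := (G gamma1 gamma2).
Local Notation J := (J L K).
Implicit Types (z : Z) (x : X).

Lemma ZvalP a z z' : Zval (a *: z + z') = a *: Zval z + Zval z'.
Proof. congr pair; exact: (linearP (val : graph_space _ -> _)). Qed.

Lemma ZvalB z z' : Zval (z - z') = Zval z - Zval z'.
Proof. by rewrite addrC -scaleN1r ZvalP scaleN1r addrC. Qed.

Lemma ZvalD z z' : Zval (z + z') = Zval z + Zval z'.
Proof. by have := ZvalP 1 z z'; rewrite !scale1r. Qed.

Lemma GP a z z' : G (a *: z + z') = a *: G z + G z'.
Proof. by rewrite /Defs.G /= !linearP. Qed.

Lemma GB z z' : G (z - z') = G z - G z'.
Proof. by rewrite addrC -scaleN1r GP scaleN1r addrC. Qed.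

Lemma GD z z' : G (z + z') = G z + G z'.
Proof. by have := GP 1 z z'; rewrite !scale1r. Qed.

Lemma JP a z z' : J (Zval (a *: z + z')) = a *: J (Zval z) + J (Zval z').
Proof.
rewrite ZvalP /Defs.J /= !op_linear; try exact: graph_space_dom.
by rewrite opprD -scalerN.
Qed.

Lemma JB z z' : J (Zval (z - z')) = J (Zval z) - J (Zval z').
Proof. by rewrite addrC -scaleN1r JP scaleN1r addrC. Qed.

Lemma JD z z' : J (Zval (z + z')) = J (Zval z) + J (Zval z').
Proof. by have := JP 1 z z'; rewrite !scale1r. Qed.

Lemma toZK z : toZ L K (Zval z) = z.
Proof. by case: z => z1 z2; rewrite /toZ /= !valKd. Qed.

Lemma rnorm_Z z : rnorm z <= rnorm (Zval z) + rnorm (J (Zval z)).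
Proof.
apply: sqr_sum_le; rewrite ?rnorm_ge0// !hprod_rnorm /= !graph_rnorm rnormN.
by rewrite addrACA [X in _ + X]addrC.
Qed.

Lemma C_bounded : continuous beta1 -> continuous beta2 ->
  exists2 c : R, 0 < c & forall z z',
    rnorm (C beta1 beta2 z - C beta1 beta2 z') <= c * rnorm (z - z').
Proof.
move=> /continuous_rbounded[c1 c10 h1] /continuous_rbounded[c2 c20 h2].
exists (c1 + c2) => [|z z']; first by rewrite addr_gt0.
apply: dual_rnorm_le => [|v].
  by rewrite mulr_ge0 ?rnorm_ge0// addr_ge0// ltW.
have -> : (C beta1 beta2 z - C beta1 beta2 z') v =
   beta2 (z - z').2 v.1 + beta1 (z - z').1 v.2.
  by rewrite /= !linearB /= subrDD.
apply: (le_trans (rnormD _ _)).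
have b2 : rnorm (beta2 (z - z').2 v.1) <= c2 * rnorm (z - z') * rnorm v.
  apply: (le_trans (dual_rnorm_apply _ _)); apply: ler_pM; rewrite ?rnorm_ge0//.
    by apply: (le_trans (h2 _)); rewrite ler_pM2l// hprod_rnorm2.
  exact: hprod_rnorm1.
have b1 : rnorm (beta1 (z - z').1 v.2) <= c1 * rnorm (z - z') * rnorm v.
  apply: (le_trans (dual_rnorm_apply _ _)); apply: ler_pM; rewrite ?rnorm_ge0//.
    by apply: (le_trans (h1 _)); rewrite ler_pM2l// hprod_rnorm1.
  exact: hprod_rnorm2.
rewrite mulrDl mulrDl; lra.
Qed.

Hypothesis gamma1_onto : range gamma1 = [set: U1].
Hypothesis gamma2_onto : range gamma2 = [set: U2].

Lemma G_onto u : exists z, G z = u.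
Proof.
have : [set: U1] u.1 by []. rewrite -gamma1_onto => -[z1 _ z1E].
have : [set: U2] u.2 by []. rewrite -gamma2_onto => -[z2 _ z2E].
by exists (z1, z2); rewrite /Defs.G /= z1E z2E; case: u {z1E z2E}.
Qed.

Hypothesis A_skew : skew_adjoint MA.
Variable Xm1 : completion (resolvent_norm MA).
Variable Aext : {linear X -> Xm1}.
Hypothesis Aext_cont : continuous Aext.
Hypothesis AextE : forall x, op_dom MA x -> Aext x = cpl_emb Xm1 (MA x).
Variable B : {linear U -> Xm1}.
Hypothesis B_cont : continuous B.
Hypothesis B_control : forall z,
  cpl_emb Xm1 (J (Zval z)) = Aext (Zval z) + B (G z).
Local Notation emb := (cpl_emb Xm1).
Local Notation node := (node Aext B).

Lemma A_dom z : G z = 0 -> op_dom MA (Zval z).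
Proof. by move=> Gz; exists z. Qed.

(** If [(x, u)] is in the domain of the node and [z0] lifts [u], then [x - Zval z0]
    has an image by the extended operator that lies in [X], so it belongs to
    [dom A]. *)
Lemma node_dom x u : op_dom node (x, u) <-> exists2 z, Zval z = x & G z = u.
Proof.
split=> [[g _ gE0]|[z <- <-]]; last by exists (J (Zval z)); rewrite //= B_control.
have gE : emb (g : X) = Aext x + B u := gE0.
have [z0 z0u] := G_onto u.
have [|z /= Gz zE] := extrapolation_dom A_skew Aext_cont AextE (x := x - Zval z0)
    (g := g - J (Zval z0)).
  rewrite (linearB emb) gE B_control z0u (linearB Aext).
  by rewrite opprD addrACA subrr addr0.
exists (z + z0); first by rewrite ZvalD zE subrK.
by rewrite GD Gz add0r.
Qed.

Lemma node_val z : node (Zval z, G z) = J (Zval z).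
Proof.
rewrite /Defs.node /=; apply: (@cpl_emb_inj _ _ _ Xm1); rewrite B_control.
by case: xgetP => [x _ //|/(_ (J (Zval z)))[]]; exact: B_control.
Qed.

(** [l u] is the solution of [(I - A|X) (l u) = B u]. It is obtained from any [z1]
    with trace [u] by subtracting the element of [dom A] with the same image by
    [I - J]; its bound comes from that of [B] and from [extrapolation_lower]. *)
Lemma lifting : exists (l : {linear U -> X}) (c : R),
  [/\ 0 < c, forall u, rnorm (l u) <= c * rnorm u &
  forall u, exists z, [/\ Zval z = l u, G z = u & J (Zval z) = Zval z]].
Proof.
have : forall u, exists x, exists z, [/\ Zval z = x, G z = u & J (Zval z) = Zval z].
  move=> u; have [z1 z1u] := G_onto u.
  have [_ [z2 /= Gz2 <-] z2E] := extrapolation_range Xm1 (Zval z1 - J (Zval z1)).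
  exists (Zval (z1 - z2)), (z1 - z2); split=> //; first by rewrite GB Gz2 subr0.
  rewrite JB ZvalB; apply/eqP; rewrite eq_sym -subr_eq0 subrACA subr_eq0.
  by apply/eqP; exact: (esym z2E).
move=> /choice[l' l'P].
have l'E u : emb (l' u) - Aext (l' u) = B u.
  by have [z [<- <- {1}<-]] := l'P u; rewrite B_control addrAC subrr add0r.
have l'lin : linear l'.
  move=> a u v; apply: (extrapolation_inj A_skew Aext_cont AextE).
  rewrite l'E linearP -!l'E (linearP emb) (linearP Aext).
  by rewrite scalerBr subrDD.
have [l lE] := exists_linear l'lin; have [c c0 hc] := continuous_rbounded B_cont.
exists l, c; split => // u; last by rewrite lE; exact: l'P.
rewrite lE; apply: (le_trans (extrapolation_lower A_skew Aext_cont AextE _)).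
by rewrite l'E; exact: hc.
Qed.

Lemma A_rin x : op_dom MA x -> rin x (MA x) = 0.
Proof. exact: skew_adjoint_rin. Qed.

Variable Q : {linear X -> X}.
Hypothesis Q_cont : continuous Q.
Hypothesis Q_selfadjoint : forall x y, inner x (Q y) = inner (Q x) y.
Hypothesis Q_posdef : exists2 c : R, 0 < c &
     forall x, c%:C * `|x| ^+ 2 <= inner x (Q x).

(** The solution is [b + P (l u)], where [b] solves the Cauchy problem for [A Q]
    with forcing [l u - P (l u')]. *)
Lemma state_exists (alpha0 : X) (u : R -> U) : H2loc u ->
  op_dom node (Q alpha0, u 0) ->
  exists a da : R -> X, [/\ a 0 = alpha0, derivative_on a da, continuous_on da,
    continuous_on u &
    forall t, 0 <= t -> exists z, [/\ Zval z = Q (a t), G z = u t & J (Zval z) = da t]].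
Proof.
move=> [v [w [[_ uv] [_ vw]]]] /node_dom[z0 z0E z0u].
have va := indefinite_approximable vw; have ua := indefinite_approximable uv.
have vc := approximable_continuous va; have du := indefinite_derivative uv vc.
have [l [c [c0 lc lz]]] := lifting.
have [P [m [C [[m0 C0 PK QK] [hC hm]]]]] := coercive_inverse Q_cont Q_posdef.
have N_norm := energy_norm_equivalent Q_cont Q_selfadjoint Q_posdef.
have M_diss := precomp_m_dissipative Q_cont Q_selfadjoint Q_posdef A_skew.1 A_rin
  (extrapolation_range Xm1).
have lva := approximable_linear c0 lc va; have lua := approximable_linear c0 lc ua.
have NP x : rnorm ((\- P) x) <= C * rnorm x by rewrite rnormN; exact: hC.
pose f t := l (u t) + (\- P) (l (v t)).
have fa : approximable f.
  by apply: approximableD lua _; exact: (approximable_linear C0 NP lva).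
have dom0 : op_dom (precomp Q MA) (alpha0 - P (l (u 0))).
  have [z [zl zu _]] := lz (u 0).
  suff : op_dom MA (Q (alpha0 - P (l (u 0)))) by [].
  rewrite (linearB Q) PK -z0E -zl -ZvalB.
  by apply: A_dom; rewrite GB z0u zu subrr.
have [b [db [b0 bM dbc bd]]] := cauchy_problem_solution N_norm M_diss dom0 fa.
exists (fun t => b t + P (l (u t))), (fun t => db t + P (l (v t))); split.
- by rewrite b0 subrK.
- apply: derivative_onD => //.
  exact: (derivative_on_linear C0 hC (derivative_on_linear c0 lc du)).
- apply: continuous_onD => //.
  exact: (continuous_on_linear C0 hC (continuous_on_linear c0 lc vc)).
- exact: derivative_on_continuous du.
move=> t t0; have [db' dbE] := bM t t0.
have [zb /= Gzb zbE] := db'.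
have [z [zl zu zJ]] := lz (u t).
exists (zb + z); split.
- by rewrite ZvalD zbE zl linearD PK.
- by rewrite GD Gzb zu add0r.
have JE : J (Zval zb) = precomp Q MA (b t) by rewrite zbE.
rewrite JD zJ zl dbE JE /f.
have -> : (\- P) (l (v t)) = - P (l (v t)) by [].
by rewrite -!addrA addNr addr0.
Qed.

Lemma node_element z : exists e : graph_space node, val e = (Zval z, G z).
Proof.
have e_dom : ((Zval z, G z) : hprod X U) \in @dom_pred R (hprod X U) X node.
  by rewrite unfold_in /dom_pred inE; apply/node_dom; exists z.
by exists (@GraphSpace R (hprod X U) X node _ e_dom).
Qed.

Lemma A_dense_orth x : (forall d, op_dom MA d -> inner x d = 0) -> x = 0.
Proof.
move=> xd; apply/rnorm_le0/ler_addgt0Pr => e e0; rewrite add0r.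
have [d dd de] := rnorm_dense x A_skew.1 e0.
have [->|x0] := eqVneq (rnorm x) 0; first exact: ltW.
have {}x0 : 0 < rnorm x by rewrite lt0r x0 rnorm_ge0.
rewrite -(ler_pM2l x0) -expr2 -rin_norm.
have -> : rin x x = rin x (x - d) by rewrite rinBr {3}/rin xd// subr0.
by apply: (le_trans (rin_cs _ _)); rewrite ler_pM2l// ltW.
Qed.

(** Testing on the pairs [(x, 0)] with [x] in [dom A], which is dense, identifies
    the first components; surjectivity of [G] then identifies the second ones. *)
Lemma flow_inj x x' (v v' : dual U) : flow node x v = flow node x' v' ->
  x = x' /\ v = v'.
Proof.
move=> E; have Ez z : inner x (Zval z) + v (G z) = inner x' (Zval z) + v' (G z).
  have [e eE] := node_element z; have := congr1 (fun f : dual (graph_space node) => f e) E.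
  by rewrite /= eE.
have xx : x = x'.
  apply/eqP; rewrite -subr_eq0; apply/eqP/A_dense_orth => _ [z Gz <-].
  have := Ez z; rewrite Gz !linear0 !addr0 => xz.
  by rewrite innerC innerBr rmorphB/= -!innerC xz subrr.
split=> //; apply: val_inj; apply/funext => r; have [z <-] := G_onto r.
by have := Ez z; rewrite xx => /addrI.
Qed.

Lemma trajectory_state a y (u : R -> U) :
  trajectory (stokes_dirac beta1 beta2 Aext B) Q u a y ->
  exists2 da, derivative_on a da & forall t, 0 <= t ->
    exists z, [/\ Zval z = Q (a t), G z = u t, J (Zval z) = da t &
      y t = C beta1 beta2 z].
Proof.
move=> [da [/derivative_onP ada [p [pD _ pE]]]]; exists da => // t t0.
have [e _ eE] := pD t t0; have [] := pE t t0; rewrite -eE /= => eF eV0.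
have eV : val e = (Q (a t), u t) := eV0.
have /node_dom[z zE zG] : op_dom node (Q (a t), u t).
  by rewrite -eV; exact: graph_space_dom.
exists z; move: eF; rewrite /calJ eV -zE -zG node_val toZK => /flow_inj[-> yE].
by split=> //; apply/esym/oppr_inj.
Qed.

Lemma trajectory_unique a y a' y' (u : R -> U) :
  trajectory (stokes_dirac beta1 beta2 Aext B) Q u a y ->
  trajectory (stokes_dirac beta1 beta2 Aext B) Q u a' y' -> a' 0 = a 0 ->
  forall t, 0 <= t -> a' t = a t /\ y' t = y t.
Proof.
move=> /trajectory_state[da ada az] /trajectory_state[da' ada' az'] a0.
have aE t : 0 <= t -> a' t = a t.
  move=> t0; apply/eqP; rewrite -subr_eq0; apply/eqP.
  apply: (energy_conservation Q_cont Q_selfadjoint Q_posdef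
    (derivative_onB ada' ada)) t0; last by rewrite a0 subrr.
  move=> s s0; have [z [zE zG zJ _]] := az s s0; have [z' [zE' zG' zJ' _]] := az' s s0.
  rewrite (linearB Q) -zE -zE' -zJ -zJ' -ZvalB -JB.
  by apply: A_rin; apply: A_dom; rewrite GB zG zG' subrr.
move=> t t0; have [z [zE _ _ ->]] := az t t0; have [z' [zE' _ _ ->]] := az' t t0.
by split; [exact: aE | rewrite -(toZK z) -(toZK z') zE zE' aE].
Qed.

Lemma trajectory_exists (alpha0 : X) (u : R -> U) :
  continuous beta1 -> continuous beta2 -> H2loc u -> op_dom node (Q alpha0, u 0) ->
  exists a y, trajectory (stokes_dirac beta1 beta2 Aext B) Q u a y /\ a 0 = alpha0.
Proof.
move=> b1 b2 u2 compat.
have [a [da [a0 ada dac uc az]]] := state_exists u2 compat.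
have [CQ CQ0 hQ] := continuous_rbounded Q_cont.
have Qac := continuous_on_linear CQ0 hQ (derivative_on_continuous ada).
have [c c0 hc] := C_bounded b1 b2.
pose y t := C beta1 beta2 (toZ L K (Q (a t))).
have /choice[E EE] : forall t, exists e : graph_space node,
    0 <= t -> val e = (Q (a t), u t).
  move=> t; have [t0|t0] := leP 0 t; last by exists 0.
  by have [z [<- <- _]] := az t t0; have [e eE] := node_element z; exists e.
have nE t : 0 <= t -> node (Q (a t), u t) = da t.
  by move=> t0; have [z [<- <- <-]] := az t t0; exact: node_val.
exists a, y; split=> //; exists da; split; first exact/derivative_onP.
exists (fun t => (flow node (da t) (- y t), E t)); split.
- move=> t t0; exists (E t) => //; rewrite /calJ (EE t t0) /=.
  by rewrite -(nE t t0).
- apply/subspace_continuousP => t; rewrite /= in_itv/= andbT => t0.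
  have near_of (P : R -> Prop) (d : R) : 0 < d ->
      (forall s, 0 <= s -> `|s - t| < d -> P s) ->
      \forall s \near within `[0, +oo[%classic (nbhs t), P s.
    move=> d0 hd; rewrite near_withinE; apply/nbhs_ballP; exists d => //= s.
    by rewrite -ball_normE /= distrC in_itv/= andbT => sd s0; exact: hd.
  have cont (W : normedModType R[i]) (f : R -> W) (c' : R) : 0 < c' ->
      (forall s, 0 <= s -> rnorm (f t - f s) <=
        c' * (rnorm (Q (a s) - Q (a t)) + rnorm (u s - u t) + rnorm (da s - da t))) ->
      f @ within `[0, +oo[%classic (nbhs t) --> f t.
    move=> c'0 hf; apply/rnorm_cvgP => e e0.
    have e40 : 0 < e / c' / 4 by rewrite !divr_gt0.
    have [d1 d10 h1] := Qac t t0 _ e40; have [d2 d20 h2] := uc t t0 _ e40.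
    have [d3 d30 h3] := dac t t0 _ e40.
    apply: (near_of _ (Num.min d1 (Num.min d2 d3))).
      by rewrite !lt_min d10 d20 d30.
    move=> s s0; rewrite !lt_min => /and3P[s1 s2 s3].
    apply: (le_lt_trans (hf s s0)); rewrite mulrC -ltr_pdivlMr//.
    have := h1 s s0 s1; have := h2 s s0 s2; have := h3 s s0 s3.
    have : 0 < e / c' by rewrite divr_gt0.
    lra.
  have hF : (fun s => flow node (da s) (- y s)) @ within `[0, +oo[%classic (nbhs t)
      --> flow node (da t) (- y t).
    apply: (cont _ (fun s => flow node (da s) (- y s)) (1 + c)) => [|s s0].
      by rewrite addr_gt0.
    apply: (le_trans (flow_dist _ _ _ _ _)).
    have [z [zE zG zJ]] := az t t0; have [z' [zE' zG' zJ']] := az s s0.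
    have -> : - y t - - y s = y s - y t by rewrite opprK addrC.
    rewrite (rnorm_distC (da t)).
    have : rnorm (y s - y t) <= c * (rnorm (Q (a s) - Q (a t)) + rnorm (da s - da t)).
      rewrite /y -zE -zE' !toZK; apply: (le_trans (hc _ _)); rewrite ler_pM2l//.
      by apply: (le_trans (rnorm_Z _)); rewrite ZvalB JB zJ zJ'.
    have := mulr_ge0 (ltW c0) (rnorm_ge0 (u s - u t)).
    have := rnorm_ge0 (u s - u t); have := rnorm_ge0 (Q (a s) - Q (a t)).
    lra.
  have hE : E @ within `[0, +oo[%classic (nbhs t) --> E t.
    apply: (cont _ E 1) => // s s0; rewrite mul1r (rnorm_distC (E t)).
    apply: (le_trans (graph_rnorm_le _)).
    have -> : val (E s - E t) = val (E s) - val (E t) by exact: raddfB.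
    rewrite opB; try exact: graph_space_dom.
    rewrite !EE// !nE//; apply: lerD => //.
    exact: hprod_rnorm_le.
  exact: (cvg_pair hF hE).
by move=> t t0; split=> //; exact: EE.
Qed.

End boundary_control.

Theorem theorem4 (R : realType) (X1 X2 U1 U2 : hilbertType R)
  (L : operator X1 X2) (K : operator X2 X1)
  (L_closed : closed_op L) (L_dense : dense (op_dom L))
  (K_closed : closed_op K) (K_dense : dense (op_dom K))
  (gamma1 : {linear graph_space L -> U1}) (gamma1_cont : continuous gamma1)
  (gamma2 : {linear graph_space K -> U2}) (gamma2_cont : continuous gamma2)
  (beta1 : {linear graph_space L -> dual U2}) (beta1_cont : continuous beta1)
  (beta2 : {linear graph_space K -> dual U1}) (beta2_cont : continuous beta2)
  (green : forall (e1 : graph_space L) (e2 : graph_space K),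
     inner (L (val e1)) (val e2) =
     inner (val e1) (K (val e2)) + Num.conj (beta2 e2 (gamma1 e1))
       + beta1 e1 (gamma2 e2))
  (gamma1_onto : range gamma1 = [set: U1])
  (gamma2_onto : range gamma2 = [set: U2])
  (ker1_dense : dense [set val z | z in [set z | gamma1 z = 0]])
  (ker2_dense : dense [set val z | z in [set z | gamma2 z = 0]])
  (beta_onto :
     (dense [set val z | z in [set z | gamma1 z = 0 /\ beta1 z = 0]] /\
      [set beta1 z | z in [set z | gamma1 z = 0]] = [set: dual U2])
     \/
     (dense [set val z | z in [set z | gamma2 z = 0 /\ beta2 z = 0]] /\
      [set beta2 z | z in [set z | gamma2 z = 0]] = [set: dual U1]))
  (A_skew : skew_adjoint (A gamma1 gamma2))
  (Xm1 : completion (resolvent_norm (A gamma1 gamma2)))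
  (Aext : {linear hprod X1 X2 -> Xm1}) (Aext_cont : continuous Aext)
  (AextE : forall x, op_dom (A gamma1 gamma2) x ->
     Aext x = cpl_emb Xm1 (A gamma1 gamma2 x))
  (B : {linear hprod U1 U2 -> Xm1}) (B_cont : continuous B)
  (B1_comp : forall u1 : U1, cpl_comp2 Xm1 (B (u1, 0)))
  (B2_comp : forall u2 : U2, cpl_comp1 Xm1 (B (0, u2)))
  (B_control : forall z : hprod (graph_space L) (graph_space K),
     cpl_emb Xm1 (J L K (Zval z)) = Aext (Zval z) + B (G gamma1 gamma2 z))
  (Q : {linear hprod X1 X2 -> hprod X1 X2}) (Q_cont : continuous Q)
  (Q_selfadjoint : forall x y, inner x (Q y) = inner (Q x) y)
  (Q_posdef : exists2 c : R, 0 < c &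
     forall x, c%:C * `|x| ^+ 2 <= inner x (Q x))
  (alpha0 : hprod X1 X2) (u : R -> hprod U1 U2) (u_H2 : H2loc u)
  (compat : op_dom (node Aext B) (Q alpha0, u 0)) :
  exists (alpha : R -> hprod X1 X2) (y : R -> dual (hprod U1 U2)),
    [/\ trajectory (stokes_dirac beta1 beta2 Aext B) Q u alpha y,
        alpha 0 = alpha0 &
        forall (alpha' : R -> hprod X1 X2) (y' : R -> dual (hprod U1 U2)),
          trajectory (stokes_dirac beta1 beta2 Aext B) Q u alpha' y' ->
          alpha' 0 = alpha0 ->
          forall t, 0 <= t -> alpha' t = alpha t /\ y' t = y t].
Proof.
have [a [y [tr a0]]] := trajectory_exists gamma1_onto gamma2_onto A_skew Aext_cont
  AextE B_cont B_control Q_cont Q_selfadjoint Q_posdef beta1_cont beta2_cont u_H2 compat.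
exists a, y; split=> // a' y' tr' a0'.
apply: (trajectory_unique gamma1_onto gamma2_onto A_skew Aext_cont
  AextE B_control Q_cont Q_selfadjoint Q_posdef tr tr').
by rewrite a0' a0.
Qed.
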